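(* Let $\theta\ne0$ and let $\mathbf X=(X_1(t),X_2(t),\ldots)_{t\ge0}$ be an OU type growth-fragmentation process with characteristics $(\sigma,c,\nu,\theta)$ starting from $(1,0,0,\ldots)$, with cumulant $\kappa$. For every $t\ge0$, every $\alpha\ge0$ with $\kappa(\alpha)<\infty$, and every $q\ge\alpha(1\vee e^{\theta t})$, $$\mathbb E\Big[\sum_{i=1}^\infty X_i(t)^q\Big]=\exp\Big(\int_0^t\kappa(qe^{-\theta s})\,ds\Big).$$
   Context: Conventions: $e^{-\infty}:=0$, $\log 0:=-\infty$, $s^q:=0$ if $s=0$ and $e^{qr}:=0$ if $r=-\infty$, for every $q\ge0$ (including $q=0$). $c_o^{\downarrow}$ is the space of decreasing nonnegative sequences converging to $0$. $\mathcal S:=\{\mathbf s=(s_1,s_2,\ldots): s_1\ge s_2\ge\cdots\ge0,\ \sum_i s_i\le1\}$. OU type processes. A spectrally negative Lévy process $\xi$ with characteristics $(\sigma,c,\Lambda,k)$ ($\sigma\ge0$, $c\in\mathbb R$, $k\ge0$ the killing rate, $\Lambda$ a measure on $(-\infty,0)$ with $\int(|y|^2\wedge1)\Lambda(dy)<\infty$) satisfies $\mathbb E[e^{q\xi(t)}]=e^{t\Phi(q)}$, $t,q\ge0$, with $\Phi(q)=-k+\frac12\sigma^2q^2+cq+\int_{(-\infty,0)}(e^{qy}-1+q(1-e^y))\Lambda(dy)$. For $\theta\in\mathbb R$, the OU type process with characteristics $(\Phi,\theta)$ started from $z$ is $Z(t)=e^{-\theta t}z+\int_0^te^{-\theta(t-s)}d\xi(s)$,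 with $Z(t)=-\infty$ from the killing time of $\xi$ on. Branching processes with finite birth-intensity. Let $\mathcal R:=\{\mathbf r=(r_1,r_2,\ldots):0\ge r_1\ge r_2\ge\cdots\ge-\infty,\ \sum_ie^{r_i}\le1\}$, $\#\mathbf r:=\sup\{i\ge1:r_i>-\infty\}$ ($\sup\emptyset=0$), $\mathcal R_1:=\{\mathbf r\in\mathcal R:\#\mathbf r=1\}$. Let $\theta\in\mathbb R,\sigma\ge0,c\in\mathbb R$ and $\mu$ a sigma-finite measure on $\mathcal R$ with (a) $\mu(\{(0,-\infty,-\infty,\ldots)\})=0$, $\int_{\mathcal R}(1-e^{r_1})^2\mu(d\mathbf r)<\infty$, and (b) $\int_{\mathcal R\setminus\mathcal R_1}\#\mathbf r\,\mu(d\mathbf r)<\infty$. Let $\mathbb U=\bigcup_{n\ge0}\mathbb N^n$ and take three independent families: i.i.d. exponential variables $(\lambda_u)_{u\in\mathbb U}$ of parameter $\mu(\mathcal R\setminus\mathcal R_1)$; i.i.d. OU type processes $(Z_u)_{u\in\mathbb U}$ started from $0$ with characteristics $(\psi,\theta)$, $\psi(q)=\frac12\sigma^2q^2+\big(c+\int_{\mathcal R\setminus\mathcal R_1}(1-e^{r_1})\mu(d\mathbf r)\big)q+\int_{\mathcal R_1}(e^{qr_1}-1+q(1-e^{r_1}))\mu(d\mathbf r)$; i.i.d. sequences $(\Delta a_{ui},i\in\mathbb N)_{u\in\mathbb U}$ of law $\mu(\cdot\mid\mathcal R\setminus\mathcal R_1)$. Put $a_\emptyset=b_\emptyset=0$ and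 $a_{ui}=e^{-\theta\lambda_u}a_u+Z_u(\lambda_u)+\Delta a_{ui}$, $b_{ui}=b_u+\lambda_u$; individuals with $a_u=-\infty$, and their descendants, are ignored. The OU type branching Markov process with characteristics $(\sigma,c,\mu,\theta)$ is the multiset-valued process $\mathcal Z(t)=\{\!\{e^{-\theta(t-b_u)}a_u+Z_u(t-b_u):u\in\mathbb U,\ b_u\le t<b_u+\lambda_u\}\!\}$, $t\ge0$. Truncation and the general case. For $\ell\ge0$ and $\mathbf r\in\mathcal R$ let $\mathbf r^{(\ell)}:=(r_1,r_2^{(\ell)},r_3^{(\ell)},\ldots)$ with $r^{(\ell)}=r$ if $r>-\ell$ and $-\infty$ otherwise, and let $\mu^{(\ell)}$ be the image of $\mu$ by $\mathbf r\mapsto\mathbf r^{(\ell)}$. Cutting at level $\ell$ means removing, with all their descendants, the individuals $ui$ with $i\ge2$ and $\Delta a_{ui}\le-\ell$. If only (a) holds, each $\mu^{(\ell)}$ satisfies (a) and (b), and one can build on one probability space processes $(\mathcal Z^{(\ell)})_{\ell\ge0}$ such that $\mathcal Z^{(\ell)}$ has characteristics $(\sigma,c,\mu^{(\ell)},\theta)$ and, for $\ell'<\ell$, cutting $\mathcal Z^{(\ell)}$ at level $\ell'$ gives $\mathcal Z^{(\ell')}$. The OU type branching Markov process with characteristics $(\sigma,c,\mu,\theta)$ is the increasing union $\mathcal Z(t)=\biguplus_{\ell\ge0}\mathcal Z^{(\ell)}(t)$. OU type growth-fragmentation. Let $\sigma\ge0$, $c,\theta\in\mathbb R$ and $\nu$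 a sigma-finite measure on $\mathcal S$ with $\nu(\{(1,0,\ldots)\})=0$ and $\int_{\mathcal S}(1-s_1)^2\nu(d\mathbf s)<\infty$. Let $\mu$ be the image of $\nu$ by $(s_1,s_2,\ldots)\mapsto(\log s_1,\log s_2,\ldots)$ and $\mathcal Z$ the OU type branching Markov process with characteristics $(\sigma,c,\mu,\theta)$. The OU type growth-fragmentation with characteristics $(\sigma,c,\nu,\theta)$ started from $(1,0,0,\ldots)$ is the decreasing rearrangement (completed by zeros) $\mathbf X(t)=(X_1(t),X_2(t),\ldots)\in c_o^\downarrow$ of $\{\!\{e^z:z\in\mathcal Z(t)\}\!\}$. Its cumulant is $\kappa(q)=\frac12\sigma^2q^2+cq+\int_{\mathcal S}\big(\sum_{i\ge1}s_i^q-1+q(1-s_1)\big)\nu(d\mathbf s)\in(-\infty,\infty]$, $q\ge0$; the set $\{q\ge 0:\kappa(q)<\infty\}$ is a right-unbounded interval containing $[2,\infty)$. *)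

(* Defs.v *)
From HB Require Import structures.
From mathcomp Require Import all_boot all_order all_algebra finmap.
From mathcomp Require Import all_classical all_reals all_analysis.
From mathcomp Require Import measurable_realfun.

Set Implicit Arguments.
Unset Strict Implicit.
Unset Printing Implicit Defensive.

Import Order.TTheory GRing.Theory Num.Theory.
Import numFieldNormedType.Exports.

Local Open Scope classical_set_scope.
Local Open Scope ring_scope.

(* The library has 0 `^ 0 = 1; here 0 ^ q = 0 for every q >= 0, including 0. *)
Definition pow0 (R : realType) (x q : R) : R :=
  if x == 0 then 0 else x `^ q.

(* e^(q r) with value 0 at r = -oo, even for q = 0; it is only meant for
   r < +oo. *)
Definition exp_at (R : realType) (q : R) (r : \bar R) : R :=
  if r is r'%:E then expR (q * r') else 0.

Definition g_sigma_family d (T : measurableType d) (A I : Type) (D : set I)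
    (f : I -> A -> T) : set (set A) :=
  <<s \bigcup_(i in D) preimage_set_system setT (f i) measurable >>.

Definition seqspace d (T : measurableType d) :=
  g_sigma_algebraType
    (\bigcup_(i in [set: nat])
       preimage_set_system [set: nat -> T] (fun s => s i) measurable).

Definition independent_events d (Omega : measurableType d) (R : realType)
    (P : probability Omega R) (G H : set (set Omega)) : Prop :=
  forall A B, G A -> H B -> (P (A `&` B) = P A * P B)%E.

Definition mutually_independent d (Omega : measurableType d) (R : realType)
    (P : probability Omega R) (I : choiceType) (F : I -> set (set Omega)) :
    Prop :=
  forall (J : {fset I}) (E : I -> set Omega),
    (forall i, i \in J -> F i (E i)) ->
    (P (\bigcap_(i in [set` J]) E i) = \prod_(i <- J) P (E i))%E.

Definition cadlag (R : realType) (f : R -> R) : Prop :=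
  (forall t, 0 <= t -> f s @[s --> t^'+] --> f t) /\
  (forall t, 0 < t -> cvg (f s @[s --> t^'-])).

Definition no_positive_jumps (R : realType) (f : R -> R) : Prop :=
  forall t, 0 < t -> f t <= lim (f s @[s --> t^'-]).

(* Spectrally negative Levy process with Laplace exponent Phi, without killing
   (i.e. Phi 0 = 0). Only the times t >= 0 are meaningful. *)
Definition spectrally_negative_levy d (Omega : measurableType d)
    (R : realType) (P : probability Omega R) (Phi : R -> R)
    (xi : R -> Omega -> R) : Prop :=
  (forall t, 0 <= t -> measurable_fun setT (xi t)) /\
  (\forall w \ae P, [/\ xi 0 w = 0, cadlag (xi ^~ w) &
                        no_positive_jumps (xi ^~ w)]) /\
  (forall s t, 0 <= s -> s <= t ->
     independent_events P
       (g_sigma_family [set r | 0 <= r <= s] xi)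
       (preimage_set_system setT (fun w => xi t w - xi s w) measurable)) /\
  (forall s t, 0 <= s -> s <= t -> forall B : set R, measurable B ->
     P ((fun w => xi t w - xi s w) @^-1` B) = P (xi (t - s) @^-1` B)) /\
  (forall q t, 0 <= q -> 0 <= t ->
     (\int[P]_w (expR (q * xi t w))%:E = (expR (t * Phi q))%:E)%E).

(* I is the Riemann-Stieltjes integral of f with respect to dg over [a, b].
   The partition is a < s_0 < ... < s_(n-1) = b and c i is a tag of its i-th
   interval; when f is continuous of bounded variation and g is cadlag, a jump
   of g at b is counted and a jump at a is not. *)
Definition is_RS_integral (R : realType) (f g : R -> R) (a b I : R) : Prop :=
  forall e, 0 < e -> exists2 delta, 0 < delta &
    forall (s : seq R) (c : nat -> R), itv_partition a b s ->
      (forall i, (i < size s)%N ->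
         nth b (a :: s) i <= c i <= nth b s i /\
         nth b s i - nth b (a :: s) i < delta) ->
      `| \sum_(i < size s) f (c i) * (g (nth b s i) - g (nth b (a :: s) i))
         - I | < e.

(* Z(t) = e^(- theta t) z + \int_0^t e^(- theta (t - s)) dxi(s), where the
   integrand is deterministic and smooth, so that the integral is pathwise. *)
Definition OU_type_process d (Omega : measurableType d)
    (R : realType) (P : probability Omega R) (Phi : R -> R) (theta z : R)
    (Z : R -> Omega -> R) : Prop :=
  (forall t, 0 <= t -> measurable_fun setT (Z t)) /\
  exists2 xi, spectrally_negative_levy P Phi xi &
    \forall w \ae P, forall t, 0 <= t ->
      is_RS_integral (fun s => expR (- theta * (t - s))) (xi ^~ w) 0 t
        (Z t w - expR (- theta * t) * z).

(* Sequences indexed by i >= 1 in the mathematics are indexed by i : nat here,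
   with i standing for i + 1. *)

Section sequences.
Context {R : realType}.

Definition mass_partitions : set (seqspace R) :=
  [set s | [/\ forall i, s i.+1 <= s i, forall i, 0 <= s i &
               (\sum_(i <oo) (s i)%:E <= 1)%E]].

Definition log_partitions : set (seqspace (\bar R)) :=
  [set r | [/\ forall i, (r i.+1 <= r i)%E, (r 0%N <= 0)%E &
               (\sum_(i <oo) (exp_at 1 (r i))%:E <= 1)%E]].

Definition log_seq (s : seqspace R) : seqspace (\bar R) :=
  fun i => lne (s i)%:E.

(* #r; the element 0 realizes the convention sup set0 = 0. *)
Definition nb_finite (r : seqspace (\bar R)) : \bar R :=
  ereal_sup (0%E |` [set i.+1%:R%:E | i in [set i | (-oo < r i)%E]]).

Definition log_partitions1 : set (seqspace (\bar R)) :=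
  log_partitions `&` [set r | nb_finite r = 1%E].

Definition branching_partitions : set (seqspace (\bar R)) :=
  log_partitions `\` log_partitions1.

Definition truncate_seq (l : R) (r : seqspace (\bar R)) : seqspace (\bar R) :=
  fun i => if (i == 0)%N || ((- l)%:E < r i)%E then r i else -oo%E.

End sequences.

Section characteristics.
Context {R : realType}.
Variables (sigma c : R) (mu : set (seqspace (\bar R)) -> \bar R).

Definition branching_rate : \bar R := mu branching_partitions.

(* A measure on log_partitions is a measure on the space of all sequences that
   does not charge the complement of log_partitions. *)
Definition finite_birth_measure : Prop :=
  [/\ sigma_finite setT mu, mu (~` log_partitions) = 0%E,
      mu [set (fun i => if i == 0%N then 0%E else -oo%E)] = 0%E,
      (\int[mu]_(r in log_partitions) ((1 - exp_at 1 (r 0%N)) ^+ 2)%:E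
         < +oo)%E &
      (\int[mu]_(r in branching_partitions) nb_finite r < +oo)%E].

Definition psi (q : R) : R :=
  2^-1 * sigma ^+ 2 * q ^+ 2
  + (c + fine (\int[mu]_(r in branching_partitions)
                 (1 - exp_at 1 (r 0%N))%:E)%E) * q
  + fine (\int[mu]_(r in log_partitions1)
            (exp_at q (r 0%N) - 1 + q * (1 - exp_at 1 (r 0%N)))%:E)%E.

End characteristics.

(* A word u of the Ulam-Harris tree is written with its last letter first, and
   letters start at 0: the (i+1)-th child of u is i :: u, the root is [::]. *)
Record branching_family d (Omega : measurableType d) (R : realType) :=
    BranchingFamily {
  lifetime : seq nat -> Omega -> \bar R ;
  motion : seq nat -> R -> Omega -> R ;
  dislocation : seq nat -> Omega -> seqspace (\bar R) }.

Section branching.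
Context d (Omega : measurableType d) (R : realType) (P : probability Omega R).

Definition family_sigma (F : branching_family Omega R)
    (k : seq nat + (seq nat + seq nat)) : set (set Omega) :=
  match k with
  | inl u => preimage_set_system setT (lifetime F u) measurable
  | inr (inl u) => g_sigma_family [set t | 0 <= t] (motion F u)
  | inr (inr u) => preimage_set_system setT (dislocation F u) measurable
  end.

(* The branching rate m may be 0: then the exponential variables are almost
   surely infinite and the conditional law of mu is left arbitrary. *)
Definition OU_branching_family (sigma c : R)
    (mu : set (seqspace (\bar R)) -> \bar R) (theta : R)
    (F : branching_family Omega R) : Prop :=
  finite_birth_measure mu /\
  mutually_independent P (family_sigma F) /\
  (forall u, measurable_fun setT (lifetime F u) /\
     forall t, 0 <= t ->
       P [set w | (t%:E < lifetime F u w)%E] =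
         expeR (- (t%:E * branching_rate mu))%E) /\
  (forall u, OU_type_process P (psi sigma c mu) theta 0 (motion F u)) /\
  (forall u, measurable_fun setT (dislocation F u) /\
     forall A : set (seqspace (\bar R)), measurable A ->
       (branching_rate mu * P (dislocation F u @^-1` A) =
          mu (A `&` branching_partitions))%E).

Variables (theta : R) (F : branching_family Omega R) (w : Omega).

Fixpoint birth_time (u : seq nat) : \bar R :=
  if u is i :: v then (birth_time v + lifetime F v w)%E else 0%E.

(* When v never dies, the value for its children is irrelevant, since their
   birth time is +oo. *)
Fixpoint birth_place (u : seq nat) : \bar R :=
  if u is i :: v then
    let x := fine (lifetime F v w) in
    ((expR (- theta * x))%:E * birth_place v
     + (motion F v x w)%:E + dislocation F v w i)%E
  else 0%E.

Definition alive (t : R) : set (seq nat) :=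
  [set u | [/\ birth_place u != -oo%E, (birth_time u <= t%:E)%E &
               (t%:E < birth_time u + lifetime F u w)%E]].

Definition position (t : R) (u : seq nat) : R :=
  let x := t - fine (birth_time u) in
  expR (- theta * x) * fine (birth_place u) + motion F u x w.

Fixpoint kept (l : R) (u : seq nat) : Prop :=
  if u is i :: v then
    kept l v /\ (i = 0%N \/ ((- l)%:E < dislocation F v w i)%E)
  else True.

(* A multiset of reals is given by its multiplicities, in {0, 1, ..., +oo}. *)
Definition population (t : R) : R -> \bar R :=
  fun z => counting [set u | alive t u /\ position t u = z].

Definition cut_population (l t : R) : R -> \bar R :=
  fun z => counting [set u | [/\ kept l u, alive t u & position t u = z]].

End branching.

Section general.
Context d (Omega : measurableType d) (R : realType) (P : probability Omega R).

Definition OU_branching_process (sigma c : R)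
    (mu : set (seqspace (\bar R)) -> \bar R) (theta : R)
    (Z : R -> Omega -> R -> \bar R) : Prop :=
  exists F : R -> branching_family Omega R,
    [/\ forall l, 0 <= l ->
          OU_branching_family P sigma c (pushforward mu (truncate_seq l)) theta
            (F l),
        \forall w \ae P, forall l' l, 0 <= l' -> l' < l ->
          forall t, 0 <= t ->
            cut_population theta (F l) w l' t = population theta (F l') w t &
        forall t w, 0 <= t ->
          Z t w = fun z =>
            ereal_sup [set population theta (F l) w t z | l in [set l | 0 <= l]]
    ].

(* x is the decreasing rearrangement, completed by zeros, of the multiset
   {{e^z : z in m}}, and it belongs to c_0. *)
Definition exp_rearrangement (m : R -> \bar R) (x : nat -> R) : Prop :=
  [/\ nonincreasing_seq x, forall i, 0 <= x i, x i @[i --> \oo] --> 0 &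
      forall y, 0 < y -> counting [set i | x i = y] = m (ln y)].

Definition OU_growth_fragmentation (sigma c : R)
    (nu : set (seqspace R) -> \bar R) (theta : R)
    (X : R -> nat -> Omega -> R) : Prop :=
  exists2 Z, OU_branching_process sigma c (pushforward nu log_seq) theta Z &
    \forall w \ae P, forall t, 0 <= t ->
      exp_rearrangement (Z t w) (fun i => X t i w).

End general.

Definition cumulant (R : realType) (sigma c : R)
    (nu : set (seqspace R) -> \bar R) (q : R) : \bar R :=
  ((2^-1 * sigma ^+ 2 * q ^+ 2 + c * q)%:E
   + \int[nu]_(s in mass_partitions)
       (\sum_(i <oo) (pow0 (s i) q)%:E - 1 + (q * (1 - s 0%N))%:E))%E.

(* Main.v *)
(** Truncate first: suppose that the dislocation measure has finite birth
    intensity [m]. Along an ancestral line nothing but an OU type motion and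
    discounted dislocations contribute to the position at time [t]: a
    displacement [x] made at time [s] contributes [e^(- theta (t - s)) x], hence
    a factor [e^(p_s x)] with [p_s = q e^(- theta (t - s))]. With [K' = psi(p_s)]
    and [L' = M(p_s)], where [M p] is [m] times the mean of [sum_i e^(p Delta a_i)],
    induction on the generation gives that the [k]-th generation contributes
      [e^(K t - K 0 - m t) (L t - L 0)^k / k!]
    to the expectation of [sum e^(q z)]; summing over [k] yields the exponential
    of the integral of [psi - m + M], which is the cumulant of the truncated
    measure. When the truncation level increases, the truncated cumulants
    increase to [kappa] and the truncated populations increase almost surely to
    the whole population, so that monotone convergence on the one hand and Fatou's
    lemma on the other hand give the result, whether or not [kappa] is finite. *)

From HB Require Import structures.
Require Import Defs.
From mathcomp Require Import all_boot all_order all_algebra finmap.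
From mathcomp Require Import all_classical all_reals all_analysis.
From mathcomp Require Import measurable_realfun.
From mathcomp Require Import lra ring.

Set Implicit Arguments.
Unset Strict Implicit.
Unset Printing Implicit Defensive.

Import Order.TTheory GRing.Theory Num.Theory.
Import numFieldNormedType.Exports.

Local Open Scope classical_set_scope.
Local Open Scope ring_scope.

(** * Independence *)

(** The discounted exponent makes an ancestral line multiplicative: [discounted theta t q (b + l) *
    expR (- theta * l)] is again the discounted exponent at [b], so the weight of a child is the
    weight of its parent times factors of the parent's own variables. With [K] and [L] primitives in
    absolute time, the motions along a line contribute in the mean [expR (K t - K 0)] whatever the
    branching times, and the integrals over these times reduce to an iterated integral of the
    derivative of [L]. The obstacle is measurability: a motion is evaluated at a random lifetime
    while its paths are regular only almost surely, and independence is given for sigma-algebras.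
    Hence jointly measurable modifications, and spaces carrying the sigma-algebra of a subfamily, on
    which Tonelli's theorem averages one variable at a time with the others frozen. In the cumulant
    the first coordinate is separated from the others: its compensated term is integrable, the rest
    is nonnegative, and truncation touches only the rest, so that limits in the level are monotone
    and may be infinite. *)

Section independence.
Context d (Omega : measurableType d) (R : realType) (P : probability Omega R).

(** The joint law and the product of the marginal laws agree on rectangles, hence everywhere, and
    Tonelli's theorem applies to the product. *)
Lemma integral_independent d1 d2 (T1 : measurableType d1)
    (T2 : measurableType d2) (X : Omega -> T1) (Y : Omega -> T2)
    (f : T1 * T2 -> \bar R) :
  measurable_fun setT X -> measurable_fun setT Y ->
  (forall A B, measurable A -> measurable B ->
     P (X @^-1` A `&` Y @^-1` B) = (P (X @^-1` A) * P (Y @^-1` B))%E) ->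
  measurable_fun setT f -> (forall x, (0 <= f x)%E) ->
  (\int[P]_w f (X w, Y w) = \int[P]_w1 \int[P]_w2 f (X w1, Y w2))%E.
Proof.
move=> mX mY XY mf f0.
have mXY : measurable_fun setT (fun w => (X w, Y w)).
  by apply/measurable_fun_pairP; split.
pose X' : {mfun Omega >-> T1} := HB.pack X (isMeasurableFun.Build _ _ _ _ X mX).
pose Y' : {mfun Omega >-> T2} := HB.pack Y (isMeasurableFun.Build _ _ _ _ Y mY).
pose Z' : {mfun Omega >-> (T1 * T2)%type} :=
  HB.pack (fun w => (X w, Y w)) (isMeasurableFun.Build _ _ _ _ _ mXY).
pose PX := distribution P X'; pose PY := distribution P Y'.
pose PZ := distribution P Z'.
have PZE A : measurable A -> PZ A = (PX \x PY)%E A.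
  by move=> mA; rewrite (@product_measure_unique _ _ _ _ _ PX PY PZ).
have -> : (\int[P]_w f (X w, Y w) = \int[PZ]_z f z)%E.
  by rewrite ge0_integral_distribution.
have -> : (\int[PZ]_z f z = \int[(PX \x PY)%E]_z f z)%E.
  by apply: eq_measure_integral => A mA _; exact: PZE.
rewrite fubini_tonelli1//.
rewrite ge0_integral_distribution//; last 2 first.
  exact: measurable_fun_fubini_tonelli_F.
  by move=> x; apply: integral_ge0.
apply: eq_integral => w _; rewrite /= /fubini_F ge0_integral_distribution//.
exact: measurableT_comp.
Qed.

Lemma independent_sigma (G H : set (set Omega)) :
  G `<=` measurable -> H `<=` measurable -> setI_closed G -> setI_closed H ->
  G setT -> H setT -> independent_events P G H ->
  independent_events P <<s G >> <<s H >>.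
Proof.
move=> mG mH GI HI GT HT GH.
(* For a fixed event [B] on one side, [P (A & B)] and [P A * P B] are finite measures in [A] that
   agree on a pi-system. This is applied twice, the second time with the two sides exchanged. *)
have half (G' H' : set (set Omega)) : G' `<=` measurable -> H' `<=` measurable ->
    setI_closed G' -> G' setT -> independent_events P G' H' ->
    independent_events P <<s G' >> H'.
  move=> mG' mH' GI' GT' GH' A B GA HB.
  have mB := mH' _ HB.
  pose m1 := mrestr P mB.
  have PB : (0 <= fine (P B))%R by rewrite fine_ge0.
  pose m2 := mscale (NngNum PB) P.
  have fPB : P B \is a fin_num by rewrite fin_num_measure.
  have m2E C : m2 C = (P C * P B)%E.
    by rewrite /m2 /mscale/= fineK// muleC.
  rewrite -m2E.
  apply: (@g_sigma_algebra_measure_unique _ _ _ G' mG' (fun=> setT) (fun=> GT')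
    _ m1 m2 GI') => //.
  - by rewrite bigcup_const.
  - move=> C GC; transitivity (P C * P B)%E; [exact: GH'|exact/esym/m2E].
  - move=> _; rewrite /m1 /mrestr; apply: le_lt_trans (ltry 1).
    by apply: probability_le1; exact: measurableI.
have GH1 := half G H mG mH GI GT GH.
move=> A B GA HB; rewrite setIC muleC.
  have sub (K : set (set Omega)) : K `<=` measurable -> <<s K >> `<=` measurable.
  by move=> mK; exact: (smallest_sub (@sigma_algebra_measurable _ Omega) mK).
apply: (half H <<s G >>) => //; first exact: sub.
by move=> ? ? ? ?; rewrite setIC muleC; exact: GH1.
Qed.

Lemma mutually_independent_sigma (I : choiceType) (F : I -> set (set Omega))
    (K1 K2 : set I) :
  (forall i, F i `<=` measurable) -> (forall i, setI_closed (F i)) ->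
  (forall i, F i setT) -> mutually_independent P F -> K1 `&` K2 = set0 ->
  independent_events P <<s \bigcup_(i in K1) F i >> <<s \bigcup_(i in K2) F i >>.
Proof.
move=> mF FI FT indF K12.
(* The union of the [F i] is not stable under intersection, so it is replaced by the finite
   intersections of its members. Requiring [E i = setT] outside [J] lets two of them be merged over
   the union of their index sets. *)
pose Pi K := [set A | exists (J : {fset I}) (E : I -> set Omega),
  [/\ [set` J] `<=` K, forall i, F i (E i), (forall i, i \notin J -> E i = setT)
    & A = \bigcap_(i in [set` J]) E i]].
have mPi K : Pi K `<=` measurable.
  move=> _ [J [E [_ FE _ ->]]]; apply: fin_bigcap_measurable => // i _.
  exact/mF/FE.
have capE (J1 J2 : {fset I}) (E1 E2 : I -> set Omega) :
    (forall i, i \notin J1 -> E1 i = setT) ->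
    (forall i, i \notin J2 -> E2 i = setT) ->
    \bigcap_(i in [set` J1]) E1 i `&` \bigcap_(i in [set` J2]) E2 i =
    \bigcap_(i in [set` (J1 `|` J2)%fset]) (E1 i `&` E2 i).
  move=> T1 T2; apply/seteqP; split => [w [w1 w2] i _|w w12].
    split.
      by have [iJ|iJ] := boolP (i \in J1); [exact: w1|rewrite T1].
    by have [iJ|iJ] := boolP (i \in J2); [exact: w2|rewrite T2].
  by split => i iJ; have [] := w12 i => //; rewrite /= in_fsetU iJ ?orbT.
have PiI K : setI_closed (Pi K).
  move=> _ _ [J1 [E1 [J1K FE1 T1 ->]]] [J2 [E2 [J2K FE2 T2 ->]]].
  exists (J1 `|` J2)%fset, (fun i => E1 i `&` E2 i); split.
  - by move=> i /=; rewrite in_fsetU => /orP[/J1K|/J2K].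
  - by move=> i; apply: FI.
  - by move=> i; rewrite in_fsetU negb_or => /andP[/T1 -> /T2 ->]; rewrite setIT.
  - exact: capE.
have PiT K : Pi K setT.
  exists fset0, (fun=> setT); split => //; last by rewrite bigcapT.
have subPi K : <<s \bigcup_(i in K) F i >> `<=` <<s Pi K >>.
  apply: smallest_sub; first exact: smallest_sigma_algebra.
  move=> A [i Ki FA]; apply: sub_sigma_algebra.
  exists [fset i]%fset, (fun j => if j == i then A else setT); split.
  - by move=> j /=; rewrite inE => /eqP ->.
  - by move=> j; case: eqP => [->|].
  - by move=> j; rewrite inE => /negbTE ->.
  - by rewrite set_fset1 bigcap_set1 eqxx.
have ind : independent_events P <<s Pi K1 >> <<s Pi K2 >>.
  apply: independent_sigma => //.
  move=> _ _ [J1 [E1 [J1K FE1 T1 ->]]] [J2 [E2 [J2K FE2 T2 ->]]].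
  rewrite capE// !indF//; last by move=> i _; exact: FI.
  have J12 : [disjoint J1 & J2]%fset.
    apply/fdisjointP => i i1; apply/negP => i2.
    by have : (K1 `&` K2) i by [split; [exact: J1K|exact: J2K]]; rewrite K12.
  rewrite (perm_big (J1 ++ J2)) /=; last first.
    apply: uniq_perm.
    - exact: fset_uniq.
    - rewrite cat_uniq !fset_uniq andbT/=; apply/hasPn => i i2.
      by apply/negP => i1; have /fdisjointP/(_ _ i1)/negP := J12; apply.
    - by move=> i; rewrite in_fsetU mem_cat.
  rewrite big_cat/=; congr (_ * _)%E; apply: eq_big_seq => i iJ.
    by rewrite (T2 i) ?setIT//; exact: (fdisjointP J12).
  rewrite (T1 i) ?setTI//; apply/negP => i1.
  by have /fdisjointP/(_ _ i1)/negP := J12; apply.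
by move=> A B /subPi A1 /subPi B1; exact: ind.
Qed.

End independence.

(** * Levy and OU type processes *)

Section limits.
Context d (Omega : measurableType d) (R : realType)
  (mu : {measure set Omega -> \bar R}).

Lemma ae_fatou (f : nat -> Omega -> \bar R) (g : Omega -> \bar R) (c : \bar R) :
  (forall n, measurable_fun setT (f n)) -> measurable_fun setT g ->
  (forall n w, (0 <= f n w)%E) -> (forall w, (0 <= g w)%E) ->
  (\forall w \ae mu, f n w @[n --> \oo] --> g w) ->
  (forall n, \int[mu]_w (f n w) <= c)%E -> (\int[mu]_w (g w) <= c)%E.
Proof.
move=> mf mg f0 g0 fg fc.
have -> : (\int[mu]_w (g w) = \int[mu]_w limn_einf (f ^~ w))%E.
  apply: ge0_ae_eq_integral => //.
  - apply: measurableT_comp => //; apply: measurable_fun_limn_esup => n.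
    exact: measurableT_comp.
  - move=> w _; rewrite limn_einf_lim; apply: lime_ge; first exact: is_cvg_einfs.
    by apply: nearW => n; apply: le_ereal_inf_tmp => _ [m _ <-].
  - by apply: filterS fg => w fgw _; rewrite (cvg_limn_einf_sup fgw).1.
apply: (le_trans (fatou mu measurableT mf _)) => [//|].
rewrite limn_einf_lim; apply: lime_le; first exact: is_cvg_einfs.
apply: nearW => n; apply: le_trans (fc n); apply: ereal_inf_lbound.
by exists n => /=.
Qed.

End limits.

Section levy.
Context d (Omega : measurableType d) (R : realType) (P : probability Omega R).

(* Boundedness in L^2 gives uniform integrability: [u <= min u K + u^2 / K]. *)
Lemma integral_cvg_bounded_sq (U : nat -> Omega -> R) (V : Omega -> R)
    (e C : R) :
  (forall n, measurable_fun setT (U n)) -> measurable_fun setT V ->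
  (forall n w, 0 <= U n w) -> (forall w, 0 <= V w) ->
  (\forall w \ae P, U n w @[n --> \oo] --> V w) ->
  (forall n, \int[P]_w (U n w)%:E = e%:E)%E ->
  (forall n, \int[P]_w (U n w ^+ 2)%:E <= C%:E)%E ->
  (\int[P]_w (V w)%:E = e%:E)%E.
Proof.
move=> mU mV U0 V0 UV Ue UC.
have trunc_cvg (K : R) : 0 <= K ->
    (\int[P]_w (Num.min (U n w) K)%:E)%E @[n --> \oo] -->
    (\int[P]_w (Num.min (V w) K)%:E)%E.
  move=> K0.
  have [] := @dominated_convergence _ _ R P setT measurableT
    (fun n w => (Num.min (U n w) K)%:E) (fun w => (Num.min (V w) K)%:E)
    (fun=> K%:E).
  - by move=> n; apply/measurable_EFinP; apply: measurable_minr.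
  - by apply/measurable_EFinP; apply: measurable_minr.
  - apply: filterS UV => w UVw _; apply: cvg_EFin; first exact: nearW.
    have : {for V w, continuous ((@id R^o) \min (fun=> K))}.
      by apply: continuous_min => //; exact: cvg_cst.
    by move=> /(continuous_cvg _) -/(_ _ _ _ _ UVw).
  - exact: finite_measure_integrable_cst.
  - apply: aeW => w n _; rewrite lee_fin ger0_norm ?le_min ?U0//.
    by rewrite ge_min lexx orbT.
  by move=> _ _.
have C0 : 0 <= C.
  by rewrite -lee_fin; apply: le_trans (UC 0%N); apply: integral_ge0 => w _;
    rewrite lee_fin sqr_ge0.
apply/eqP; rewrite eq_le; apply/andP; split.
  apply: (@ae_fatou _ _ _ P (fun n w => (U n w)%:E)) => //.
  - by move=> n; exact/measurable_EFinP.
  - exact/measurable_EFinP.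
  - by apply: filterS UV => w UVw; apply: cvg_EFin; first exact: nearW.
  - by move=> n; rewrite Ue.
apply/lee_addgt0Pr => _/posnumP[eps].
(* Chosen so that [C / K <= eps]; the added 1 keeps [K] positive when [C = 0]. *)
pose K := (C + 1) / eps%:num.
have K0 : 0 < K by rewrite divr_gt0// ltr_wpDl.
have UK n : (e%:E <= \int[P]_w (Num.min (U n w) K)%:E + eps%:num%:E)%E.
  rewrite -(Ue n).
  apply: (@le_trans _ _ (\int[P]_w ((Num.min (U n w) K)%:E +
                                    (K^-1)%:E * (U n w ^+ 2)%:E))%E).
    apply: ge0_le_integral => //.
    - by move=> w _; rewrite lee_fin.
    - exact/measurable_EFinP.
    - apply: emeasurable_funD; first by apply/measurable_EFinP/measurable_minr.
      apply: emeasurable_funM => //; apply/measurable_EFinP.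
      exact: measurable_funX.
    move=> w _; rewrite -EFinM -EFinD lee_fin minEle; case: ifPn => [_|].
      by rewrite lerDl mulr_ge0 ?sqr_ge0// invr_ge0 ltW.
    rewrite -ltNge => KU; rewrite mulrC; apply: ler_wpDl; first exact: ltW.
    by rewrite ler_pdivlMr// expr2 ler_wpM2l// ltW.
  rewrite ge0_integralD//; last first.
  - apply: emeasurable_funM => //; apply/measurable_EFinP.
    exact: measurable_funX.
  - move=> w _; rewrite -EFinM lee_fin mulr_ge0 ?sqr_ge0// invr_ge0 ltW//.
  - exact/measurable_EFinP/measurable_minr.
  - by move=> w _; rewrite lee_fin le_min U0 ltW.
  apply: leeD => //; rewrite ge0_integralZl//.
  - apply: (@le_trans _ _ ((K^-1)%:E * C%:E))%E.
      by apply: lee_wpmul2l => //; rewrite lee_fin invr_ge0 ltW.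
    rewrite -EFinM lee_fin mulrC ler_pdivrMr// /K mulrC divfK//.
    by rewrite lerDl.
  - by apply/measurable_EFinP/measurable_funX.
  - by move=> w _; rewrite lee_fin sqr_ge0.
  - by rewrite lee_fin invr_ge0 ltW.
apply: (@le_trans _ _ (\int[P]_w (Num.min (V w) K)%:E + eps%:num%:E)%E).
  have cvgD : (\int[P]_w (Num.min (U n w) K)%:E + eps%:num%:E)%E @[n --> \oo]
      --> (\int[P]_w (Num.min (V w) K)%:E + eps%:num%:E)%E.
    by apply: cvgeD; [exact: fin_num_adde_defl|exact: trunc_cvg (ltW K0)|exact: cvg_cst].
  rewrite -(cvg_lim _ cvgD)//; apply: lime_ge; last exact: nearW.
  by apply/cvg_ex; eexists; exact: cvgD.
apply: leeD => //; apply: ge0_le_integral => //.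
- by move=> w _; rewrite lee_fin le_min V0 ltW.
- exact/measurable_EFinP/measurable_minr.
- exact/measurable_EFinP.
- by move=> w _; rewrite lee_fin ge_min lexx.
Qed.

(** Pointwise, [expR (p * x) <= 1 + expR (p' * x)], by the sign of [x]. This bounds [Phi] uniformly
    over the exponents met by a Riemann-Stieltjes sum. *)
Lemma levy_exponent_ub (Phi : R -> R) (xi : R -> Omega -> R) (p p' : R) :
  spectrally_negative_levy P Phi xi -> 0 <= p <= p' ->
  expR (Phi p) <= 1 + expR (Phi p').
Proof.
move=> [mxi [_ [_ [_ Lxi]]]] /andP[p0 pp'].
have mE a : measurable_fun setT (fun w => (expR (a * xi 1 w))%:E).
  apply/measurable_EFinP/measurableT_comp => //.
  by apply: measurable_funM => //; exact: mxi.
rewrite -lee_fin EFinD -(mul1r (Phi p)) -(mul1r (Phi p')).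
have p'0 := le_trans p0 pp'; rewrite -(Lxi p 1 p0 ler01) -(Lxi p' 1 p'0 ler01).
have -> : (1%:E = \int[P]_w (cst 1 w))%E.
  by rewrite integral_cst//= probability_setT mul1e.
rewrite -ge0_integralD//.
apply: ge0_le_integral => //.
- exact: emeasurable_funD.
move=> w _; rewrite -EFinD lee_fin.
have [x0|x0] := leP 0 (xi 1 w).
  by rewrite ler_wpDl// ler_expR ler_wpM2r.
by rewrite ler_wpDr ?expR_ge0// -[leRHS]expR0 ler_expR mulr_ge0_le0// ltW.
Qed.

(** Near [p], [Phi] is the logarithm of the Laplace transform at time 1, continuous by domination:
    on []0, p + p[] the integrand is at most [1 + expR ((p + p) * xi 1 w)]. The Laplace transform is
    known only for nonnegative exponents, hence [0 < p]. *)
Lemma levy_exponent_continuous (Phi : R -> R) (xi : R -> Omega -> R) (p : R) :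
  spectrally_negative_levy P Phi xi -> 0 < p -> {for p, continuous Phi}.
Proof.
move=> [mxi [_ [_ [_ Lxi]]]] p0.
have mE a : measurable_fun setT (fun w => expR (a * xi 1 w)).
  by apply/measurableT_comp => //; apply: measurable_funM => //; exact: mxi.
have PhiE a : 0 <= a -> (\int[P]_w expR (a * xi 1 w))%R = expR (Phi a).
  by move=> a0; rewrite /Rintegral Lxi// mul1r.
have iE a : 0 <= a -> P.-integrable setT (EFin \o (fun w => expR (a * xi 1 w))).
  move=> a0; apply/integrableP; split; first exact/measurable_EFinP.
  under eq_integral do rewrite gee0_abs ?lee_fin ?expR_ge0//.
  by rewrite Lxi// ltry.
have ip : p \in `]0, (p + p)[ by rewrite in_itv/= p0 ltrDl.
have cE : {for p, continuous (fun a : R => (\int[P]_w expR (a * xi 1 w))%R)}.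
  apply: (@continuity_under_integral R _ Omega P
    (fun a w => expR (a * xi 1 w)) setT measurableT 0 (p + p) _ _
    (fun w => 1 + expR ((p + p) * xi 1 w))).
  - by move=> a /=; rewrite in_itv/= => /andP[a0 _]; apply/iE/ltW.
  - apply: aeW => w _ a _; apply: continuous_comp; last exact: continuous_expR.
    by apply: cvgM; [exact: cvg_id|exact: cvg_cst].
  - rewrite (_ : _ \o _ =
        ((EFin \o cst (1%R : R)) \+ (EFin \o (fun w => expR ((p + p) * xi 1 w)%R)))%E)//.
    apply: integrableD => //; first exact: finite_measure_integrable_cst.
    by apply: iE; rewrite addr_ge0// ltW.
  - move=> a /=; rewrite in_itv/= => /andP[a0 ap]; apply: aeW => w _.
    rewrite ger0_norm ?expR_ge0//.
    have [x0|x0] := leP 0 (xi 1 w).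
      by rewrite ler_wpDl// ler_expR ler_wpM2r// ltW.
    by rewrite ler_wpDr ?expR_ge0// -[leRHS]expR0 ler_expR mulr_ge0_le0// ltW.
  - by rewrite inE.
have nearE : \forall a \near p, ln (\int[P]_w expR (a * xi 1 w))%R = Phi a.
  near=> a; rewrite PhiE ?expRK//; apply: ltW.
  by near: a; exact: lt_nbhsr.
have Ep : ln (\int[P]_w expR (p * xi 1 w))%R = Phi p := nbhs_singleton nearE.
suff : Phi a @[a --> p] --> Phi p by [].
rewrite -Ep.
apply: cvg_trans; first exact: (near_eq_cvg nearE).
apply: continuous_cvg => //.
by apply: continuous_ln; rewrite PhiE ?expR_gt0// ltW.
Unshelve. all: end_near. Qed.

End levy.

Lemma measurable_sigma_family d (T : measurableType d) (A : pointedType) (I : Type)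
    (D : set I) (f : I -> A -> T) (i : I) : D i ->
  measurable_fun [set: g_sigma_algebraType
    (\bigcup_(i in D) preimage_set_system setT (f i) measurable)] (f i).
Proof.
move=> Di _ B mB; apply: sub_sigma_algebra; exists i => //; exists B => //.
Qed.

Lemma is_RS_integral_at_point (R : realType) (f g : R -> R) (a I : R) :
  is_RS_integral f g a a I -> I = 0.
Proof.
move=> RS; apply/eqP; rewrite -normr_le0; apply/ler_addgt0Pr => e e0.
have [delta _ /(_ [::] (fun=> 0))] := RS _ e0.
by rewrite big_ord0 sub0r normrN add0r => /(_ _ _)/ltW; apply => //; split.
Qed.

Section levy.
Context d (Omega : measurableType d) (R : realType) (P : probability Omega R).

(** Induction on the number of increments: the last one is independent of the sigma-algebra
    generated up to [s n], which contains all the others, and by stationarity its law is that of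
    [xi (s n.+1 - s n)]. *)
Lemma levy_increments_laplace (Phi : R -> R) (xi : R -> Omega -> R)
    (s b : nat -> R) (n : nat) :
  spectrally_negative_levy P Phi xi -> 0 <= s 0%N ->
  (forall i, s i <= s i.+1) -> (forall i, 0 <= b i) ->
  (\int[P]_w (expR (\sum_(i < n) b i * (xi (s i.+1) w - xi (s i) w)))%:E =
   (expR (\sum_(i < n) (s i.+1 - s i) * Phi (b i)))%:E)%E.
Proof.
move=> [mxi [_ [indxi [statxi Lxi]]]] s00 s_nd b0.
have s0 i : 0 <= s i by elim: i => // i /le_trans; apply.
have s_le i j : (i <= j)%N -> s i <= s j.
  by move=> ij; have /nondecreasing_seqP/(_ _ _ ij) := s_nd.
elim: n => [|n IH].
  under eq_integral do rewrite big_ord0 expR0.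
  by rewrite integral_cst//= probability_setT mul1e big_ord0 expR0.
pose D := [set r | 0 <= r <= s n].
pose G := \bigcup_(i in D) preimage_set_system setT (xi i) measurable.
pose X w := \sum_(i < n) b i * (xi (s i.+1) w - xi (s i) w).
pose Y w := xi (s n.+1) w - xi (s n) w.
have mXG : measurable_fun [set: g_sigma_algebraType G] X.
  apply: measurable_sum => i; apply: measurable_funM => //.
  by apply: measurable_funB; apply: (measurable_sigma_family (D := D));
    rewrite /D/= s0 s_le// ltnW.
have mX : measurable_fun setT X.
  by apply: measurable_sum => i; apply: measurable_funM => //;
    apply: measurable_funB; exact: mxi.
have mY : measurable_fun setT Y by apply: measurable_funB; exact: mxi.
have XY A B : measurable A -> measurable B ->
    P (X @^-1` A `&` Y @^-1` B) = (P (X @^-1` A) * P (Y @^-1` B))%E.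
  move=> mA mB; apply: (indxi _ _ (s0 n) (s_nd n)).
    by have := mXG measurableT A mA; rewrite setTI.
  by exists B => //; rewrite setTI.
have lawY : (\int[P]_w (expR (b n * Y w))%:E =
    (expR ((s n.+1 - s n) * Phi (b n)))%:E)%E.
  have ds0 : 0 <= s n.+1 - s n by rewrite subr_ge0.
  rewrite -(Lxi _ _ (b0 n) ds0).
  have mexp : measurable_fun setT (fun y : R => (expR (b n * y))%:E).
    by apply/measurable_EFinP/measurableT_comp => //; exact: measurable_funM.
  have mS : measurable_fun setT (xi (s n.+1 - s n)).
    by apply: mxi; rewrite subr_ge0.
  have := ge0_integral_pushforward mY P measurableT mexp.
  rewrite preimage_setT => <- //.
  have := ge0_integral_pushforward mS P measurableT mexp.
  rewrite preimage_setT => <- //.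
  apply: eq_measure_integral => A mA _; exact: (statxi _ _ (s0 n)).
under eq_integral do rewrite big_ord_recr/= expRD.
have := @integral_independent _ _ _ P _ _ _ _ X Y
  (fun xy => (expR xy.1 * expR (b n * xy.2))%:E) mX mY XY.
rewrite /= => ->; last 2 first.
- apply/measurable_EFinP; apply: measurable_funM.
    exact: measurableT_comp.
  by apply: measurableT_comp => //; exact: measurable_funM.
- by move=> xy; rewrite lee_fin mulr_ge0 ?expR_ge0.
transitivity (\int[P]_w1 ((expR (X w1))%:E * \int[P]_w2 (expR (b n * Y w2))%:E))%E.
  apply: eq_integral => w1 _; under eq_integral do rewrite EFinM.
  rewrite ge0_integralZl//.
  by apply/measurable_EFinP/measurableT_comp => //; exact: measurable_funM.
rewrite lawY ge0_integralZr//; last exact/measurable_EFinP/measurableT_comp.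
by rewrite IH -EFinM -expRD big_ord_recr.
Qed.

(* The tags of the Riemann-Stieltjes sums are chosen by the mean value theorem
   so that the Laplace transform of each sum is exactly [expR (J x - J 0)]. *)
Lemma OU_laplace (Phi : R -> R) (theta q x : R) (Z : R -> Omega -> R)
    (J : R -> R) :
  OU_type_process P Phi theta 0 Z -> 0 <= q -> 0 <= x ->
  (forall r, 0 <= r <= x ->
     is_derive r 1 J (Phi (q * expR (- theta * (x - r))))) ->
  (\int[P]_w (expR (q * Z x w))%:E = (expR (J x - J 0))%:E)%E.
Proof.
(* At [x = 0] the grid below would not be strictly increasing; there the Riemann-Stieltjes integral
   is zero. *)
move=> [mZ [xi lxi RS]] q0; rewrite le_eqVlt => /predU1P[<- _|x0 dJ].
  rewrite subrr expR0; transitivity (\int[P]_w cst 1%E w)%E; last first.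
    by rewrite integral_cst//= probability_setT mul1e.
  apply: ge0_ae_eq_integral => //.
  - apply/measurable_EFinP/measurableT_comp => //.
    by apply: measurable_funM => //; exact: mZ.
  - apply: filterS RS => w /(_ 0 (lexx _)) /is_RS_integral_at_point.
    by rewrite mulr0 subr0 => -> _; rewrite mulr0 expR0.
pose p n i : R := x * i%:R / n.+1%:R.
have p_lt n i : p n i < p n i.+1.
  by rewrite /p ltr_pM2r ?invr_gt0// ltr_pM2l// ltr_nat.
have p0 n : p n 0%N = 0 by rewrite /p mulr0 mul0r.
have pn n : p n n.+1 = x by rewrite /p mulfK.
have p_ge0 n i : 0 <= p n i by rewrite /p divr_ge0// mulr_ge0// ltW.
have p_le n i : (i <= n.+1)%N -> p n i <= x.
  by move=> i_n; rewrite /p ler_pdivrMr// ler_pM2l// ler_nat.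
have p_step n i : p n i.+1 - p n i = x / n.+1%:R.
  by rewrite /p -mulrBl -mulrBr -natrB// subSnn mulr1.
have tagP n i : exists c : R, (i <= n)%N -> p n i <= c <= p n i.+1 /\
    J (p n i.+1) - J (p n i) =
    Phi (q * expR (- theta * (x - c))) * (p n i.+1 - p n i).
  have [i_n|] := leqP i n; last by exists 0.
  have ix := p_le n i.+1 i_n.
  have [||c ci cE] := @MVT_segment _ J
      (fun r => Phi (q * expR (- theta * (x - r)))) (p n i) (p n i.+1) (ltW (p_lt n i)).
  - move=> r; rewrite in_itv/= => /andP[r1 r2]; apply: dJ.
    by rewrite (le_trans (p_ge0 _ _) (ltW r1)) (le_trans (ltW r2)).
  - apply: derivable_within_continuous => r; rewrite in_itv/= => /andP[r1 r2].
    suff /(@ex_derive _ _ _) : is_derive r 1 J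
      (Phi (q * expR (- theta * (x - r)))) by [].
    by apply: dJ; rewrite (le_trans (p_ge0 _ _) r1) (le_trans r2).
  - by exists c; rewrite in_itv/= in ci.
pose c n i := projT1 (cid (tagP n i)).
have cP n i : (i <= n)%N -> p n i <= c n i <= p n i.+1 /\
    J (p n i.+1) - J (p n i) =
    Phi (q * expR (- theta * (x - c n i))) * (p n i.+1 - p n i).
  exact: (projT2 (cid (tagP n i))).
pose S n w := \sum_(i < n.+1)
  expR (- theta * (x - c n i)) * (xi (p n i.+1) w - xi (p n i) w).
have LS a n : 0 <= a -> (\int[P]_w (expR (a * S n w))%:E = (expR (\sum_(i < n.+1)
    (p n i.+1 - p n i) * Phi (a * expR (- theta * (x - c n i)))))%:E)%E.
  move=> a0; rewrite -(@levy_increments_laplace Phi xi (p n)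
     (fun i => a * expR (- theta * (x - c n i))))//.
  - apply: eq_integral => w _; rewrite /S mulr_sumr.
    by under eq_bigr do rewrite mulrA.
  - by move=> i; exact/ltW/p_lt.
  - by move=> i; rewrite mulr_ge0// expR_ge0.
have mS n : measurable_fun setT (S n).
  have [mxi _] := lxi.
  by apply: measurable_sum => i; apply: measurable_funM => //;
    apply: measurable_funB; exact: mxi.
have mexpS a n : measurable_fun setT (fun w => expR (a * S n w)).
  by apply/measurableT_comp => //; exact: measurable_funM.
have expc n i : (i <= n)%N -> expR (- theta * (x - c n i)) <= expR (`|theta| * x).
  move=> i_n; have [/andP[c1 c2] _] := cP _ _ i_n.
  have c0 : 0 <= c n i := le_trans (p_ge0 _ _) c1.
  have cx : c n i <= x by rewrite (le_trans c2)// p_le.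
  rewrite ler_expR (le_trans (ler_norm _))// normrM normrN ler_wpM2l//.
  by rewrite ger0_norm ?subr_ge0// gerBl.
(* The factor 2 comes from squaring [expR (q * S n w)], and [expR (|theta| * x)] bounds the discount
   factors. Then [B] dominates [Phi] at every exponent occurring in the second moment, which is thus
   at most [expR (x * B)] for all [n]. *)
pose q' := 2 * q * expR (`|theta| * x).
pose B := ln (1 + expR (Phi q')).
have B0 : 0 <= B by rewrite ln_ge0// lerDl expR_ge0.
apply: (@integral_cvg_bounded_sq _ _ _ P (fun n w => expR (q * S n w)) _ _
  (expR (x * B))) => //.
- apply/measurableT_comp => //.
  by apply: measurable_funM => //; exact/mZ/ltW.
- apply: filterS RS => w /(_ x (ltW x0)); rewrite mulr0 subr0 => RSw.
  apply: continuous_cvg; first exact: continuous_expR.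
  apply: cvgMr; apply/cvgrPdist_lt => e /RSw[delta delta0 Hd].
  near=> n.
  pose s := [seq p n i.+1 | i <- iota 0 n.+1].
  have ss : size s = n.+1 by rewrite size_map size_iota.
  have nths y i : (i < n.+1)%N -> nth y s i = p n i.+1.
    by move=> i_n; rewrite (nth_map 0%N) ?size_iota// nth_iota.
  have nth0s y i : (i < n.+1)%N -> nth y (0 :: s) i = p n i.
    by case: i => [|i] i_n /=; [rewrite p0|rewrite nths// ltnW].
  have := Hd s (c n).
  rewrite ss distrC => HS; rewrite (_ : S n w = \sum_(i < n.+1)
    expR (- theta * (x - c n i)) * (xi (nth x s i) w - xi (nth x (0 :: s) i) w)).
    apply: HS.
    + split.
        apply/(pathP 0) => i; rewrite ss => i_n; rewrite nth0s// nths//.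
      by rewrite (last_nth 0) ss /= nths// pn.
    + move=> i i_n; rewrite nths// nth0s//; split; first exact: (cP _ _ _).1.
      rewrite p_step ltr_pdivrMr// mulrC -ltr_pdivrMr//.
      by apply: (@lt_trans _ _ n%:R); rewrite ?ltr_nat//; near: n; exact: nbhs_infty_gtr.
  by apply: eq_bigr => i _; rewrite nths// nth0s.
- move=> n; rewrite LS//; congr (expR _)%:E.
  transitivity (\sum_(i < n.+1) (J (p n i.+1) - J (p n i))).
    by apply: eq_bigr => i _; rewrite mulrC (cP _ _ _).2// -ltnS.
  rewrite -(big_mkord xpredT (fun i => J (p n i.+1) - J (p n i))).
  by rewrite (telescope_sumr (fun i => J (p n i)))// pn p0.
- move=> n.
  under eq_integral do rewrite -expRM_natl mulrA.
  rewrite LS ?mulr_ge0// lee_fin ler_expR.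
  apply: (@le_trans _ _ (\sum_(i < n.+1) (p n i.+1 - p n i) * B)).
    apply: ler_sum => i _; rewrite ler_wpM2l ?subr_ge0 ?(ltW (p_lt _ _))//.
    rewrite -ler_expR [leRHS]lnK ?posrE ?ltr_wpDr ?expR_ge0//.
    apply: (levy_exponent_ub lxi); rewrite mulr_ge0 ?expR_ge0 ?mulr_ge0//=.
    by rewrite ler_wpM2l ?mulr_ge0// expc// -ltnS.
  rewrite -mulr_suml -(big_mkord xpredT (fun i => p n i.+1 - p n i)).
  by rewrite (telescope_sumr (p n))// pn p0 subr0.
Unshelve. all: end_near. Qed.

End levy.

(** * Right-continuity of OU type paths *)

Section riemann_stieltjes.
Context {R : realType}.
Implicit Types (a b theta delta : R) (f g : R -> R).

Lemma fine_itv_partition a b delta : a <= b -> 0 < delta ->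
  exists2 s, itv_partition a b s & path (fun x y => y - x < delta) a s.
Proof.
rewrite le_eqVlt => /predU1P[-> _|ab delta0]; first by exists [::].
have ba0 : 0 < b - a by rewrite subr_gt0.
pose n := Num.bound ((b - a) / delta).
have n_lt : (b - a) / delta < n.+1%:R.
  apply: lt_trans (archi_boundP _) _; first by rewrite divr_ge0// ltW.
  by rewrite ltr_nat.
pose p i : R := a + (b - a) * i%:R / n.+1%:R.
have p0 : p 0%N = a by rewrite /p mulr0 mul0r addr0.
have pn : p n.+1 = b by rewrite /p mulfK// addrC subrK.
have p_step i : p i.+1 - p i = (b - a) / n.+1%:R.
  by rewrite /p opprD addrACA subrr add0r -mulrBl -mulrBr -natrB// subSnn mulr1.
pose s := [seq p i.+1 | i <- iota 0 n.+1].
have ss : size s = n.+1 by rewrite size_map size_iota.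
have nths y i : (i < n.+1)%N -> nth y s i = p i.+1.
  by move=> i_n; rewrite (nth_map 0%N) ?size_iota// nth_iota.
have nth0s y i : (i < n.+1)%N -> nth y (a :: s) i = p i.
  by case: i => [|i] i_n; rewrite ?p0//= nths// ltnW.
exists s.
  split; last by rewrite (last_nth 0) ss -[nth _ _ _]/(nth 0 s n) nths// pn.
  apply/(pathP 0) => i; rewrite ss => i_n; rewrite nth0s// nths//.
  by rewrite -subr_gt0 p_step divr_gt0.
apply/(pathP 0) => i; rewrite ss => i_n; rewrite nth0s// nths// p_step.
by rewrite ltr_pdivrMr// mulrC -ltr_pdivrMr.
Qed.

Definition right_RS_sum f g a b (s : seq R) : R :=
  \sum_(i < size s) f (nth b s i) * (g (nth b s i) - g (nth b (a :: s) i)).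

Lemma right_RS_sum_cat f g a b c s1 s2 : itv_partition a b s1 ->
  right_RS_sum f g a c (s1 ++ s2) =
  right_RS_sum f g a b s1 + right_RS_sum f g b c s2.
Proof.
move=> [_ /eqP lb]; rewrite /right_RS_sum.
rewrite -(big_mkord xpredT (fun i => f (nth c (s1 ++ s2) i) *
  (g (nth c (s1 ++ s2) i) - g (nth c (a :: s1 ++ s2) i)))) size_cat big_mkord.
rewrite big_split_ord/=; congr (_ + _); apply: eq_bigr => i _ /=.
  rewrite nth_cat ltn_ord (set_nth_default b)//.
  rewrite -cat_cons nth_cat ltnS (ltnW (ltn_ord i)) (set_nth_default b (s := a :: s1))//=.
  by rewrite ltnS ltnW.
rewrite nth_cat ltnNge leq_addr/= addKn; congr (_ * (_ - g _)).
(* The left neighbour of the first point of [s2] is the last point of [s1], which is [b]; every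
   other point of [s2] keeps its neighbour. *)
case: i => -[|i] i_lt /=; last first.
  by rewrite addnS /= nth_cat ltnNge leq_addr/= addKn.
rewrite addn0 -cat_cons nth_cat /= ltnSn -lb (last_nth c).
by [].
Qed.

(** Summation by parts moves the differences onto [F], whose total variation is [|F n - F 0|] by
    monotonicity. The integrator of a Riemann-Stieltjes sum then needs only to be small, not of
    bounded variation. *)
Lemma monotone_abel_bound (F : nat -> R) (G : nat -> R) (n : nat) (e : R) :
  (forall i, (i < n)%N -> F i <= F i.+1) \/
  (forall i, (i < n)%N -> F i.+1 <= F i) ->
  G 0%N = 0 -> (forall i, (i <= n)%N -> `|G i| <= e) ->
  `|\sum_(i < n) F i.+1 * (G i.+1 - G i)| <= (`|F n| + `|F n - F 0%N|) * e.
Proof.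
move=> Fm G0 Ge.
have -> : \sum_(i < n) F i.+1 * (G i.+1 - G i) =
    F n * G n - \sum_(i < n) (F i.+1 - F i) * G i.
  elim: n {Fm Ge} => [|n IH]; first by rewrite !big_ord0 G0 mulr0 subr0.
  by rewrite !big_ord_recr/= IH; ring.
have e0 : 0 <= e by apply: le_trans (Ge 0%N _).
apply: (le_trans (ler_normB _ _)); rewrite mulrDl lerD//.
  by rewrite normrM ler_wpM2l// Ge.
apply: (le_trans (ler_norm_sum _ _ _)).
apply: (@le_trans _ _ (\sum_(i < n) `|F i.+1 - F i| * e)).
  by apply: ler_sum => i _; rewrite normrM ler_wpM2l// Ge// ltnW.
rewrite -mulr_suml ler_wpM2r//.
have teleF := telescope_sumr F (leq0n n).
case: Fm => Fm.
  rewrite (eq_bigr (fun i : 'I_n => F i.+1 - F i)).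
    by rewrite -(big_mkord xpredT (fun i => F i.+1 - F i)) teleF ler_norm.
  by move=> i _; rewrite ger0_norm// subr_ge0 Fm.
rewrite (eq_bigr (fun i : 'I_n => - (F i.+1 - F i))).
  rewrite sumrN -(big_mkord xpredT (fun i => F i.+1 - F i)) teleF.
  by rewrite -normrN ler_norm.
by move=> i _; rewrite ler0_norm// subr_le0 Fm.
Qed.

(** A partition of [[0, t]] is continued to [u > t]. The sum over [[0, t]] is multiplied exactly by
    [expR (- theta * (u - t))], while the sum over [[t, u]] is small by Abel summation, since [g]
    stays close to [g t] there. *)
Lemma OU_right_continuous theta g (Z : R -> R) :
  (forall t, 0 <= t -> g s @[s --> t^'+] --> g t) ->
  (forall t, 0 <= t ->
     is_RS_integral (fun s => expR (- theta * (t - s))) g 0 t (Z t)) ->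
  forall t, 0 <= t -> Z s @[s --> t^'+] --> Z t.
Proof.
move=> g_right RS t t0.
have cvgE : expR (- theta * (s - t)) * Z t @[s --> t^'+] --> Z t.
  rewrite -[X in _ --> X]mul1r; apply: cvgMl.
  rewrite -[X in _ --> X]expR0 -[X in expR X](mulr0 (- theta)) -[X in - theta * X](subrr t).
  apply: cvg_at_right_filter.
  apply: continuous_comp; last exact: continuous_expR.
  by apply: cvgM; [exact: cvg_cst|apply: cvgB; [exact: cvg_id|exact: cvg_cst]].
suff cvg0 : Z s - expR (- theta * (s - t)) * Z t @[s --> t^'+] --> 0.
  pose D s := expR (- theta * (s - t)) * Z t.
  have ZE : (fun s => (Z s - D s) + D s) = Z by apply/funext => s; rewrite subrK.
  have : (fun s => (Z s - D s) + D s) @ t^'+ --> 0 + Z t := cvgD cvg0 cvgE.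
  by rewrite ZE add0r; apply.
pose E := expR `|theta|.
have E0 : 0 < E by rewrite expR_gt0.
apply/cvgrPdist_le => _/posnumP[eps].
(* The errors add up to [(3 + 2 * E) * e]: [e] from the sum on [[0, u]], [E * e] from the rescaled
   sum on [[0, t]], and [(2 + E) * e] from the part over [[t, u]]. Here [E] bounds the discount as
   long as [u <= t + 1]. *)
pose e := eps%:num / (3 + 2 * E).
have e0 : 0 < e by rewrite divr_gt0// ltr_wpDr ?mulr_ge0// ltW.
have [/= h0 h00 h0P] : \forall s \near t^'+, `|g t - g s| <= e.
  by have /cvgrPdist_le/(_ _ e0) := g_right _ t0.
near=> u.
have tu : t < u by near: u; exact: nbhs_right_gt.
have u0 : 0 <= u := le_trans t0 (ltW tu).
have [d1 d10 H1] := RS _ t0 _ e0.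
have [d2 d20 H2] := RS _ u0 _ e0.
have d0 : 0 < Num.min d1 d2 by rewrite lt_min d10.
have [s1 p1 m1] := fine_itv_partition t0 d0.
have [s2 p2 m2] := fine_itv_partition (ltW tu) d0.
have p12 := itv_partition_cat p1 p2.
have nth_step a b s i : itv_partition a b s -> (i < size s)%N ->
    nth b (a :: s) i <= nth b s i.
  by move=> [/(pathP b)/(_ i) h _] /h/ltW.
have {H1} : `|right_RS_sum (fun s => expR (- theta * (t - s))) g 0 t s1 - Z t| < e.
  apply: (H1 _ (nth t s1)) => // i i1; split; first by rewrite nth_step/=.
  by rewrite (lt_le_trans (pathP _ m1 _ i1))// ge_min lexx.
have {H2} : `|right_RS_sum (fun s => expR (- theta * (u - s))) g 0 u (s1 ++ s2) - Z u| < e.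
  apply: (H2 _ (nth u (s1 ++ s2))) => // i i12; split; first by rewrite nth_step/=.
  have m12 : path (fun x y => y - x < Num.min d1 d2) 0 (s1 ++ s2).
    by rewrite cat_path m1/=; case: p1 => _ /eqP ->.
  by rewrite (lt_le_trans (pathP _ m12 _ i12))// ge_min lexx orbT.
rewrite (right_RS_sum_cat _ _ _ _ p1).
have -> : right_RS_sum (fun s => expR (- theta * (u - s))) g 0 t s1 =
    expR (- theta * (u - t)) * right_RS_sum (fun s => expR (- theta * (t - s))) g 0 t s1.
  rewrite /right_RS_sum mulr_sumr; apply: eq_bigr => i _.
  by rewrite mulrA -expRD; congr (expR _ * _); ring.
set A := right_RS_sum _ _ _ _ _; set B := right_RS_sum _ _ _ _ _ => HB HA.
have Eu : expR (- theta * (u - t)) <= E.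
  rewrite ler_expR (le_trans (ler_norm _))// normrM normrN ger0_norm ?subr_ge0 ?(ltW tu)//.
  rewrite ler_piMr// lerBlDl; near: u; apply: nbhs_right_le.
  by rewrite ltrDl.
have BE : `|B| <= (1 + (1 + E)) * e.
  pose p := nth u (t :: s2).
  have pn : p (size s2) = u by apply: itv_partition_nth_size.
  have := @monotone_abel_bound (fun i => expR (- theta * (u - p i)))
    (fun i => g (p i) - g t) (size s2) e.
  rewrite /B /right_RS_sum.
  have pm i : (i < size s2)%N -> p i <= p i.+1 by move=> i_s; exact: nth_step.
  rewrite /= pn (subrr u) mulr0 expR0 normr1.
  under eq_bigr do rewrite opprB addrA subrK.
  move=> H; apply: (le_trans (H _ _ _)).
  - have [th0|th0] := leP 0 theta; [left|right] => i /pm ppi;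
      rewrite ler_expR !mulNr lerN2.
      by rewrite ler_wpM2l// lerB.
    by rewrite (ler_wnM2l (ltW th0))// lerB.
  - by rewrite subrr.
  - move=> i i_n.
    have tp : t <= p i by apply: itv_partition_nth_ge.
    have pu : p i <= u by apply: itv_partition_nth_le.
    rewrite distrC; have [->|tpi] := eqVneq (p i) t; first by rewrite subrr normr0 ltW.
    apply: h0P; last by rewrite lt_neqAle eq_sym tpi.
    rewrite /= distrC ger0_norm ?subr_ge0//; apply: (le_lt_trans (lerB pu (lexx t))).
    rewrite ltrBlDl; near: u; apply: nbhs_right_lt; rewrite ltrDl//.
  rewrite ler_wpM2r ?(ltW e0)// lerD2l (le_trans (ler_normB _ _))// normr1 lerD2l.
  by rewrite ger0_norm ?expR_ge0.
rewrite sub0r normrN.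
have -> : Z u - expR (- theta * (u - t)) * Z t =
  - (expR (- theta * (u - t)) * A + B - Z u) + B + expR (- theta * (u - t)) * (A - Z t).
  by ring.
apply: (le_trans (ler_normD _ _)); apply: (@le_trans _ _ ((e + (1 + (1 + E)) * e) + E * e)).
  apply: lerD.
    by apply: (le_trans (ler_normD _ _)); rewrite normrN lerD// ltW.
  by rewrite normrM ger0_norm ?expR_ge0// ler_pM// ltW.
rewrite [leLHS](_ : _ = (3 + 2 * E) * e); last by ring.
by rewrite /e mulrC divfK// gt_eqF// ltr_wpDr// mulr_ge0// ltW.
Unshelve. all: end_near. Qed.

End riemann_stieltjes.

Lemma measurable_exp_at d (T : measurableType d) (R : realType) (f : T -> R)
    (g : T -> \bar R) : measurable_fun setT f -> measurable_fun setT g ->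
  measurable_fun setT (fun w => exp_at (f w) (g w)).
Proof.
move=> mf mg.
rewrite (_ : (fun _ => _) = (fun w => if g w \is a fin_num then
  expR (f w * fine (g w)) else 0)); last first.
  by apply/funext => w; case: (g w).
apply: measurable_fun_ifT => //.
- apply: (measurable_fun_bool true).
  by have := emeasurable_fin_num measurableT mg.
- apply: measurableT_comp => //; apply: measurable_funM => //.
  exact: measurableT_comp.
Qed.

(** * A jointly measurable version of the motions *)

Section right_version.
Context {R : realType}.

(** For [x >= 0], the least multiple of [1 / (n + 1)] strictly above [x]: strictness makes right
    limits applicable, and the countable range gives joint measurability. *)
Definition right_grid (n : nat) (x : R) : R :=
  (Num.truncn (x * n.+1%:R)).+1%:R / n.+1%:R.

(* The paths of [Z] are only almost surely right-continuous, and a limsup along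
   grid points from the right is jointly measurable in time and [w]. *)
Definition right_version (T : Type) (Z : R -> T -> R) (x : R) (w : T) : \bar R :=
  limn_esup (fun n => (Z (right_grid n x) w)%:E).

Lemma measurable_right_version d (T : measurableType d) (Z : R -> T -> R) :
  (forall x, 0 <= x -> measurable_fun setT (Z x)) ->
  measurable_fun setT (fun xw : R * T => right_version Z xw.1 xw.2).
Proof.
move=> mZ.
apply: (measurable_fun_limn_esup
  (f := fun n (xw : R * T) => (Z (right_grid n xw.1) xw.2)%:E)) => n.
apply/measurable_EFinP => _ B mB.
have mk k : measurable [set x : R | Num.truncn (x * n.+1%:R) = k].
  rewrite (_ : [set _ | _] = [set x : R | k%:R <= x * n.+1%:R] `&`
      [set x : R | x * n.+1%:R < k.+1%:R] `|`
      (* [truncn] vanishes on negative numbers, so the level set of 0 is unbounded to the left. *)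
      [set x : R | k = 0%N /\ x < 0]); last first.
    apply/seteqP; split => [x /= <-|x /= [[xk1 xk2]|[-> x0]]].
    - have [x0|x0] := leP 0 x; last first.
        by right; split => //; rewrite truncn_floor leNgt pmulr_llt0 ?x0.
      by left; have /andP[] : (Num.truncn (x * n.+1%:R))%:R <= x * n.+1%:R <
        (Num.truncn (x * n.+1%:R)).+1%:R by apply: truncn_itv; rewrite mulr_ge0.
    - by apply: truncn_def; rewrite xk1 xk2.
    - by rewrite truncn_floor leNgt pmulr_llt0 ?x0.
  have mM : measurable_fun setT (fun x : R => x * n.+1%:R).
    by apply: measurable_funM.
  apply: measurableU.
    apply: measurableI; rewrite -[X in measurable X]setTI.
      have := measurable_fun_ler (measurable_cst (k%:R : R)) mM.
      by move=> /(_ measurableT [set true]) -/(_ I).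
    have := measurable_fun_ltr mM (measurable_cst (k.+1%:R : R)).
    by move=> /(_ measurableT [set true]) -/(_ I).
  have [->|k0] := eqVneq k 0%N; last first.
    rewrite (_ : [set _ | _] = set0)//; apply/seteqP; split => x //= -[/eqP].
    by rewrite (negbTE k0).
  rewrite (_ : [set _ | _] = `]-oo, 0[%classic)//.
  by apply/seteqP; split => x /=; rewrite in_itv/=; tauto.
rewrite setTI (_ : _ @^-1` B = \bigcup_k
  ([set x : R | Num.truncn (x * n.+1%:R) = k] `*`
   (Z (k.+1%:R / n.+1%:R) @^-1` B))).
  apply: bigcupT_measurable => k; apply: measurableX => //.
  rewrite -[X in measurable X]setTI; exact: mZ.
apply/seteqP; split => [[x w]/= Bxw|[x w]/= [k _ [/= <-]]//].
by exists (Num.truncn (x * n.+1%:R)).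
Qed.

Lemma right_version_cvg (T : Type) (Z : R -> T -> R) (x : R) (w : T) :
  0 <= x -> Z s w @[s --> x^'+] --> Z x w -> right_version Z x w = (Z x w)%:E.
Proof.
move=> x0 Zx; rewrite /right_version.
suff cvgZ : (Z (right_grid n x) w)%:E @[n --> \oo] --> (Z x w)%:E.
  exact: (cvg_limn_einf_sup cvgZ).2.
apply: cvg_EFin; first exact: nearW.
have grid_gt n : x < right_grid n x.
  rewrite /right_grid ltr_pdivlMr//.
  by have /andP[] : (Num.truncn (x * n.+1%:R))%:R <= x * n.+1%:R <
        (Num.truncn (x * n.+1%:R)).+1%:R by apply: truncn_itv; rewrite mulr_ge0.
have grid_le n : right_grid n x <= x + n.+1%:R^-1.
  rewrite /right_grid ler_pdivrMr// mulrDl mulVf// -natr1 lerD2r.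
  by have /andP[] : (Num.truncn (x * n.+1%:R))%:R <= x * n.+1%:R <
        (Num.truncn (x * n.+1%:R)).+1%:R by apply: truncn_itv; rewrite mulr_ge0.
have grid_cvg : right_grid n x @[n --> \oo] --> x.
  apply: (@squeeze_cvgr _ _ _ _ (fun=> x) (fun n => x + n.+1%:R^-1)).
  - by apply: nearW => n; rewrite ltW//=.
  - exact: cvg_cst.
  - by rewrite -[X in _ --> X]addr0; apply: cvgD; [exact: cvg_cst|exact: cvg_harmonic].
by move/cvg_at_rightP : Zx; apply.
Qed.

End right_version.

Section OU.
Context d (Omega : measurableType d) (R : realType) (P : probability Omega R).
Variables (Phi : R -> R) (theta : R) (Z : R -> Omega -> R).
Hypothesis OUZ : OU_type_process P Phi theta 0 Z.

Lemma OU_right_version :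
  \forall w \ae P, forall x, 0 <= x -> right_version Z x w = (Z x w)%:E.
Proof.
have [_ [xi [_ [pxi _]] RS]] := OUZ.
apply: filterS2 pxi RS => w [_ [cxi _] _] RS x x0.
apply: right_version_cvg => //.
apply: (OU_right_continuous (theta := theta) cxi) => // t t0.
by have := RS t t0; rewrite mulr0 subr0.
Qed.

Lemma OU_right_version_laplace (q x : R) (J : R -> R) :
  0 <= q -> 0 <= x ->
  (forall r, 0 <= r <= x ->
     is_derive r 1 J (Phi (q * expR (- theta * (x - r))))) ->
  (\int[P]_w (exp_at q (right_version Z x w))%:E = (expR (J x - J 0))%:E)%E.
Proof.
move=> q0 x0 dJ; rewrite -(OU_laplace OUZ q0 x0 dJ).
have [mZ _] := OUZ.
apply: ge0_ae_eq_integral => //.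
- apply/measurable_EFinP/measurable_exp_at => //.
  have mx : measurable_fun setT (fun w : Omega => (x, w)).
    exact: pair1_measurable.
  exact: (measurableT_comp (measurable_right_version mZ) mx).
- apply/measurable_EFinP/measurableT_comp => //.
  by apply: measurable_funM => //; exact: mZ.
- by move=> w _; rewrite lee_fin /exp_at; case: (right_version Z x w) => // r; rewrite expR_ge0.
- by apply: filterS OU_right_version => w /(_ x x0) ->.
Qed.

End OU.

(** * Branching families *)

Section exp_at.
Context {R : realType}.

Lemma exp_at_ge0 (q : R) r : 0 <= exp_at q r.
Proof. by case: r => //= r; rewrite expR_ge0. Qed.

(** Since [exp_at] is zero at both infinities, the product rule holds without any condition on the
    sum. *)
Lemma exp_atD (q : R) x y : exp_at q (x + y)%E = exp_at q x * exp_at q y.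
Proof.
by case: x y => [x| |] [y| |] //=; rewrite ?(mulr0, mul0r)// mulrDr expRD.
Qed.

Lemma exp_atZ (q c : R) x : 0 < c -> exp_at q (c%:E * x)%E = exp_at (q * c) x.
Proof.
move=> c0; case: x => [x| |] /=; first by rewrite mulrA.
- by rewrite gt0_muley ?lte_fin.
- by rewrite gt0_muleNy ?lte_fin.
Qed.

End exp_at.

Section sub_sigma.
Context d (Omega : measurableType d) (R : realType) (P : probability Omega R).

Lemma measurable_sigmaS (G H : set (set Omega)) d' (T : measurableType d')
    (f : Omega -> T) : G `<=` <<s H >> ->
  measurable_fun [set: g_sigma_algebraType G] f ->
  measurable_fun [set: g_sigma_algebraType H] f.
Proof.
move=> GH mf _ B mB.
have sub : <<s G >> `<=` <<s H >>.
  by apply: smallest_sub => //; exact: smallest_sigma_algebra.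
by apply: sub; exact: mf.
Qed.

Lemma measurable_sigmaT (G : set (set Omega)) d' (T : measurableType d')
    (f : Omega -> T) : G `<=` measurable ->
  measurable_fun [set: g_sigma_algebraType G] f -> measurable_fun [set: Omega] f.
Proof.
move=> mG mf _ B mB.
apply: (smallest_sub (@sigma_algebra_measurable _ Omega) mG).
exact: mf.
Qed.

End sub_sigma.

Section family.
Context d (Omega : measurableType d) (R : realType) (P : probability Omega R).
Variables (F : branching_family Omega R).
Hypothesis mlife : forall u, measurable_fun setT (lifetime F u).
Hypothesis mmotion : forall u x, 0 <= x -> measurable_fun setT (motion F u x).
Hypothesis mdisl : forall u, measurable_fun setT (dislocation F u).
Hypothesis indF : mutually_independent P (family_sigma F).

Local Notation index := (seq nat + (seq nat + seq nat))%type.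
Implicit Types (K : set index) (u v : seq nat).

Definition node (k : index) : seq nat :=
  match k with inl u | inr (inl u) | inr (inr u) => u end.

(* Measurability on this space encodes dependence on the variables of [K] only. *)
Definition family_space K : Type :=
  g_sigma_algebraType (\bigcup_(k in K) family_sigma F k).

HB.instance Definition _ K := Measurable.on (family_space K).
HB.instance Definition _ K := Pointed.on (family_space K).

Lemma family_sigma_measurable k : family_sigma F k `<=` measurable.
Proof.
case: k => [u|[u|u]] A /=.
- by move=> [B mB <-]; exact: mlife.
- apply: (smallest_sub (@sigma_algebra_measurable _ Omega)) => {}A [x /= x0 [B mB <-]].
  exact: mmotion.
- by move=> [B mB <-]; exact: mdisl.
Qed.

Lemma family_sigmaI k : setI_closed (family_sigma F k).
Proof.
case: k => [u|[u|u]] A B /=.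
- move=> [A' mA <-] [B' mB <-]; exists (A' `&` B'); first exact: measurableI.
  by rewrite preimage_setI setIIr.
- exact: (@measurableI _ (g_sigma_algebraType (\bigcup_(i in [set t | 0 <= t])
    preimage_set_system setT (motion F u i) measurable))).
- move=> [A' mA <-] [B' mB <-]; exists (A' `&` B'); first exact: measurableI.
  by rewrite preimage_setI setIIr.
Qed.

Lemma family_sigma_setT k : family_sigma F k setT.
Proof.
case: k => [u|[u|u]] /=.
- by exists setT => //; rewrite preimage_setT setIT.
- exact: (@measurableT _ (g_sigma_algebraType (\bigcup_(i in [set t | 0 <= t])
    preimage_set_system setT (motion F u i) measurable))).
- by exists setT => //; rewrite preimage_setT setIT.
Qed.

Lemma measurable_family_lifetime K u : K (inl u) ->
  measurable_fun [set: family_space K] (lifetime F u).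
Proof.
move=> Ku _ B mB; apply: sub_sigma_algebra; exists (inl u) => //.
by exists B.
Qed.

Lemma measurable_family_motion K u x : K (inr (inl u)) -> 0 <= x ->
  measurable_fun [set: family_space K] (motion F u x).
Proof.
move=> Ku x0 _ B mB; apply: sub_sigma_algebra; exists (inr (inl u)) => //.
by apply: sub_sigma_algebra; exists x => //; exists B.
Qed.

Lemma measurable_family_dislocation K u : K (inr (inr u)) ->
  measurable_fun [set: family_space K] (dislocation F u).
Proof.
move=> Ku _ B mB; apply: sub_sigma_algebra; exists (inr (inr u)) => //.
by exists B.
Qed.

Lemma measurable_familyS K K' d' (T : measurableType d') (f : Omega -> T) :
  K `<=` K' -> measurable_fun [set: family_space K] f ->
  measurable_fun [set: family_space K'] f.
Proof.
move=> KK'; apply: measurable_sigmaS => A [k Kk kA].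
by apply: sub_sigma_algebra; exists k => //; exact: KK'.
Qed.

Lemma measurable_familyT K d' (T : measurableType d') (f : Omega -> T) :
  measurable_fun [set: family_space K] f -> measurable_fun [set: Omega] f.
Proof.
by apply: measurable_sigmaT => A [k Kk]; exact: family_sigma_measurable.
Qed.

(** The form in which independence is used for the tree: functions of disjoint sets of variables are
    integrated one after the other. *)
Lemma integral_family K1 K2 d1 d2 (T1 : measurableType d1)
    (T2 : measurableType d2) (X : Omega -> T1) (Y : Omega -> T2)
    (f : T1 * T2 -> \bar R) :
  K1 `&` K2 = set0 ->
  measurable_fun [set: family_space K1] X ->
  measurable_fun [set: family_space K2] Y ->
  measurable_fun setT f -> (forall x, (0 <= f x)%E) ->
  (\int[P]_w f (X w, Y w) = \int[P]_w1 \int[P]_w2 f (X w1, Y w2))%E.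
Proof.
move=> K12 mX mY mf f0; apply: integral_independent => //.
- exact: measurable_familyT mX.
- exact: measurable_familyT mY.
move=> A B mA mB.
apply: (mutually_independent_sigma (K1 := K1) (K2 := K2) family_sigma_measurable
  family_sigmaI family_sigma_setT indF K12).
- by have := mX measurableT A mA; rewrite setTI.
- by have := mY measurableT B mB; rewrite setTI.
Qed.

(* Modifications with nonnegative lifetimes and jointly measurable motions;
   they agree with the original ones almost surely. *)
Definition life u w : \bar R := maxe 0%E (lifetime F u w).

Definition displacement u (x : R) w : \bar R := right_version (motion F u) x w.

Variable theta : R.

Fixpoint birth u w : \bar R :=
  if u is _ :: v then (birth v w + life v w)%E else 0%E.

Fixpoint place u w : \bar R :=
  if u is i :: v then
    let x := fine (life v w) in
    ((expR (- theta * x))%:E * place v w + displacement v x w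
     + dislocation F v w i)%E
  else 0%E.

Lemma life_ge0 u w : (0 <= life u w)%E.
Proof. by rewrite /life le_max lexx. Qed.

Lemma birth_ge0 u w : (0 <= birth u w)%E.
Proof. by elim: u => //= _ v IH; rewrite adde_ge0// life_ge0. Qed.

Lemma measurable_life K u : K (inl u) -> measurable_fun [set: family_space K] (life u).
Proof.
move=> Ku; apply: measurable_maxe; first exact: measurable_cst.
exact: measurable_family_lifetime.
Qed.

Lemma measurable_displacement K u : K (inr (inl u)) ->
  measurable_fun [set: R * family_space K] (fun xw => displacement u xw.1 xw.2).
Proof.
move=> Ku; apply: (@measurable_right_version _ _ (family_space K)) => x x0.
exact: measurable_family_motion.
Qed.

(** Joint measurability of the modified motion permits evaluating it at the random lifetime. *)
Lemma measurable_displacement_life K u : K (inl u) -> K (inr (inl u)) ->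
  measurable_fun [set: family_space K]
    (fun w => displacement u (fine (life u w)) w).
Proof.
move=> K1 K2; have mp : measurable_fun [set: family_space K]
    (fun w => (fine (life u w), w : family_space K)).
  apply/measurable_fun_pairP; split; last exact: measurable_id.
  apply: (@measurableT_comp _ _ _ _ _ _ fine) => //.
  exact: measurable_life.
exact: (measurableT_comp (measurable_displacement K2) mp).
Qed.

(** Contains the variables of all strict ancestors of any word of length [n], but none of the word
    itself; depending on the length alone, it grows along the induction on words. *)
Definition past n : set index := [set k | (size (node k) < n)%N].

Lemma measurable_birth u :
  measurable_fun [set: family_space (past (size u))] (birth u).
Proof.
elim: u => [|i v IH]; first exact: measurable_cst.
apply: emeasurable_funD; last by apply: measurable_life; rewrite /past/=.
by apply: measurable_familyS IH => k /=; rewrite /past/= => /ltnW.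
Qed.

Lemma measurable_place u :
  measurable_fun [set: family_space (past (size u))] (place u).
Proof.
elim: u => [|i v IH]; first exact: measurable_cst.
have mD : measurable_fun [set: family_space (past (size (i :: v)))]
    (fun w => dislocation F v w i).
  have mi : measurable_fun [set: seqspace (\bar R)] (fun r => r i).
    exact: measurable_sigma_family.
  apply: (measurableT_comp mi).
  by apply: measurable_family_dislocation; rewrite /past/=.
apply: emeasurable_funD => //; apply: emeasurable_funD.
  apply: emeasurable_funM.
    apply/measurable_EFinP; apply: measurableT_comp => //.
    apply: measurable_funM => //; apply: (@measurableT_comp _ _ _ _ _ _ fine) => //.
    by apply: measurable_life; rewrite /past/=.
  by apply: measurable_familyS IH => k /=; rewrite /past/= => /ltnW.
by apply: measurable_displacement_life; rewrite /past/=.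
Qed.

End family.

(** * Lifetimes *)

Section density.
Context d (T : measurableType d) (R : realType).
Variables (mu nu : {measure set T -> \bar R}) (D : set T) (f : T -> R).
Hypothesis mD : measurable D.
Hypothesis mf : measurable_fun D f.
Hypothesis f0 : forall x, D x -> 0 <= f x.
Hypothesis nuE : forall A, measurable A -> A `<=` D ->
  (nu A = \int[mu]_(x in A) (f x)%:E)%E.

Let mEf : measurable_fun D (EFin \o f). Proof. exact/measurable_EFinP. Qed.

Import HBNNSimple.

(** True for indicators by [nuE], for simple functions by linearity, and in general by monotone
    convergence along simple approximations. *)
Lemma ge0_integral_density (g : T -> \bar R) : measurable_fun D g ->
  (forall x, D x -> (0 <= g x)%E) ->
  (\int[nu]_(x in D) g x = \int[mu]_(x in D) (g x * (f x)%:E))%E.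
Proof.
move=> mg g0; pose h := nnsfun_approx mD mg.
have gE x : D x -> g x = limn (fun n => (h n x)%:E).
  by move=> Dx; apply/esym/cvg_lim => //; exact: cvg_nnsfun_approx.
have mh n : measurable_fun D (fun x => (h n x)%:E).
  by apply/measurable_EFinP/measurable_funTS/measurable_funP.
have hE n : (\int[nu]_(x in D) (h n x)%:E = \int[mu]_(x in D) ((h n x)%:E * (f x)%:E))%E.
  have mhk k : measurable (h n @^-1` [set k]) by exact: measurable_funPTI.
  have h0 k x : (0 <= (k * \1_(h n @^-1` [set k]) x)%:E)%E.
    exact: nnfun_muleindic_ge0.
  transitivity (\sum_(k \in range (h n))
      \int[nu]_(x in D) (k * \1_(h n @^-1` [set k]) x)%:E)%E.
    under eq_integral do rewrite fimfunE -fsumEFin//.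
    rewrite ge0_integral_fsum// => k.
    by apply/measurable_EFinP/measurable_funM => //; exact: measurable_funTS.
  transitivity (\sum_(k \in range (h n))
      \int[mu]_(x in D) ((k * \1_(h n @^-1` [set k]) x)%:E * (f x)%:E))%E; last first.
    rewrite -ge0_integral_fsum//.
    - apply: eq_integral => x /[!inE] Dx.
      rewrite -ge0_mule_fsuml//.
      by rewrite fsumEFin// -fimfunE.
    - move=> k; apply: emeasurable_funM => //.
      by apply/measurable_EFinP/measurable_funM => //; exact: measurable_funTS.
    - by move=> k x Dx; rewrite mule_ge0// lee_fin f0.
  apply: eq_fsbigr => k /[!inE] -[x _ <-].
  set r := h n x; have r0 : 0 <= r by [].
  under eq_integral do rewrite EFinM.
  rewrite ge0_integralZl//; last by apply/measurable_EFinP/measurable_indic.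
  under [RHS]eq_integral do rewrite EFinM -muleA.
  rewrite ge0_integralZl//; last 2 first.
  - by apply: emeasurable_funM => //; apply/measurable_EFinP/measurable_indic.
  - by move=> y Dy; rewrite mule_ge0// lee_fin// f0.
  congr (_ * _)%E; rewrite integral_indic// nuE//; last exact: measurableI.
  rewrite setIC integral_mkcondr; apply: eq_integral => y _.
  by rewrite patchE indicE; case: ifPn; rewrite ?mul1e ?mul0e.
transitivity (limn (fun n => \int[nu]_(x in D) (h n x)%:E))%E.
  rewrite -monotone_convergence//.
  - by apply: eq_integral => x /[!inE] /gE.
  - by move=> n x _; rewrite lee_fin.
  - by move=> x _ m n mn; rewrite lee_fin; exact/lefP/nd_nnsfun_approx.
under eq_fun do rewrite hE.
rewrite -monotone_convergence//.
- apply: eq_integral => x /[!inE] Dx.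
  have hx : (h n x)%:E @[n --> \oo] --> g x by exact: cvg_nnsfun_approx.
  by apply/cvg_lim => //; exact: cvgeZr.
- by move=> n; apply: emeasurable_funM.
- by move=> n x Dx; rewrite mule_ge0// lee_fin// f0.
- move=> x Dx m n mn; rewrite lee_wpmul2r ?lee_fin ?f0//.
  exact/lefP/nd_nnsfun_approx.
Qed.

End density.

Section calculus.
Context {R : realType}.
Implicit Types (f F : R -> R).

Lemma is_derive_continuous F (x df : R) : is_derive x 1 F df -> {for x, continuous F}.
Proof. by move=> dF; apply/differentiable_continuous/derivable1_diffP; exact: ex_derive. Qed.

Lemma is_derive_expR_comp F (x df : R) : is_derive x 1 F df ->
  is_derive x 1 (fun y => expR (F y)) (df * expR (F x)).
Proof.
move=> dF; rewrite mulrC.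
exact: (@is_derive1_comp _ expR F x _ _ (is_derive_expR (F x)) dF).
Qed.

Lemma is_derive_shift F (a x df : R) : is_derive (a + x) 1 F df ->
  is_derive x 1 (fun y => F (a + y)) df.
Proof.
move=> dF; have da : is_derive x (1 : R) (fun y : R => a + y) 1.
  have := is_deriveD (is_derive_cst a x (1 : R)) (is_derive_id x (1 : R)).
  by rewrite add0r.
by have := @is_derive1_comp _ F (fun y => a + y) x _ _ dF da; rewrite mulr1.
Qed.

Lemma integral_is_derive f F (a b : R) : a <= b ->
  (forall x, a <= x <= b -> is_derive x 1 F (f x)) ->
  (forall x, a <= x <= b -> {for x, continuous f}) ->
  (\int[lebesgue_measure]_(x in `[a, b]) (f x)%:E = (F b - F a)%:E)%E.
Proof.
rewrite le_eqVlt => /predU1P[<- _ _|ab dF cf].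
  by rewrite set_itv1 integral_set1 subrr.
have cF x : a <= x <= b -> {for x, continuous F}.
  by move=> /dF; exact: is_derive_continuous.
rewrite (@continuous_FTC2 _ f F)//.
- by apply: continuous_in_subspaceT => x; rewrite inE/= in_itv/=; exact: cf.
- split.
  + by move=> x; rewrite in_itv/= => /andP[ax xb]; apply: ex_derive; apply: dF; rewrite !ltW.
  + by apply: cvg_at_right_filter; apply: cF; rewrite lexx ltW.
  + by apply: cvg_at_left_filter; apply: cF; rewrite lexx ltW.
- move=> x; rewrite in_itv/= => /andP[ax xb].
  rewrite derive1E; apply: derive_val; by apply: dF; rewrite !ltW.
Qed.

Lemma integral_is_derive_oc f F (a b : R) : a <= b ->
  (forall x, a <= x <= b -> is_derive x 1 F (f x)) ->
  (forall x, a <= x <= b -> {for x, continuous f}) ->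
  (\int[lebesgue_measure]_(x in `]a, b]) (f x)%:E = (F b - F a)%:E)%E.
Proof.
move=> ab dF cf; rewrite integral_itv_obnd_cbnd; first exact: integral_is_derive.
apply/measurable_EFinP.
have cf' : {within `[a, b], continuous f}.
  by apply: continuous_in_subspaceT => x; rewrite inE/= in_itv/=; exact: cf.
apply: (@measurable_funS _ _ _ _ `[a, b]%classic) => //.
  by move=> x /=; rewrite !in_itv/= => /andP[/ltW -> ->].
exact: subspace_continuous_measurable_fun.
Qed.

End calculus.

Section exponential_lifetime.
Context d (Omega : measurableType d) (R : realType) (P : probability Omega R).
Variables (L : Omega -> \bar R) (rate : R).
Hypothesis mL : measurable_fun setT L.
Hypothesis rate0 : 0 <= rate.
Hypothesis tailL : forall x, 0 <= x ->
  P [set w | (x%:E < L w)%E] = (expR (- (x * rate)))%:E.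

Let pdf (x : R) := rate * expR (- (x * rate)).

Let mpdf D : measurable_fun D pdf.
Proof.
apply: measurable_funTS; apply: measurable_funM => //.
by apply: measurableT_comp => //; apply: measurableT_comp => //; exact: measurable_funM.
Qed.

Let integral_pdf (a b : R) : 0 <= a -> a <= b ->
  (\int[lebesgue_measure]_(x in `]a, b]) (pdf x)%:E =
   (expR (- (a * rate)) - expR (- (b * rate)))%:E)%E.
Proof.
move=> a0 ab.
have dN (x : R) : is_derive x (1 : R) (fun y : R => - (y * rate)) (- rate).
  have := is_deriveN (is_deriveM (is_derive_id x (1 : R)) (is_derive_cst rate x (1 : R))).
  by rewrite scaler0 add0r /GRing.scale/= mulr1.
transitivity ((- expR (- (b * rate)) - - expR (- (a * rate)))%:E); last first.
  by rewrite opprK addrC.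
apply: (@integral_is_derive_oc _ pdf (fun x => - expR (- (x * rate)))) => //.
- move=> x _; rewrite /pdf.
  have := is_deriveN (is_derive_expR_comp (dN x)).
  by rewrite mulNr opprK.
- move=> x _; apply: cvgM; first exact: cvg_cst.
  by apply: (is_derive_continuous (is_derive_expR_comp (dN x))).
Qed.

(** The tail determines the law of the lifetime on each half-open interval []a, b]] with [a >= 0],
    hence its density on []0, T]]. Restricting to []0, T]] allows an infinite lifetime, even almost
    surely when the rate is 0: [fine] sends it to 0, which is excluded. *)
Lemma integral_lifetime (phi : R -> \bar R) (T : R) : 0 <= T ->
  measurable_fun `]0, T] phi -> (forall x, 0 < x <= T -> (0 <= phi x)%E) ->
  (\int[P]_w (if (0 < L w <= T%:E)%E then phi (fine (L w)) else 0) =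
   \int[lebesgue_measure]_(x in `]0%R, T]) (phi x * (pdf x)%:E))%E.
Proof.
move=> T0 mphi phi0.
have mfL : measurable_fun setT ((fun w => fine (L w)) : Omega -> measurableTypeR R).
  exact: (@measurableT_comp _ _ _ _ _ _ fine).
pose fL : {mfun Omega >-> measurableTypeR R} :=
  HB.pack (fun w => fine (L w)) (isMeasurableFun.Build _ _ _ _ _ mfL).
pose nu := distribution P fL.
pose D : set R := `]0, T]%classic.
have mD : measurable D by exact: measurable_itv.
have nu_itv (a b : R) : 0 <= a -> a <= b ->
    nu `]a, b]%classic = (\int[lebesgue_measure]_(x in `]a, b]) (pdf x)%:E)%E.
  move=> a0 ab; rewrite integral_pdf//.
  have mtail (x : R) : measurable [set w | (x%:E < L w)%E].
    rewrite -[X in measurable X]setTI.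
    exact: (measurable_lte measurableT (measurable_cst x%:E) mL).
  transitivity (P ([set w | (a%:E < L w)%E] `\` [set w | (b%:E < L w)%E])).
    congr (P _); apply/seteqP; split => w /=; rewrite in_itv/=.
      case: (L w) => [l| |] /=; rewrite ?lte_fin.
      - by move=> /andP[-> lb]; split => //; apply/negP; rewrite -leNgt.
      - by rewrite ltNge a0.
      - by rewrite ltNge a0.
    case: (L w) => [l| |] /=; rewrite ?lte_fin ?ltry => -[al /negP]//.
    by rewrite -leNgt al => ->.
  rewrite measureD//; last by rewrite -ge0_fin_numE// fin_num_measure.
  rewrite setIidr.
    rewrite EFinB; congr (_ - _)%E; apply: tailL => //.
    exact: le_trans ab.
  move=> w /=; apply: le_lt_trans; first by rewrite lee_fin.
(* Extended by zero, the density induces a measure on the whole line, which is compared on half-open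
   intervals with the restriction of the law to [D]. *)
pose pdf0 (x : R) : \bar R := if x \in D then (pdf x)%:E else 0%E.
have pdf0_ge0 x : (0 <= pdf0 x)%E.
  by rewrite /pdf0; case: ifP => // _; rewrite lee_fin mulr_ge0// expR_ge0.
have pdf0E : pdf0 = (EFin \o pdf) \_ D.
  by apply/funext => x; rewrite /pdf0 patchE.
have mpdf0 : measurable_fun setT pdf0.
  have mEpdf : measurable_fun D (EFin \o pdf) by apply/measurable_EFinP; exact: mpdf.
  by rewrite pdf0E; exact: ((measurable_restrictT _ mD).1 mEpdf).
pose m2 (A : set (measurableTypeR R)) := (\int[lebesgue_measure]_(x in A) pdf0 x)%E.
have m20 : m2 set0 = 0%E by rewrite /m2 integral_set0.
have m2_ge0 A : (0 <= m2 A)%E by apply: integral_ge0.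
have m2_sigma : semi_sigma_additive m2.
  exact: (@semi_sigma_additive_nng_induced _ (measurableTypeR R) R
    lebesgue_measure pdf0 mpdf0 pdf0_ge0).
pose m2' : {measure set (measurableTypeR R) -> \bar R} :=
  HB.pack m2 (isMeasure.Build _ (measurableTypeR R) R m2 m20 m2_ge0 m2_sigma).
have nuE A : measurable A -> A `<=` D ->
    (nu A = \int[lebesgue_measure]_(x in A) (pdf x)%:E)%E.
  move=> mA AD.
  pose m1 : {measure set (measurableTypeR R) -> \bar R} := mrestr nu mD.
  transitivity (m1 A); first by rewrite /m1/= /mrestr setIidl.
  transitivity (m2' A); last first.
    by apply: eq_integral => x /[!inE] /AD Dx; rewrite /pdf0 mem_set.
  apply: (@g_sigma_algebra_measure_unique _ R (measurableTypeR R) (@ocitv R) _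
    (fun k => `](- k%:R)%R, k%:R]%classic) _ _ m1 m2') => //.
  - by move=> B ocB; exact: sub_sigma_algebra.
  - by move=> i; exact: is_ocitv.
  - by rewrite bigcup_itvT.
  - exact: ocitvI.
  - move=> _ [[a b] _ <-] /=.
    have abD : `]a, b]%classic `&` D = `]Num.max a 0, Num.min b T]%classic.
      apply/seteqP; split => x; rewrite /D/= !in_itv/= gt_max le_min.
        by move=> [/andP[-> ->] /andP[-> ->]].
      by move=> /andP[/andP[-> ->] /andP[-> ->]].
    rewrite /mrestr abD /m2 pdf0E -integral_mkcondr abD.
    have [ab|ab] := leP (Num.max a 0) (Num.min b T).
      by apply: nu_itv => //; rewrite le_max lexx orbT.
    rewrite (_ : `]_, _]%classic = set0).
      by rewrite integral_set0; exact: measure0.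
    by apply/seteqP; split => x //=; rewrite in_itv/= => /andP[x1 x2];
      have := lt_le_trans x1 x2; rewrite ltNge (ltW ab).
  - move=> k; apply: (@le_lt_trans _ _ 1%E); last exact: ltry.
    by apply: (probability_le1 nu); exact: measurableI.
transitivity (\int[nu]_(x in D) phi x)%E; last first.
  apply: (@ge0_integral_density _ (measurableTypeR R) R lebesgue_measure nu D pdf) => //.
  - exact: mpdf.
  - by move=> x _; rewrite mulr_ge0// expR_ge0.
rewrite /nu ge0_integral_pushforward//; last first.
  by move=> x; rewrite inE/D/= in_itv/=; exact: phi0.
rewrite [RHS]integral_mkcond; apply: eq_integral => w _.
rewrite patchE /=; case: ifPn => [/andP[L0 LT]|LT]; case: ifPn => //;
  rewrite ?inE ?notin_setE /D/= in_itv/=.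
- by case: (L w) L0 LT => //= l; rewrite lte_fin lee_fin => -> ->.
- by case: (L w) LT => //= [l /negP|_|_]; rewrite ?ltxx// lte_fin lee_fin => + ?; apply.
Qed.

End exponential_lifetime.

(** * Sums over the Ulam-Harris tree *)

Section countable_sums.
Context {R : realType}.

(** Enumerating words by their codes turns a sum over the tree into a series, to which integration
    term by term applies. *)
Lemma esum_countType (T : countType) (f : T -> \bar R) :
  (forall u, (0 <= f u)%E) ->
  (\esum_(u in [set: T]) f u =
   \sum_(n <oo) (if pickle_inv n is Some u then f u else 0))%E.
Proof.
move=> f0; rewrite nneseries_esumT; last by move=> n; case: pickle_inv.
pose g n := (if pickle_inv n is Some u then f u else 0%E).
have -> : (\esum_(n in [set: nat]) g n =
    \esum_(n in range (@choice.pickle T)) g n)%E.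
  rewrite [RHS]esum_mkcond; apply: eq_esum => n _.
  case: ifPn => // nT; rewrite /g; case E : pickle_inv => [u|//].
  exfalso; move/negP : nT; apply; rewrite inE; exists u => //.
  by have := @pickle_invK T n; rewrite E.
rewrite (@reindex_esum _ _ _ setT _ (@choice.pickle T)); last first.
  split => [u _|u v _ _|n [u _ <-]]; first by exists u.
    exact: (pcan_inj (@choice.pickleK T)).
  by exists u.
by apply: eq_esum => u _; rewrite /g pickleK_inv.
Qed.

Lemma ge0_integral_esum d (S : measurableType d) (mu : {measure set S -> \bar R})
    (T : countType) (D : set T) (f : T -> S -> \bar R) :
  (forall u, measurable_fun setT (f u)) -> (forall u w, (0 <= f u w)%E) ->
  (\int[mu]_w (\esum_(u in D) f u w) = \esum_(u in D) \int[mu]_w f u w)%E.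
Proof.
move=> mf f0.
transitivity (\int[mu]_w (\sum_(n <oo)
    (if pickle_inv n is Some u then if u \in D then f u w else 0 else 0)))%E.
  apply: eq_integral => w _; rewrite esum_mkcond esum_countType// => u.
  by case: ifP.
rewrite integral_nneseries//; last 2 first.
- move=> n; case: pickle_inv => [u|]; last exact: measurable_cst.
  by case: (u \in D); [exact: mf|exact: measurable_cst].
- by move=> n w _; case: pickle_inv => // u; case: ifP.
rewrite esum_mkcond esum_countType; last first.
  by move=> u; case: ifP => // _; exact: integral_ge0.
apply: eq_eseriesr => n _; case: pickle_inv => [u|]; last by rewrite integral0.
by case: ifP => // _; rewrite integral0.
Qed.

Lemma measurable_esum d (S : measurableType d) (T : countType) (D : set T)
    (f : T -> S -> \bar R) :
  (forall u, measurable_fun setT (f u)) -> (forall u w, (0 <= f u w)%E) ->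
  measurable_fun setT (fun w => \esum_(u in D) f u w)%E.
Proof.
move=> mf f0.
rewrite (_ : (fun _ => _) = fun w => (\sum_(n <oo)
    (if pickle_inv n is Some u then if u \in D then f u w else 0 else 0))%E).
  apply: ge0_emeasurable_sum => n.
    by move=> w _; case: pickle_inv => // u; case: ifP.
  move=> _; case: pickle_inv => [u|]; last exact: measurable_cst.
  by case: (u \in D); [exact: mf|exact: measurable_cst].
apply/funext => w; rewrite esum_mkcond esum_countType// => u.
by case: ifP.
Qed.

Lemma esum_generation (f : seq nat -> \bar R) (n : nat) :
  (forall u, (0 <= f u)%E) ->
  (\esum_(u in [set u | size u = n.+1]) f u =
   \esum_(v in [set v | size v = n]) \sum_(i <oo) f (i :: v))%E.
Proof.
move=> f0; under [RHS]eq_esum do rewrite nneseries_esumT//.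
rewrite esum_esum//; apply: reindex_esum; split => //=.
- by move=> [v i] /= [-> _].
- move=> [v i] [v' i'] _ _ /= [-> ->] //.
- by move=> [//|i v] /= [vn]; exists (v, i).
Qed.

Lemma esum_generations (f : seq nat -> \bar R) : (forall u, (0 <= f u)%E) ->
  (\esum_(u in [set: seq nat]) f u =
   \sum_(n <oo) \esum_(u in [set u | size u = n]) f u)%E.
Proof.
move=> f0; rewrite nneseries_esumT; last by move=> n; exact: esum_ge0.
rewrite -esum_bigcupT//; last first.
  by apply/trivIsetP => i j _ _ /eqP ij; apply/seteqP; split => // u [/= ui uj];
    case: ij; rewrite -ui -uj.
by congr (esum _ _); apply/seteqP; split => // u _; exists (size u).
Qed.

End countable_sums.

(** * Measurability on the space of logarithmic partitions *)

Section partitions.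
Context {R : realType}.
Implicit Types r : seqspace (\bar R).

Lemma measurable_coord d (T : measurableType d) (i : nat) :
  measurable_fun [set: seqspace T] (fun s => s i).
Proof. exact: measurable_sigma_family. Qed.

Lemma measurable_seqspace d d' (S : measurableType d) (T : measurableType d')
    (f : S -> seqspace T) : (forall i, measurable_fun setT (fun w => f w i)) ->
  measurable_fun setT f.
Proof.
move=> mf.
apply: (@measurability _ _ _ (seqspace T) setT f (\bigcup_(i in [set: nat])
     preimage_set_system [set: nat -> T] (fun s => s i) measurable)) => //.
move=> _ [_ [i _ [B mB <-]] <-]; rewrite !setTI.
by have := mf i measurableT B mB; rewrite setTI.
Qed.

(** In a decreasing sequence the coordinates above [-oo] form an initial segment, so this count is
    [nb_finite] on [log_partitions]. As a series it is measurable and dominates the sums of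
    [exp_at p (r i)] term by term. *)
Definition nb_series r : \bar R := (\sum_(i <oo) ((-oo < r i)%E%:R)%:E)%E.

Lemma exp_at_sum_le_nb (p : R) r : 0 <= p -> log_partitions r ->
  (\sum_(i <oo) (exp_at p (r i))%:E <= nb_series r)%E.
Proof.
move=> p0 [rm r0 _]; apply: lee_nneseries => [i _|i _].
  by rewrite lee_fin exp_at_ge0.
have ri : (r i <= 0)%E by elim: i => // i; exact: le_trans.
rewrite lee_fin; case: (r i) ri => [x| |] //=.
rewrite lee_fin ltNyr => x0.
by rewrite -expR0 ler_expR mulr_ge0_le0.
Qed.

Lemma nb_finite_series r : log_partitions r -> nb_finite r = nb_series r.
Proof.
move=> [rm r0 _].
have mono i j : (i <= j)%N -> (r j <= r i)%E.
  elim: j => [|j IH]; first by rewrite leqn0 => /eqP ->.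
  by rewrite leq_eqVlt => /predU1P[->//|/IH]; exact: le_trans.
have sumE n : (forall i, (i < n)%N -> (-oo < r i)%E) ->
    (\sum_(0 <= i < n) (((-oo < r i)%E)%:R : R)%:E = n%:R%:E)%E.
  move=> rn; rewrite (eq_big_nat _ _ (F2 := fun=> 1%E)); last first.
    by move=> i /andP[_ /rn ->].
  by rewrite sumEFin big_const_nat subn0 iter_addr_0.
have nd : nondecreasing_seq (fun n =>
    (\sum_(0 <= i < n) (((-oo < r i)%E)%:R : R)%:E)%E).
  by apply: ereal_nondecreasing_series => i _; rewrite lee_fin.
have -> : nb_series r = ereal_sup (range (fun n =>
    (\sum_(0 <= i < n) (((-oo < r i)%E)%:R : R)%:E)%E)).
  by apply/cvg_lim => //; exact: ereal_nondecreasing_cvgn.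
apply/eqP; rewrite eq_le; apply/andP; split; apply: ge_ereal_sup.
  move=> _ /= [->|[i ri <-]].
    by apply: ereal_sup_ubound; exists 0%N => //; rewrite big_geq.
  apply: ereal_sup_ubound; exists i.+1 => //; apply: sumE => j ji.
  by rewrite (lt_le_trans ri)// mono.
move=> _ [n _ <-]; elim: n => [|n IH].
  by rewrite big_geq//; apply: ereal_sup_ubound; left.
have [rn|rn] := boolP (-oo < r n)%E; last first.
  by rewrite big_nat_recr//= (negbTE rn) adde0.
rewrite sumE; first by apply: ereal_sup_ubound; right; exists n.
by move=> i; rewrite ltnS => i_n; rewrite (lt_le_trans rn)// mono.
Qed.

Lemma measurable_nb_series : measurable_fun [set: seqspace (\bar R)] nb_series.
Proof.
apply: ge0_emeasurable_sum => i; first by move=> x _ _; rewrite lee_fin.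
move=> _; apply/measurable_EFinP.
rewrite (_ : (fun _ => _) = fun r : seqspace (\bar R) => if (-oo < r i)%E then 1 else 0).
  apply: measurable_fun_ifT => //; apply: measurable_fun_lte => //.
  exact: measurable_coord.
by apply/funext => r; case: ifP.
Qed.

Lemma measurable_exp_at_sum d (T : measurableType d) (p : T -> R)
    (f : T -> seqspace (\bar R)) :
  measurable_fun setT p -> measurable_fun setT f ->
  measurable_fun setT (fun w => \sum_(i <oo) (exp_at (p w) (f w i))%:E)%E.
Proof.
move=> mp mf; apply: ge0_emeasurable_sum => i.
  by move=> x _ _; rewrite lee_fin exp_at_ge0.
move=> _; apply/measurable_EFinP/measurable_exp_at => //.
exact: (measurableT_comp (measurable_coord i)).
Qed.

Lemma measurable_log_partitions : measurable (@log_partitions R).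
Proof.
rewrite (_ : log_partitions = (\bigcap_i [set r : seqspace (\bar R) | r i.+1 <= r i]%E)
   `&` ([set r : seqspace (\bar R) | r 0%N <= 0]%E `&`
   [set r : seqspace (\bar R) | \sum_(i <oo) (exp_at 1 (r i))%:E <= 1]%E)).
  apply: measurableI; last apply: measurableI.
  - apply: bigcapT_measurable => i; rewrite -[X in measurable X]setTI.
    by apply: measurable_lee => //; exact: measurable_coord.
  - rewrite -[X in measurable X]setTI.
    by apply: measurable_lee => //; exact: measurable_coord.
  - rewrite -[X in measurable X]setTI.
    apply: measurable_lee => //.
    exact: (@measurable_exp_at_sum _ _ (fun=> 1) id).
apply/seteqP; split => r /=.
  by move=> [rm r0 rs]; split => [i _|]; [exact: rm|split].
by move=> [rm [r0 rs]]; split => // i; exact: (rm i).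
Qed.

Lemma log_partitions1E : @log_partitions1 R =
  log_partitions `&` [set r | nb_series r = 1%E].
Proof.
by apply/seteqP; split => r -[lr /= nr]; split => //=;
  rewrite ?nb_finite_series// -nb_finite_series.
Qed.

Lemma measurable_log_partitions1 : measurable (@log_partitions1 R).
Proof.
rewrite log_partitions1E; apply: measurableI; first exact: measurable_log_partitions.
rewrite -[X in measurable X]setTI.
exact: (measurable_nb_series measurableT (emeasurable_set1 1%E)).
Qed.

Lemma measurable_branching_partitions : measurable (@branching_partitions R).
Proof.
exact: measurableD measurable_log_partitions measurable_log_partitions1.
Qed.

End partitions.

(** * Processes with finite birth intensity *)

Section mean.
Context d (Omega : measurableType d) (R : realType) (P : probability Omega R).
Variables (sigma c theta : R) (mu : {measure set (seqspace (\bar R)) -> \bar R}).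
Variable F : branching_family Omega R.
Hypothesis HF : OU_branching_family P sigma c mu theta F.
Variables (rate : R) (M : R -> R).
Hypothesis rateE : branching_rate mu = rate%:E.
Hypothesis ME : forall p, 0 <= p ->
  (\int[mu]_(r in branching_partitions) \sum_(i <oo) (exp_at p (r i))%:E =
   (M p)%:E)%E.

Let mlife u : measurable_fun setT (lifetime F u).
Proof. by have [_ [_ [/(_ u) []]]] := HF. Qed.

Let mmotion u x : 0 <= x -> measurable_fun setT (motion F u x).
Proof. by move=> x0; have [_ [_ [_ [/(_ u) [mZ _] _]]]] := HF; exact: mZ. Qed.

Let mdisl u : measurable_fun setT (dislocation F u).
Proof. by have [_ [_ [_ [_ /(_ u) []]]]] := HF. Qed.

Let indF : mutually_independent P (family_sigma F).
Proof. by have [_ []] := HF. Qed.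

Let rate_ge0 : 0 <= rate.
Proof. by rewrite -lee_fin -rateE; exact: measure_ge0. Qed.

Lemma life_tail u x : 0 <= x ->
  P [set w | (x%:E < life F u w)%E] = (expR (- (x * rate)))%:E.
Proof.
move=> x0; have [_ [_ [/(_ u) [_ /(_ x x0) tailE] _]]] := HF.
move: tailE; rewrite rateE /= => <-; congr (P _); apply/seteqP; split => w /=;
  by rewrite /life lt_max lte_fin [(x < 0)%R]ltNge x0.
Qed.

Let mlf u : measurable_fun setT (life F u).
Proof. by apply: measurable_maxe => //; exact: measurable_cst. Qed.

Lemma life_gt0 u : \forall w \ae P, (0 < life F u w)%E.
Proof.
have m0 : measurable [set w | (0 < life F u w)%E].
  by rewrite -[X in measurable X]setTI; exact: measurable_lte.
exists (~` [set w | (0 < life F u w)%E]); split => //; first exact: measurableC.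
rewrite probability_setC//.
have := @life_tail u 0 (lexx 0); rewrite mul0r oppr0 expR0 => E.
by transitivity (1 - 1%:E : \bar R)%E; [congr (_ - _)%E; exact: E|rewrite subee].
Qed.

(** The rate times the law of the dislocation is [mu] restricted to [branching_partitions]. Keeping
    the rate as a factor covers the case of rate 0, where that law is arbitrary. *)
Lemma offspring_mean u p : 0 <= p ->
  (rate%:E * \int[P]_w \sum_(i <oo) (exp_at p (dislocation F u w i))%:E =
   (M p)%:E)%E.
Proof.
move=> p0; rewrite -ME//.
have mB := @measurable_branching_partitions R.
pose D : {mfun Omega >-> seqspace (\bar R)} :=
  HB.pack (dislocation F u) (isMeasurableFun.Build _ _ _ _ _ (mdisl u)).
(* This scaled law does not charge the complement of [branching_partitions], on which it has density
   1 with respect to [mu]. *)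
pose nu := mscale (NngNum rate_ge0) (distribution P D).
have nuE A : measurable A -> nu A = mu (A `&` branching_partitions).
  move=> mA; have [_ [_ [_ [_ /(_ u) [_ /(_ A mA) DE]]]]] := HF.
  by move: DE; rewrite rateE.
pose g (r : seqspace (\bar R)) := (\sum_(i <oo) (exp_at p (r i))%:E)%E.
have mg : measurable_fun setT g.
  exact: (@measurable_exp_at_sum _ _ _ (fun=> p) id).
have g0 r : (0 <= g r)%E.
  by apply: nneseries_ge0 => i _ _; rewrite lee_fin exp_at_ge0.
transitivity (\int[nu]_r g r)%E.
  by rewrite ge0_integral_mscale// ge0_integral_distribution.
rewrite (@ge0_negligible_integral _ _ _ _ setT (~` branching_partitions))//; last 2 first.
- exact: measurableC.
- transitivity (mu (~` branching_partitions `&` branching_partitions)).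
    by apply: nuE; exact: measurableC.
  by rewrite setICl measure0.
rewrite setTD setCK.
rewrite (@ge0_integral_density _ _ _ mu nu _ (cst 1))//.
- by apply: eq_integral => r _; rewrite mule1.
- move=> A mA AB; rewrite (integral_cst mu mA 1) mul1e.
  by transitivity (mu (A `&` branching_partitions)); [exact: nuE|rewrite setIidl].
- exact: measurable_funTS.
Qed.

Variables (t q : R) (K L : R -> R).
Hypothesis t_ge0 : 0 <= t.
Hypothesis q_ge0 : 0 <= q.

Definition discounted (s : R) : R := q * expR (- theta * (t - s)).
Local Notation pw := discounted.

Hypothesis dK : forall s, 0 <= s <= t -> is_derive s 1 K (psi sigma c mu (pw s)).
Hypothesis dL : forall s, 0 <= s <= t -> is_derive s 1 L (M (pw s)).
Hypothesis cM : forall s, 0 <= s <= t -> {for s, continuous (fun s => M (pw s))}.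

Let pw_ge0 s : 0 <= pw s. Proof. by rewrite mulr_ge0// expR_ge0. Qed.

Let mpw : measurable_fun setT pw.
Proof.
apply: measurable_funM => //; apply: measurableT_comp => //.
by apply: measurable_funM => //; exact: measurable_funB.
Qed.

(** The exponent acting on the noise at age [r] is [pw (b + x) * expR (- theta * (x - r))], which is
    [pw (b + r)]; so one primitive [K] in absolute time serves all birth times. *)
Lemma displacement_laplace u b x : 0 <= b -> 0 <= x -> b + x <= t ->
  (\int[P]_w (exp_at (pw (b + x)) (displacement F u x w))%:E =
   (expR (K (b + x) - K b))%:E)%E.
Proof.
move=> b0 x0 bxt; have [_ [_ [_ [/(_ u) OUZ _]]]] := HF.
rewrite -[in K b](addr0 b).
apply: (OU_right_version_laplace OUZ (J := fun r => K (b + r))) => // r /andP[r0 rx].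
apply: is_derive_shift.
rewrite (_ : pw (b + x) * _ = pw (b + r)).
  by apply: dK; rewrite addr_ge0//= (le_trans _ bxt)// lerD2l.
by rewrite /pw -mulrA -expRD; congr (_ * expR _); ring.
Qed.

(* An individual born at time [s] and place [a] has, in the mean,
   [e^(discounted s * a) * descent k s] as its sum of [e^(q position)] over the
   descendants of relative generation [k] that are alive at time [t]. *)
Definition descent (k : nat) (s : R) : R :=
  if 0 <= s <= t
  then expR (K t - K s - rate * (t - s)) * ((L t - L s) ^+ k / k`!%:R) else 0.

Let M_ge0 s : 0 <= M (pw s).
Proof.
rewrite -lee_fin -ME//; apply: integral_ge0 => r _.
by apply: nneseries_ge0 => i _ _; rewrite lee_fin exp_at_ge0.
Qed.

Let L_le s : 0 <= s <= t -> L s <= L t.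
Proof.
move=> /andP[s0 st]; rewrite -subr_ge0 -lee_fin.
have <- : (\int[lebesgue_measure]_(x in `[s, t]) (M (pw x))%:E = (L t - L s)%:E)%E.
  apply: integral_is_derive => //.
  - by move=> x /andP[sx xt]; apply: dL; rewrite (le_trans s0).
  - by move=> x /andP[sx xt]; apply: cM; rewrite (le_trans s0).
by apply: integral_ge0 => x _; rewrite lee_fin.
Qed.

Lemma descent_ge0 k s : 0 <= descent k s.
Proof.
rewrite /descent; case: ifP => // st.
by rewrite mulr_ge0 ?expR_ge0// divr_ge0// exprn_ge0// subr_ge0 L_le.
Qed.

(** [K] and [L] are controlled on [[0, t]] only; cut off outside, they become measurable on the
    whole line. *)
Let on_0t (f : R -> R) (s : R) : R := if 0 <= s <= t then f s else 0.

Let measurable_on_0t (f : R -> R) :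
  (forall s, 0 <= s <= t -> {for s, continuous f}) -> measurable_fun setT (on_0t f).
Proof.
move=> cf; apply: measurable_fun_if => //.
  by apply: measurable_and; apply: measurable_fun_ler.
rewrite setTI (_ : _ @^-1` _ = `[0, t]%classic); last first.
  by apply/seteqP; split => s /=; rewrite in_itv/= => ->.
have cf' : {within `[0, t], continuous f}.
  by apply: continuous_in_subspaceT => x; rewrite inE/= in_itv/=; exact: cf.
exact: subspace_continuous_measurable_fun.
Qed.

Let mK : measurable_fun setT (on_0t K).
Proof. by apply: measurable_on_0t => s /dK; exact: is_derive_continuous. Qed.

Let mL : measurable_fun setT (on_0t L).
Proof. by apply: measurable_on_0t => s /dL; exact: is_derive_continuous. Qed.

Lemma measurable_descent k : measurable_fun setT (descent k).
Proof.
rewrite (_ : descent k = fun s => if 0 <= s <= t then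
    expR (K t - on_0t K s - rate * (t - s)) * ((L t - on_0t L s) ^+ k / k`!%:R)
  else 0); last first.
  by apply/funext => s; rewrite /descent /on_0t; case: ifP.
apply: measurable_fun_ifT => //.
  by apply: measurable_and; apply: measurable_fun_ler.
apply: measurable_funM.
  apply: measurableT_comp => //; apply: measurable_funB.
    exact: measurable_funB.
  by apply: measurable_funM => //; exact: measurable_funB.
by apply: measurable_funM => //; apply: measurable_funX; exact: measurable_funB.
Qed.

(* The factor [rate] of the density [rate e^(- rate x)] of the lifetime is part
   of [M]. *)
Lemma integral_descent k b : 0 <= b <= t ->
  (\int[lebesgue_measure]_(x in `]0%R, (t - b)%R])
     (descent k (b + x) * expR (K (b + x) - K b) *
      (expR (- (x * rate)) * M (pw (b + x))))%R%:E = (descent k.+1 b)%:E)%E.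
Proof.
move=> /andP[b0 bt].
have st x : 0 <= x <= t - b -> 0 <= b + x <= t.
  by move=> /andP[x0 xt]; rewrite addr_ge0//= addrC -lerBrDr.
pose C := expR (K t - K b - rate * (t - b)).
pose f x := C * ((L t - L (b + x)) ^+ k / k`!%:R * M (pw (b + x))).
(* The three exponentials multiply to the constant [C], independent of the branching time; what
   remains is the derivative of a power of [L t - L (b + x)]. *)
pose G x := - (C / k.+1`!%:R) * (L t - L (b + x)) ^+ k.+1.
transitivity (\int[lebesgue_measure]_(x in `]0%R, (t - b)%R]) (f x)%:E)%E.
  apply: eq_integral => x /[!inE]; rewrite /= in_itv/= => /andP[x0 xt].
  congr EFin; rewrite /descent st ?(ltW x0)// /f.
  have -> : C = expR (K t - K (b + x) - rate * (t - (b + x))) *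
      expR (K (b + x) - K b) * expR (- (x * rate)).
    by rewrite -!expRD /C; congr expR; ring.
  by ring.
transitivity ((G (t - b) - G 0)%:E); last first.
  rewrite /G addr0 (addrC b) subrK subrr expr0n/= mulr0 sub0r mulNr opprK.
  by rewrite /descent b0 bt /C -!mulrA; congr (_ * _)%:E; rewrite mulrC.
apply: integral_is_derive_oc; first by rewrite subr_ge0.
- move=> x xt; have bxt := st _ xt.
  have dP (y : R) : is_derive y (1 : R) (fun y : R => y ^+ k.+1) (k.+1%:R * y ^+ k).
    apply: DeriveDef; first exact: exprn_derivable.
    by rewrite exp_derive /GRing.scale/= mulr1.
  have := is_deriveB (is_derive_cst (L t) x (1 : R)) (is_derive_shift (dL bxt)).
  move=> /(is_derive1_comp (dP _)) /(is_deriveZ (- (C / k.+1`!%:R))).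
  rewrite sub0r /GRing.scale/= mulrN mulrNN /f.
  rewrite (_ : C / _ * _ = C * ((L t - L (b + x)) ^+ k / k`!%:R * M (pw (b + x))))//.
  have k0 : k`!%:R != 0 :> R by rewrite pnatr_eq0 -lt0n fact_gt0.
  have k1 : 1 + k%:R != 0 :> R by rewrite addrC natr1 pnatr_eq0.
  by rewrite factS natrM -nat1r /cst; field; rewrite k0 k1.
- move=> x xt; have bxt := st _ xt.
  apply: cvgM; first exact: cvg_cst.
  apply: cvgM; last first.
    apply: (@continuous_comp _ _ _ (fun x => b + x) (fun s => M (pw s))).
      by apply: cvgD; [exact: cvg_cst|exact: cvg_id].
    exact: cM.
  apply: cvgM; last exact: cvg_cst.
  apply: (@continuous_comp _ _ _ (fun x => L t - L (b + x)) (fun y => y ^+ k)).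
    apply: cvgB; first exact: cvg_cst.
    exact: (is_derive_continuous (is_derive_shift (dL bxt))).
  exact: exprn_continuous.
Qed.

(** The contribution of an individual with birth time [ba.1] and birth place [ba.2], when [h]
    accounts for what happens after its birth. Those born after [t], or never, count for nothing. *)
Definition weight (h : R -> R) (ba : \bar R * \bar R) : R :=
  if (ba.1 <= t%:E)%E then exp_at (pw (fine ba.1)) ba.2 * h (fine ba.1) else 0.

Let mfine d' (T : measurableType d') (f : T -> \bar R) :
  measurable_fun setT f -> measurable_fun setT (fun w => fine (f w)).
Proof. exact: (@measurableT_comp _ _ _ _ _ _ fine). Qed.

Lemma measurable_weight h : measurable_fun setT h -> measurable_fun setT (weight h).
Proof.
move=> mh; apply: measurable_fun_ifT => //; first exact: measurable_fun_lee.
apply: measurable_funM; last exact/(measurableT_comp mh)/mfine.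
by apply: measurable_exp_at => //; exact/(measurableT_comp mpw)/mfine.
Qed.

Lemma weight_ge0 h ba : (forall s, 0 <= h s) -> 0 <= weight h ba.
Proof. by move=> h0; rewrite /weight; case: ifP => // _; rewrite mulr_ge0// exp_at_ge0. Qed.

Let offspring v (p : R) : \bar R :=
  (\int[P]_w \sum_(i <oo) (exp_at p (dislocation F v w i))%:E)%E.

Let offspring_ge0 v p : (0 <= offspring v p)%E.
Proof.
by apply: integral_ge0 => w _; apply: nneseries_ge0 => i _ _; rewrite lee_fin exp_at_ge0.
Qed.

Let measurable_offspring v : measurable_fun setT (offspring v).
Proof.
pose f (pw : R * Omega) := (\sum_(i <oo) (exp_at pw.1 (dislocation F v pw.2 i))%:E)%E.
apply: (@measurable_fun_fubini_tonelli_F _ _ _ _ R P f).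
  apply: (@measurable_exp_at_sum _ _ _ fst (fun pw => dislocation F v pw.2)) => //.
  exact: (measurableT_comp (mdisl v)).
by move=> x; apply: nneseries_ge0 => i _ _; rewrite lee_fin exp_at_ge0.
Qed.

Let mdispl v x : 0 <= x -> measurable_fun setT (displacement F v x).
Proof.
move=> x0; have mx : measurable_fun setT (fun w : Omega => (x, w)).
  exact: pair1_measurable.
exact: (measurableT_comp (measurable_right_version (mmotion v)) mx).
Qed.

Let children (s : \bar R) (r : seqspace (\bar R)) : \bar R :=
  (\sum_(i <oo) (exp_at (pw (fine s)) (r i))%:E)%E.

(** The total weight of the children splits as [parent] times [children]: the second factor alone
    involves the dislocation, the first the birth data [ba] and the pair [lz] of lifetime and
    displacement. *)
Let parent k (ba lz : \bar R * \bar R) : R :=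
  if (ba.1 + lz.1 <= t%:E)%E then
    exp_at (pw (fine ba.1)) ba.2 *
      (descent k (fine (ba.1 + lz.1)%E) * exp_at (pw (fine (ba.1 + lz.1)%E)) lz.2)
  else 0.

Let children_ge0 s r : (0 <= children s r)%E.
Proof. by apply: nneseries_ge0 => i _ _; rewrite lee_fin exp_at_ge0. Qed.

Let parent_ge0 k ba lz : 0 <= parent k ba lz.
Proof.
by rewrite /parent; case: ifP => // _; rewrite !mulr_ge0// ?exp_at_ge0// descent_ge0.
Qed.

Let mparent d' (T : measurableType d') k (f g : T -> \bar R * \bar R) :
  measurable_fun setT f -> measurable_fun setT g ->
  measurable_fun setT (fun x => parent k (f x) (g x)).
Proof.
move=> mf mg.
have mf1 : measurable_fun setT (fun x => (f x).1) by exact: measurableT_comp.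
have mf2 : measurable_fun setT (fun x => (f x).2) by exact: measurableT_comp.
have mg1 : measurable_fun setT (fun x => (g x).1) by exact: measurableT_comp.
have mg2 : measurable_fun setT (fun x => (g x).2) by exact: measurableT_comp.
have ms : measurable_fun setT (fun x => (f x).1 + (g x).1)%E by exact: emeasurable_funD.
apply: measurable_fun_ifT => //; first exact: measurable_fun_lee.
apply: measurable_funM.
  by apply: measurable_exp_at => //; exact/(measurableT_comp mpw)/mfine.
apply: measurable_funM.
  exact/(measurableT_comp (measurable_descent k))/mfine.
by apply: measurable_exp_at => //; exact/(measurableT_comp mpw)/mfine.
Qed.

Let mchildren d' (T : measurableType d') (f : T -> \bar R)
    (g : T -> seqspace (\bar R)) :
  measurable_fun setT f -> measurable_fun setT g ->
  measurable_fun setT (fun x => children (f x) (g x)).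
Proof.
move=> mf mg; apply: measurable_exp_at_sum => //.
exact/(measurableT_comp mpw)/mfine.
Qed.

Let life_motion v : set (seq nat + (seq nat + seq nat)) :=
  [set k | k = inl v \/ k = inr (inl v)].

(* The lifetime is integrated last, once the dislocation and the motion have
   been averaged out at fixed lifetime. *)
Lemma integral_first_branching k v (b : R) (a : \bar R) : 0 <= b <= t ->
  (\int[P]_w ((parent k (b%:E, a) (life F v w, displacement F v (fine (life F v w)) w))%:E *
      children (b%:E + life F v w) (dislocation F v w)) =
   (exp_at (pw b) a * descent k.+1 b)%:E)%E.
Proof.
move=> bt; have /andP[b0 bt'] := bt.
pose f2 (y : (\bar R * \bar R) * seqspace (\bar R)) :=
  ((parent k (b%:E, a) y.1)%:E * children (b%:E + y.1.1) y.2)%E.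
have mf2 : measurable_fun setT f2.
  apply: emeasurable_funM.
    by apply/measurable_EFinP; apply: mparent => //; exact: measurable_cst.
  apply: mchildren => //; apply: emeasurable_funD => //.
  exact: measurableT_comp.
have := @integral_family _ _ _ P F mlife mmotion mdisl indF (life_motion v)
  [set inr (inr v)] _ _ _ _
  (fun w => (life F v w, displacement F v (fine (life F v w)) w))
  (dislocation F v) f2 _ _ _ mf2 _.
rewrite /f2/= => ->; last 4 first.
- by apply/seteqP; split => // x [/= [->|->]].
- apply/measurable_fun_pairP; split => /=.
    by apply: measurable_life; left.
  by apply: measurable_displacement_life; [left|right].
- exact: measurable_family_dislocation.
- by move=> y; rewrite mule_ge0// lee_fin.
transitivity (\int[P]_w ((parent k (b%:E, a)
    (life F v w, displacement F v (fine (life F v w)) w))%:E *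
    offspring v (pw (fine (b%:E + life F v w))))%E)%E.
  apply: eq_integral => w _; rewrite ge0_integralZl//.
  - by apply: mchildren => //; exact: measurable_cst.
  - by rewrite lee_fin.
pose f3 (y : \bar R * family_space F [set inr (inl v)]) :=
  ((parent k (b%:E, a) (y.1, displacement F v (fine y.1) y.2))%:E *
   offspring v (pw (fine (b%:E + y.1))))%E.
have mf3 : measurable_fun setT f3.
  apply: emeasurable_funM.
    apply/measurable_EFinP; apply: mparent => //.
    apply/measurable_fun_pairP; split; first exact: measurable_fst.
    have mp : measurable_fun setT (fun y : \bar R * family_space F [set inr (inl v)] =>
        (fine y.1, y.2)).
      by apply/measurable_fun_pairP; split; [exact: (mfine measurable_fst)|exact: measurable_snd].
    have Kv : [set inr (inl v)] (inr (inl v) : seq nat + (seq nat + seq nat)) by [].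
    exact: (measurableT_comp (measurable_displacement (F := F) Kv) mp).
  apply: (measurableT_comp (measurable_offspring v)).
  apply: (measurableT_comp mpw); apply: mfine.
  by apply: emeasurable_funD => //; exact: measurable_cst.
(* The identity map into [family_space] stands for the whole path of the motion, which is averaged
   while the lifetime is frozen. *)
have := @integral_family _ _ _ P F mlife mmotion mdisl indF [set inl v]
  [set inr (inl v)] _ _ _ (family_space F [set inr (inl v)])
  (life F v) id f3 _ _ _ mf3 _.
rewrite /f3/= => ->; last 4 first.
- by apply/seteqP; split => // x [/= ->].
- exact: measurable_life.
- exact: measurable_id.
- by move=> y; rewrite mule_ge0// lee_fin.
(* [on_0t K] replaces [K] for global measurability; the two agree where [descent] does not
   vanish. *)
pose H x : \bar R := ((descent k (b + x) * expR (on_0t K (b + x) - K b))%:E *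
  offspring v (pw (b + x)))%E.
pose phi x : \bar R := ((exp_at (pw b) a)%:E * H x)%E.
have H0 x : (0 <= H x)%E.
  by rewrite mule_ge0// lee_fin !mulr_ge0 ?descent_ge0 ?expR_ge0.
have phi0 x : (0 <= phi x)%E by rewrite mule_ge0// lee_fin exp_at_ge0.
have mb : measurable_fun setT (fun x => b + x) by exact: measurable_funD.
have mH : measurable_fun setT H.
  apply: emeasurable_funM.
    apply/measurable_EFinP; apply: measurable_funM.
      exact: (measurableT_comp (measurable_descent k)).
    apply: measurableT_comp => //; apply: measurable_funB => //.
    exact: (measurableT_comp mK).
  apply: (measurableT_comp (measurable_offspring v)).
  exact: (measurableT_comp mpw).
have mphi : measurable_fun setT phi by apply: emeasurable_funM.
transitivity (\int[P]_w (if (life F v w <= (t - b)%:E)%E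
    then phi (fine (life F v w)) else 0))%E.
  apply: eq_integral => w _.
  have := life_ge0 F v w; rewrite /parent/=; case: (life F v w) => [l| |]//=; last first.
    by rewrite integral0_eq// => w' _; rewrite mul0e.
  rewrite lee_fin => l0; rewrite -EFinD !lee_fin lerBrDl.
  case: ifPn => blt; last by rewrite integral0_eq// => w' _; rewrite mul0e.
  rewrite ge0_integralZr//; last 2 first.
  - apply/measurable_EFinP; do 2 (apply: measurable_funM => //).
    by apply: measurable_exp_at => //; exact: mdispl.
  - by move=> w' _; rewrite lee_fin !mulr_ge0 ?exp_at_ge0 ?descent_ge0.
  under eq_integral do rewrite EFinM EFinM.
  rewrite ge0_integralZl ?lee_fin ?exp_at_ge0//; last 2 first.
  - apply: emeasurable_funM => //; apply/measurable_EFinP.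
    by apply: measurable_exp_at => //; exact: mdispl.
  - by move=> w' _; rewrite -EFinM lee_fin mulr_ge0 ?exp_at_ge0 ?descent_ge0.
  rewrite ge0_integralZl ?lee_fin ?descent_ge0//; last 2 first.
  - by apply/measurable_EFinP; apply: measurable_exp_at => //; exact: mdispl.
  - by move=> w' _; rewrite lee_fin exp_at_ge0.
  rewrite displacement_laplace// /phi /H /on_0t addr_ge0//= blt.
  by rewrite !EFinM !muleA.
(* Lifetimes are almost surely positive, so the closed range may be replaced by the half-open one on
   which the density is known. *)
transitivity (\int[P]_w (if (0 < life F v w <= (t - b)%:E)%E
    then phi (fine (life F v w)) else 0))%E.
  have mfl : measurable_fun setT (phi \o (fun w => fine (life F v w))).
    exact/(measurableT_comp mphi)/mfine.
  apply: ge0_ae_eq_integral => //.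
  - by apply: measurable_fun_ifT => //; exact: measurable_fun_lee.
  - apply: measurable_fun_ifT => //; apply: measurable_and.
      exact: measurable_fun_lte.
    exact: measurable_fun_lee.
  - by move=> w _; case: ifP.
  - by move=> w _; case: ifP.
  - by apply: filterS (life_gt0 v) => w /= -> _.
rewrite (@integral_lifetime _ _ _ P _ rate)//; last 3 first.
- by move=> x; exact: life_tail.
- by rewrite subr_ge0.
- exact: measurable_funTS.
under eq_integral do rewrite -muleA.
rewrite ge0_integralZl ?lee_fin ?exp_at_ge0//; last 2 first.
- apply: emeasurable_funM; first exact: measurable_funTS.
  apply/measurable_EFinP/measurable_funTS; apply: measurable_funM => //.
  by apply: measurableT_comp => //; apply: measurableT_comp => //; exact: measurable_funM.
- by move=> x _; rewrite mule_ge0// lee_fin mulr_ge0// expR_ge0.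
rewrite EFinM -(integral_descent k bt); congr (_ * _)%E.
apply: eq_integral => x /[!inE]; rewrite /= in_itv/= => /andP[x0 xt].
have bxt : 0 <= b + x <= t by rewrite addr_ge0 ?(ltW x0)//= -lerBrDl.
rewrite /H /on_0t bxt [RHS]EFinM (EFinM (expR (- (x * rate)))) (EFinM rate).
rewrite -(offspring_mean v (pw_ge0 _)) -/(offspring v _) -muleA; congr (_ * _)%E.
by rewrite muleCA [in RHS]muleCA; congr (_ * _)%E; rewrite muleC.
Qed.

Let mbirth v : measurable_fun setT (birth F v).
Proof. exact: (measurable_familyT mlife mmotion mdisl (@measurable_birth _ _ _ F v)). Qed.

Let mplace v : measurable_fun setT (place F theta v).
Proof. exact: (measurable_familyT mlife mmotion mdisl (@measurable_place _ _ _ F theta v)). Qed.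

Let mweight k v : measurable_fun setT (fun w =>
  (weight (descent k) (birth F v w, place F theta v w))%:E).
Proof.
apply/measurable_EFinP.
apply: (measurableT_comp (measurable_weight (measurable_descent k))).
by apply/measurable_fun_pairP; split; [exact: mbirth|exact: mplace].
Qed.

Let wd_ge0 k ba : 0 <= weight (descent k) ba.
Proof. by apply: weight_ge0 => s; exact: descent_ge0. Qed.

Let past_node v : past (size v) `&` [set k | node k = v] = set0.
Proof. by apply/seteqP; split => // k [/= + kv]; rewrite /past/= kv ltnn. Qed.

(** The birth data of [v] belong to the strict past, independent of the variables at [v]; averaging
    the latter first, at fixed birth time and place, trades one generation in the tree for one unit
    of [k]. *)
Lemma sum_children k v :
  (\sum_(i <oo) \int[P]_w
     (weight (descent k) (birth F (i :: v) w, place F theta (i :: v) w))%:E =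
   \int[P]_w (weight (descent k.+1) (birth F v w, place F theta v w))%:E)%E.
Proof.
rewrite -integral_nneseries//; last by move=> i w _; rewrite lee_fin.
pose f (x : (\bar R * \bar R) * ((\bar R * \bar R) * seqspace (\bar R))) :=
  ((parent k x.1 x.2.1)%:E * children (x.1.1 + x.2.1.1) x.2.2)%E.
pose Y w := ((life F v w, displacement F v (fine (life F v w)) w), dislocation F v w).
transitivity (\int[P]_w f ((birth F v w, place F theta v w), Y w))%E.
  apply: eq_integral => w _; rewrite /f/= /parent/= /weight/= /children.
  have := birth_ge0 F v w; have := life_ge0 F v w.
  move: (birth F v w) (life F v w) => [b| |] [l| |]//=; rewrite ?lee_fin => l0 b0;
    try by rewrite mul0e eseries0.
  case: ifP => _; last by rewrite mul0e eseries0.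
  rewrite -nneseriesZl; last by move=> i _; rewrite lee_fin exp_at_ge0.
  apply: eq_eseriesr => i _; rewrite -EFinM; congr EFin.
  rewrite !exp_atD exp_atZ ?expR_gt0//.
  have -> : pw (b + l) * expR (- theta * l) = pw b.
    by rewrite /pw -mulrA -expRD; congr (_ * expR _); ring.
  by ring.
have mf : measurable_fun setT f.
  apply: emeasurable_funM.
    by apply/measurable_EFinP; apply: mparent => //; exact: measurableT_comp.
  apply: mchildren; last exact: measurableT_comp.
  apply: emeasurable_funD; first exact: measurableT_comp.
  by apply: measurableT_comp => //; exact: measurableT_comp.
rewrite (@integral_family _ _ _ P F mlife mmotion mdisl indF (past (size v))
  [set k | node k = v] _ _ _ _ (fun w => (birth F v w, place F theta v w)) Y f
  (past_node v))//; last 3 first.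
- apply/measurable_fun_pairP; split; first exact: measurable_birth.
  exact: measurable_place.
- apply/measurable_fun_pairP; split; last exact: measurable_family_dislocation.
  apply/measurable_fun_pairP; split; first exact: measurable_life.
  exact: measurable_displacement_life.
- by move=> x; rewrite mule_ge0// lee_fin.
apply: eq_integral => w1 _; rewrite /f /weight/=.
have := birth_ge0 F v w1; move: (birth F v w1) (place F theta v w1) => [b| |]//= a.
  (* When [v] is born after [t], so are its children, and both sides vanish. *)
  rewrite !lee_fin => b0; case: ifPn => bt.
    by apply: integral_first_branching; rewrite b0.
  apply: integral0_eq => w2 _; rewrite /parent/=.
  have := life_ge0 F v w2; case: (life F v w2) => [l| |]//=; last by rewrite mul0e.
  rewrite !lee_fin => l0; case: ifPn => [blt|_]; last by rewrite mul0e.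
  by exfalso; move/negP : bt; apply; rewrite (le_trans _ blt)// lerDl.
move=> _; apply: integral0_eq => w2 _; rewrite /parent/=.
by have := life_ge0 F v w2; case: (life F v w2) => [l| |]//=; rewrite mul0e.
Qed.

(** On the almost sure event where the modifications agree with the original variables, this is
    [e^(q z)] for an individual alive at [t] at position [z]: the inherited place is damped by
    [expR (- theta * (t - b))], which turns its exponent [q] into the discounted one at the birth
    time [b]. *)
Definition alive_weight v w : R :=
  if (birth F v w <= t%:E)%E && (t%:E < birth F v w + life F v w)%E then
    exp_at (pw (fine (birth F v w))) (place F theta v w) *
      exp_at q (displacement F v (t - fine (birth F v w)) w)
  else 0.

(** Given the past, survival until [t] and the motion until [t] are independent; their means
    [expR (- ((t - b) * rate))] and [expR (K t - K b)] multiply to [descent 0 b]. *)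
Lemma integral_alive_weight v :
  (\int[P]_w (alive_weight v w)%:E =
   \int[P]_w (weight (descent 0) (birth F v w, place F theta v w))%:E)%E.
Proof.
(* The motion is read at age [t - b], a function of the past, so the second argument carries the
   whole path and not a single value. *)
pose f (x : (\bar R * \bar R) * (\bar R * family_space F (life_motion v))) : \bar R :=
  (if (x.1.1 <= t%:E)%E && (t%:E < x.1.1 + x.2.1)%E then
    exp_at (pw (fine x.1.1)) x.1.2 *
      exp_at q (displacement F v (t - fine x.1.1) x.2.2)
  else 0)%:E.
have f0 x : (0 <= f x)%E.
  by rewrite lee_fin; case: ifP => // _; rewrite mulr_ge0 ?exp_at_ge0.
have mf : measurable_fun setT f.
  have m11 : measurable_fun setT
      (fun x : (\bar R * \bar R) * (\bar R * family_space F (life_motion v)) => x.1.1).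
    exact: measurableT_comp.
  have m12 : measurable_fun setT
      (fun x : (\bar R * \bar R) * (\bar R * family_space F (life_motion v)) => x.1.2).
    exact: measurableT_comp.
  have m21 : measurable_fun setT
      (fun x : (\bar R * \bar R) * (\bar R * family_space F (life_motion v)) => x.2.1).
    exact: measurableT_comp.
  have m22 : measurable_fun setT
      (fun x : (\bar R * \bar R) * (\bar R * family_space F (life_motion v)) => x.2.2).
    exact: measurableT_comp.
  apply/measurable_EFinP; apply: measurable_fun_ifT => //.
    apply: measurable_and; first exact: measurable_fun_lee.
    by apply: measurable_fun_lte => //; exact: emeasurable_funD.
  apply: measurable_funM.
    by apply: measurable_exp_at => //; exact/(measurableT_comp mpw)/mfine.
  apply: measurable_exp_at => //.
  have mp : measurable_fun setT
      (fun x : (\bar R * \bar R) * (\bar R * family_space F (life_motion v)) =>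
        (t - fine x.1.1, x.2.2)).
    apply/measurable_fun_pairP; split; last exact: m22.
    by apply: measurable_funB => //; exact: mfine.
  have Kv : life_motion v (inr (inl v)) by right.
  exact: (measurableT_comp (measurable_displacement (F := F) Kv) mp).
have := @integral_family _ _ _ P F mlife mmotion mdisl indF (past (size v))
  (life_motion v) _ _ _ (\bar R * family_space F (life_motion v))%type
  (fun w => (birth F v w, place F theta v w)) (fun w => (life F v w, w)) f _ _ _ mf f0.
rewrite {1}/f /alive_weight/= => ->; last 3 first.
- by apply/seteqP; split => // k [/= + [kv|kv]]; rewrite /past/= kv ltnn.
- apply/measurable_fun_pairP; split; first exact: measurable_birth.
  exact: measurable_place.
- apply/measurable_fun_pairP; split; last exact: measurable_id.
  by apply: measurable_life; left.
apply: eq_integral => w1 _; rewrite /f /weight/=.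
have := birth_ge0 F v w1; move: (birth F v w1) (place F theta v w1) => [b| |]//= a; last first.
  by move=> _; apply: integral0_eq => w2 _.
rewrite !lee_fin => b0; case: ifPn => bt; last by apply: integral0_eq => w2 _.
have tb0 : 0 <= t - b by rewrite subr_ge0.
have pwt : pw t = q by rewrite /pw subrr mulr0 expR0 mulr1.
pose g (y : \bar R * \bar R) : \bar R :=
  (if (t%:E < b%:E + y.1)%E then exp_at (pw b) a * exp_at q y.2 else 0)%:E.
have := @integral_family _ _ _ P F mlife mmotion mdisl indF [set inl v]
  [set inr (inl v)] _ _ _ _ (life F v) (displacement F v (t - b)) g _ _ _ _ _.
rewrite /g/= => ->; last 5 first.
- by apply/seteqP; split => // x [/= ->].
- exact: measurable_life.
- have Kv : [set inr (inl v)] (inr (inl v) : seq nat + (seq nat + seq nat)) by [].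
  have mx : measurable_fun setT (fun w : family_space F [set inr (inl v)] => (t - b, w)).
    exact: pair1_measurable.
  exact: (measurableT_comp (measurable_displacement (F := F) Kv) mx).
- apply/measurable_EFinP; apply: measurable_fun_ifT => //.
    by apply: measurable_fun_lte => //; exact: emeasurable_funD.
  by apply: measurable_funM => //; exact: measurable_exp_at.
- by move=> y; rewrite lee_fin; case: ifP => // _; rewrite mulr_ge0 ?exp_at_ge0.
have mlt : measurable [set w | ((t - b)%:E < life F v w)%E].
  by rewrite -[X in measurable X]setTI; exact: measurable_lte.
transitivity (\int[P]_w ((exp_at (pw b) a * expR (K t - K b))%:E *
    (\1_[set w | ((t - b)%:E < life F v w)%E] w)%:E)%E)%E.
  apply: eq_integral => w2 _; rewrite indicE.
  have -> : (w2 \in [set w | ((t - b)%:E < life F v w)%E]) = (t%:E < b%:E + life F v w2)%E.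
    apply/idP/idP; rewrite inE/=; case: (life F v w2) => [l| |]//=;
      by rewrite ?ltry// ?lte_fin ltrBlDl.
  case: (t%:E < b%:E + life F v w2)%E; last by rewrite mule0; exact: integral0_eq.
  rewrite mule1; under eq_integral do rewrite EFinM.
  rewrite ge0_integralZl ?lee_fin ?exp_at_ge0//; last 2 first.
  - by apply/measurable_EFinP; apply: measurable_exp_at => //; exact: mdispl.
  - by move=> w' _; rewrite lee_fin exp_at_ge0.
  have := @displacement_laplace v b (t - b) b0 tb0.
  by rewrite addrC subrK pwt => -> //; rewrite -EFinM.
rewrite ge0_integralZl//; last 2 first.
- exact/measurable_EFinP/measurable_indic.
- by rewrite lee_fin mulr_ge0 ?exp_at_ge0 ?expR_ge0.
rewrite integral_indic// setIT.
transitivity ((exp_at (pw b) a * expR (K t - K b))%:E * (expR (- ((t - b) * rate)))%:E)%E.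
  by congr (_ * _)%E; exact: life_tail.
rewrite -EFinM /descent b0 bt/= expr0 fact0 divr1 mulr1 -mulrA -expRD.
by congr (_ * expR _)%:E; ring.
Qed.

(** Generality in [k] drives the induction: each use of [sum_children] lowers the depth and raises
    [k], down to the root, born at time 0 and place 0 with weight [descent k 0]. *)
Lemma generation_mean n k :
  (\esum_(u in [set u | size u = n])
     \int[P]_w (weight (descent k) (birth F u w, place F theta u w))%:E =
   (descent (n + k) 0)%:E)%E.
Proof.
elim: n k => [|n IH] k.
  rewrite (_ : [set u | size u = 0%N] = [set [::]]); last first.
    by apply/seteqP; split => u /= => [/size0nil|->].
  rewrite esum_set1; last by apply: integral_ge0 => w _; rewrite lee_fin.
  rewrite /weight/= lee_fin t_ge0 mulr0 expR0 mul1r.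
  transitivity (\int[P]_w (cst (descent k 0)%:E w))%E => //.
  by rewrite integral_cst//= probability_setT mule1.
rewrite esum_generation; last by move=> u; apply: integral_ge0 => w _; rewrite lee_fin.
under eq_esum do rewrite sum_children.
by rewrite IH addnS.
Qed.

Let malive u : measurable_fun setT (fun w => (alive_weight u w)%:E).
Proof.
apply/measurable_EFinP; apply: measurable_fun_ifT => //.
  apply: measurable_and; first exact: measurable_fun_lee.
  by apply: measurable_fun_lte => //; exact: emeasurable_funD.
apply: measurable_funM.
  by apply: measurable_exp_at => //; exact/(measurableT_comp mpw)/mfine.
apply: measurable_exp_at => //.
have mp : measurable_fun setT (fun w => (t - fine (birth F u w), w)).
  apply/measurable_fun_pairP; split; last exact: measurable_id.
  by apply: measurable_funB => //; exact: mfine.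
exact: (measurableT_comp (measurable_right_version (mmotion u)) mp).
Qed.

Lemma alive_weight_ge0 u w : 0 <= alive_weight u w.
Proof. by rewrite /alive_weight; case: ifP => // _; rewrite mulr_ge0 ?exp_at_ge0. Qed.

Lemma measurable_alive_sum :
  measurable_fun setT (fun w => \esum_(u in [set: seq nat]) (alive_weight u w)%:E)%E.
Proof. by apply: measurable_esum => // u w; rewrite lee_fin alive_weight_ge0. Qed.

Lemma mean_alive :
  (\int[P]_w (\esum_(u in [set: seq nat]) (alive_weight u w)%:E) =
   (expR (K t - K 0 - rate * t + (L t - L 0)))%:E)%E.
Proof.
rewrite ge0_integral_esum//; last by move=> u w; rewrite lee_fin alive_weight_ge0.
under eq_esum do rewrite integral_alive_weight.
rewrite esum_generations; last by move=> u; apply: integral_ge0 => w _; rewrite lee_fin.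
under eq_eseriesr do rewrite generation_mean addn0.
rewrite (eq_eseriesr (g := fun n =>
  ((expR (K t - K 0 - rate * t))%:E * (exp_coeff (L t - L 0) n)%:E)%E)); last first.
  by move=> n _; rewrite /descent lexx t_ge0/= subr0 -EFinM.
have coeff_ge0 n : (0 <= (exp_coeff (L t - L 0) n)%:E)%E.
  by rewrite lee_fin divr_ge0// exprn_ge0// subr_ge0 L_le// lexx.
rewrite nneseriesZl// [in RHS]expRD [in RHS]EFinM; congr (_ * _)%E.
apply/cvg_lim => //; under eq_fun do rewrite sumEFin.
apply: cvg_EFin; first exact: nearW.
exact: is_cvg_series_exp_coeff.
Qed.

End mean.

Section integrals.
Context d (T : measurableType d) (R : realType) (mu : {measure set T -> \bar R}).

(** The integral of [g] may be infinite. Then so is that of the positive part of [f + g], since [g]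
    is at most this part plus [|f|], while the negative part is bounded by [|f|]. *)
Lemma integralD_integrable_ge0 (D : set T) (f : T -> R) (g : T -> \bar R) :
  measurable D -> mu.-integrable D (EFin \o f) -> measurable_fun D g ->
  (forall x, D x -> (0 <= g x)%E) ->
  (\int[mu]_(x in D) ((f x)%:E + g x) =
   \int[mu]_(x in D) (f x)%:E + \int[mu]_(x in D) g x)%E.
Proof.
move=> mD intf mg g0.
have [mf foo] := integrableP _ _ _ intf.
have fint := integrable_fin_num mD intf.
have [goo|] := ltP (\int[mu]_(x in D) g x)%E +oo%E.
  rewrite integralD//; apply/integrableP; split => //.
  by under eq_integral => x /[!inE] Dx do rewrite gee0_abs ?g0//.
rewrite leye_eq => /eqP goo; rewrite goo addey; last by apply: contraTN fint => /eqP ->.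
have mfg : measurable_fun D (fun x => (f x)%:E + g x)%E by exact: emeasurable_funD.
rewrite integralE.
have posE : (\int[mu]_(x in D) (fun x => (f x)%:E + g x)^\+ x = +oo)%E.
  apply/eqP; rewrite -leye_eq leNgt; apply/negP => posoo.
  have : (+oo <= \int[mu]_(x in D) ((fun x => (f x)%:E + g x)^\+ x + `|(f x)%:E|))%E.
    rewrite -goo; apply: ge0_le_integral => //.
    - by apply: emeasurable_funD; [exact: measurable_funepos|exact: measurableT_comp].
    move=> x Dx; rewrite funeposE.
    have := g0 x Dx; case: (g x) => [r| |]//= r0.
      rewrite lee_fin in r0; rewrite -EFinD -EFin_max -EFinD lee_fin.
      have := ler_norm (- f x); rewrite normrN => Hf.
      by apply: (@le_trans _ _ (f x + r + `|f x|)); [lra|rewrite lerD2r le_max lexx].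
  rewrite ge0_integralD//; last 2 first.
  - exact: measurable_funepos.
  - exact: measurableT_comp.
  by rewrite leNgt lte_add_pinfty.
rewrite posE addye// eqe_oppLR /=.
have : (\int[mu]_(x in D) (fun x => (f x)%:E + g x)^\- x < +oo)%E.
  apply: le_lt_trans foo; apply: ge0_le_integral => //.
  - exact: measurable_funeneg.
  - exact: measurableT_comp.
  move=> x Dx; rewrite funenegE.
  have := g0 x Dx; case: (g x) => [r| |]//= r0.
    rewrite lee_fin in r0; rewrite -EFin_max lee_fin ge_max normr_ge0 andbT.
    by have := ler_norm (- f x); rewrite normrN; lra.
  by rewrite maxNye lee_fin normr_ge0.
by move=> h; apply/eqP => E; rewrite E in h.
Qed.

End integrals.

(** * Cumulants *)

Section cumulant_bounds.
Context {R : realType}.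

(** From [expR (- z) >= 1 - z] one gets [expR z <= (1 - z)^-1], and [(1 + z + z ^+ 2) * (1 - z) = 1
    - z ^+ 3 >= 1]. *)
Lemma expR_quadratic_bound (z : R) : z <= 0 -> 0 <= expR z - 1 - z <= z ^+ 2.
Proof.
move=> z0; apply/andP; split; first by have := expR_ge1Dx z; lra.
have z1 : 0 < 1 - z by lra.
have h : expR z <= (1 - z)^-1.
  by rewrite -[expR z]invrK -expRN lef_pV2 ?posrE ?expR_gt0//; have := expR_ge1Dx (- z); lra.
have : (1 - z)^-1 <= 1 + z + z ^+ 2.
  rewrite -[leLHS]mul1r ler_pdivrMr//.
  have : 0 <= z ^+ 2 * (- z) by rewrite mulr_ge0 ?sqr_ge0//; lra.
  by rewrite !expr2; nra.
lra.
Qed.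

(** The part of the integrand of the cumulant that depends on the first coordinate only; the other
    coordinates add nonnegative terms. *)
Definition compensated (p : R) (r : \bar R) : R :=
  exp_at p r - 1 + p * (1 - exp_at 1 r).

(** With [y = expR x]: if [y < 1 / 2], then [4 * (1 - y) ^+ 2 >= 1] and the crude bound by [1 + p]
    is enough. Otherwise [- x <= 2 * (1 - y)], the linear terms cancel, and the quadratic remainders
    are at most [(1 + p) ^+ 2 * x ^+ 2]; this is the origin of the 4. *)
Lemma compensated_bound (p : R) (r : \bar R) : 0 <= p -> (r <= 0)%E ->
  `|compensated p r| <= 4 * (1 + p) ^+ 2 * (1 - exp_at 1 r) ^+ 2.
Proof.
move=> p0; rewrite /compensated; case: r => [x| |] //= => [|_]; last first.
  by rewrite sub0r subr0 mulr1 expr1n mulr1 ler_norml; nra.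
rewrite lee_fin mul1r => x0.
have y0 : 0 < expR x by exact: expR_gt0.
have y1 : expR x <= 1 by rewrite -expR0 ler_expR.
have px0 : p * x <= 0 by rewrite mulr_ge0_le0.
have e0 : 0 < expR (p * x) by exact: expR_gt0.
have e1 : expR (p * x) <= 1 by rewrite -expR0 ler_expR.
set y := expR x in y0 y1 *; set e := expR (p * x) in e0 e1 *.
have [y2|y2] := leP (1 / 2) y; last first.
  have : 1 / 4 <= (1 - y) ^+ 2 by rewrite expr2; nra.
  by rewrite ler_norml => h; apply/andP; split; nra.
have /andP[Ex1 Ex2] := expR_quadratic_bound x0.
have /andP[Ep1 Ep2] := expR_quadratic_bound px0.
rewrite -/y in Ex1 Ex2; rewrite -/e in Ep1 Ep2.
have xy : - x <= 2 * (1 - y).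
  have : 1 - x <= y^-1 by rewrite -expRN; have := expR_ge1Dx (- x); lra.
  have yV : y^-1 - 1 <= 2 * (1 - y).
    rewrite lerBlDr -[leLHS]mul1r ler_pdivrMr//; nra.
  lra.
have x2 : x ^+ 2 <= 4 * (1 - y) ^+ 2.
  by rewrite -[x ^+ 2]sqrrN (_ : 4 * _ = (2 * (1 - y)) ^+ 2); [rewrite ler_sqr ?nnegrE; lra|ring].
have -> : e - 1 + p * (1 - y) = (e - 1 - p * x) - p * (y - 1 - x) by ring.
apply: (@le_trans _ _ ((1 + p) ^+ 2 * x ^+ 2)).
  have pp : p * (y - 1 - x) <= p * x ^+ 2 by rewrite ler_wpM2l.
  have pp' : 0 <= p * (y - 1 - x) by rewrite mulr_ge0.
  have x20 : 0 <= x ^+ 2 by rewrite sqr_ge0.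
  have pxx : 0 <= p * x ^+ 2 by rewrite mulr_ge0.
  have ppxx : 0 <= p ^+ 2 * x ^+ 2 by rewrite mulr_ge0 ?sqr_ge0.
  have E1 : (p * x) ^+ 2 = p ^+ 2 * x ^+ 2 by ring.
  have E2 : (1 + p) ^+ 2 * x ^+ 2 = x ^+ 2 + 2 * (p * x ^+ 2) + p ^+ 2 * x ^+ 2 by ring.
  by rewrite ler_norml E2 -E1 in ppxx *; apply/andP; split; lra.
rewrite [leRHS](_ : _ = (1 + p) ^+ 2 * (4 * (1 - y) ^+ 2)); last by ring.
by rewrite ler_wpM2l ?sqr_ge0.
Qed.

End cumulant_bounds.

Lemma continuous_exp_at_sum (R : realType) (r : nat -> \bar R) (N : nat) :
  continuous (fun a : R => \sum_(i < N) exp_at a (r i)).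
Proof.
elim: N => [|N IH] a.
  by under eq_fun do rewrite big_ord0; exact: cvg_cst.
under eq_fun do rewrite big_ord_recr/=.
apply: cvgD; first exact: IH.
case: (r N) => [x| |] /=; [|exact: cvg_cst..].
apply: continuous_comp; last exact: continuous_expR.
by apply: cvgM; [exact: cvg_id|exact: cvg_cst].
Qed.

(** * Finiteness and continuity of the mean offspring *)

Section finite_births.
Context {R : realType}.
Variable mu : {measure set (seqspace (\bar R)) -> \bar R}.
Hypothesis mufb : finite_birth_measure mu.
Implicit Types r : seqspace (\bar R).

Local Notation LP := (@log_partitions R).
Local Notation LP1 := (@log_partitions1 R).
Local Notation BP := (@branching_partitions R).

Let mLP := @measurable_log_partitions R.
Let mLP1 := @measurable_log_partitions1 R.
Let mBP := @measurable_branching_partitions R.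

Lemma exp_at_le1 (p : R) x : 0 <= p -> (x <= 0)%E -> exp_at p x <= 1.
Proof.
move=> p0; case: x => //= x; rewrite lee_fin => x0.
by rewrite -expR0 ler_expR mulr_ge0_le0.
Qed.

(** Both integrability conditions are used: a branching partition either has first coordinate [-oo],
    where the squared term equals 1, or has at least one finite coordinate, so that [nb_series] is
    at least 1. *)
Lemma branching_rate_fin : branching_rate mu \is a fin_num.
Proof.
have [_ _ _ sq_int nb_int] := mufb.
rewrite ge0_fin_numE; last exact: measure_ge0.
rewrite /branching_rate -[mu _]mul1e -integral_cst//.
pose g r : \bar R := (((1 - exp_at 1 (r 0%N)) ^+ 2)%:E + nb_series r)%E.
have msq : measurable_fun setT (fun r : seqspace (\bar R) =>
    ((1 - exp_at 1 (r 0%N)) ^+ 2)%:E).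
  apply/measurable_EFinP; apply: measurable_funX; apply: measurable_funB => //.
  by apply: measurable_exp_at => //; exact: measurable_coord.
have mg : measurable_fun setT g.
  by apply: emeasurable_funD => //; exact: measurable_nb_series.
have nb0 r : (0 <= nb_series r)%E by apply: nneseries_ge0 => i _ _; rewrite lee_fin.
apply: (@le_lt_trans _ _ (\int[mu]_(r in BP) g r)%E).
  apply: ge0_le_integral => //.
  - exact: measurable_funTS.
  move=> r [LPr nLP1r]; rewrite /g.
  have [rm r0 _] := LPr.
  have [r0N|r0N] := eqVneq (r 0%N) -oo%E.
    by rewrite r0N/= subr0 expr1n leeDl.
  rewrite (le_trans _ (leeDr _ _))//; last by rewrite lee_fin sqr_ge0.
  rewrite (le_trans _ (nneseries_lim_ge 1 _))//.
  by rewrite big_nat1 ltNye r0N.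
rewrite ge0_integralD//; last 3 first.
- by move=> r _; rewrite lee_fin sqr_ge0.
- exact: measurable_funTS.
- by apply: measurable_funTS; exact: measurable_nb_series.
rewrite lte_add_pinfty//.
  apply: le_lt_trans sq_int; apply: ge0_subset_integral => //.
  - exact: measurable_funTS.
  - by move=> r _; rewrite lee_fin sqr_ge0.
  - exact: subDsetl.
apply: le_lt_trans nb_int; rewrite le_eqVlt; apply/orP; left; apply/eqP.
by apply: eq_integral => r /[!inE] -[LPr _]; rewrite nb_finite_series.
Qed.

Definition mean_offspring (p : R) : R :=
  fine (\int[mu]_(r in BP) \sum_(i <oo) (exp_at p (r i))%:E)%E.

Let nb_integrable : mu.-integrable BP nb_series.
Proof.
have [_ _ _ _ nb_int] := mufb.
apply/integrableP; split; first by apply: measurable_funTS; exact: measurable_nb_series.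
apply: le_lt_trans nb_int; rewrite le_eqVlt; apply/orP; left; apply/eqP.
apply: eq_integral => r /[!inE] -[LPr _]; rewrite nb_finite_series// gee0_abs//.
by apply: nneseries_ge0 => i _ _; rewrite lee_fin.
Qed.

Let sum_ge0 (p : R) r : (0 <= \sum_(i <oo) (exp_at p (r i))%:E)%E.
Proof. by apply: nneseries_ge0 => i _ _; rewrite lee_fin exp_at_ge0. Qed.

Let msum (p : R) : measurable_fun BP (fun r => \sum_(i <oo) (exp_at p (r i))%:E)%E.
Proof.
by apply: measurable_funTS; exact: (@measurable_exp_at_sum _ _ _ (fun=> p) id).
Qed.

Let sum_integrable (p : R) : 0 <= p ->
  mu.-integrable BP (fun r => \sum_(i <oo) (exp_at p (r i))%:E)%E.
Proof.
move=> p0; apply: le_integrable nb_integrable => // r [LPr _].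
rewrite !gee0_abs//; first exact: exp_at_sum_le_nb.
by apply: nneseries_ge0 => i _ _; rewrite lee_fin.
Qed.

Lemma mean_offspringE (p : R) : 0 <= p ->
  (\int[mu]_(r in BP) \sum_(i <oo) (exp_at p (r i))%:E = (mean_offspring p)%:E)%E.
Proof. by move=> p0; rewrite fineK// integrable_fin_num// sum_integrable. Qed.

Lemma nb_series_finite r : LP r -> (nb_series r < +oo)%E ->
  exists N, forall i, (N <= i)%N -> r i = -oo%E.
Proof.
move=> [rm _ _] nboo.
have mono i j : (i <= j)%N -> (r j <= r i)%E.
  elim: j => [|j IH]; first by rewrite leqn0 => /eqP ->.
  by rewrite leq_eqVlt => /predU1P[->//|/IH]; exact: le_trans.
have [[N rN]|rfin] := pselect (exists N, r N = -oo%E).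
  by exists N => i Ni; apply/eqP; rewrite -leeNy_eq -rN mono.
exfalso; have r_gt i : (-oo < r i)%E.
  by rewrite ltNye; apply/eqP => ri; apply: rfin; exists i.
have nbN n : (n%:R%:E <= nb_series r)%E.
  apply: le_trans (nneseries_lim_ge n _); last by move=> i _ _; rewrite lee_fin.
  rewrite (eq_big_nat _ _ (F2 := fun=> 1%E)); last by move=> i _; rewrite r_gt.
  by rewrite sumEFin big_const_nat subn0 iter_addr_0.
move: nboo nbN; case: (nb_series r) => [x| |] //= _ nbN; last by have := nbN 0%N.
have := nbN (Num.bound `|x|); rewrite lee_fin.
have := archi_boundP (normr_ge0 x); have := ler_norm x; lra.
Qed.

(** Domination by the integrable [nb_series], uniform in the exponent. For almost every branching
    partition this count is finite, so the series is a finite sum of continuous functions. *)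
Lemma mean_offspring_continuous (p : R) : 0 < p -> {for p, continuous mean_offspring}.
Proof.
move=> p0.
have sum_fin r a : LP r -> (nb_series r < +oo)%E -> 0 <= a ->
    (\sum_(i <oo) (exp_at a (r i))%:E \is a fin_num)%E.
  move=> LPr nbr a0; rewrite ge0_fin_numE//.
  by apply: le_lt_trans nbr; exact: exp_at_sum_le_nb.
have nb_ae : \forall r \ae mu, BP r -> (nb_series r < +oo)%E.
  apply: filterS (integrable_ae mBP nb_integrable) => r /[apply].
  by rewrite fin_numE => /andP[_]; rewrite ltey.
pose f a r := fine (\sum_(i <oo) (exp_at a (r i))%:E)%E.
have fE a : 0 <= a -> \int[mu]_(r in BP) f a r = mean_offspring a.
  move=> a0; rewrite /Rintegral; congr fine; apply: ae_eq_integral => //.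
  - by apply/measurable_EFinP; apply: measurableT_comp => //; exact: msum.
  - apply: filterS nb_ae => r /[swap] Br /(_ Br) nbr.
    by rewrite fineK// sum_fin//; case: Br.
have fine_le_id (x : \bar R) : (0 <= x)%E -> ((fine x)%:E <= x)%E.
  by case: x => [x| |] //= _; rewrite leey.
have ip : p \in `]0, (p + p)[ by rewrite in_itv/= p0 ltrDl.
have cE : {for p, continuous (fun a : R => \int[mu]_(r in BP) f a r)}.
  apply: (@continuity_under_integral R _ _ mu f BP mBP 0 (p + p) _ _
    (fun r => fine (nb_series r))) => //.
  - move=> a /=; rewrite in_itv/= => /andP[/ltW a0 _].
    apply: le_integrable (sum_integrable a0) => //.
      by apply/measurable_EFinP; apply: measurableT_comp => //; exact: msum.
    move=> r _ /=; rewrite [leRHS]gee0_abs// ger0_norm ?fine_ge0//.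
    exact: fine_le_id.
  - apply: filterS nb_ae => r nbr Br a ain.
    have [LPr _] := Br; have [N rN] := nb_series_finite LPr (nbr Br).
    rewrite (_ : f^~ r = fun a => \sum_(i < N) exp_at a (r i)); last first.
      apply/funext => b; rewrite /f (nneseries_split 0 N); last first.
        by move=> i _; rewrite lee_fin exp_at_ge0.
      rewrite add0n eseries0; last by move=> i Ni _; rewrite rN.
      by rewrite adde0 sumEFin big_mkord.
    exact: continuous_exp_at_sum.
  - apply: le_integrable nb_integrable => //.
      apply/measurable_EFinP; apply: measurableT_comp => //.
      by apply: measurable_funTS; exact: measurable_nb_series.
    have nb0 r : (0 <= nb_series r)%E by apply: nneseries_ge0 => i _ _; rewrite lee_fin.
    move=> r _ /=; rewrite [leRHS]gee0_abs// ger0_norm ?fine_ge0//.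
    exact: fine_le_id.
  - move=> a /=; rewrite in_itv/= => /andP[/ltW a0 _].
    apply: filterS nb_ae => r /[swap] Br /(_ Br) nbr.
    have [LPr _] := Br.
    rewrite ger0_norm ?fine_ge0//; apply: fine_le; rewrite ?sum_fin ?exp_at_sum_le_nb//.
    by rewrite ge0_fin_numE//; apply: nneseries_ge0 => i _ _; rewrite lee_fin.
  - by rewrite inE.
have nearE : \forall a \near p, \int[mu]_(r in BP) f a r = mean_offspring a.
  near=> a; apply: fE; apply: ltW.
  by near: a; exact: lt_nbhsr.
have Ep : \int[mu]_(r in BP) f p r = mean_offspring p := nbhs_singleton nearE.
suff : mean_offspring a @[a --> p] --> mean_offspring p by [].
rewrite -Ep.
by apply: cvg_trans; first exact: (near_eq_cvg nearE).
Unshelve. all: end_near. Qed.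

End finite_births.

(** * The cumulant in logarithmic coordinates *)

Section log_cumulant.
Context {R : realType}.
Implicit Types (r : seqspace (\bar R)) (mu : {measure set (seqspace (\bar R)) -> \bar R}).

Local Notation LP := (@log_partitions R).
Local Notation LP1 := (@log_partitions1 R).
Local Notation BP := (@branching_partitions R).

Definition offspring_tail (p : R) r : \bar R := (\sum_(1 <= i <oo) (exp_at p (r i))%:E)%E.

Lemma offspring_tail_ge0 p r : (0 <= offspring_tail p r)%E.
Proof. by apply: nneseries_ge0 => i _ _; rewrite lee_fin exp_at_ge0. Qed.

Lemma offspring_split p r :
  (\sum_(i <oo) (exp_at p (r i))%:E = (exp_at p (r 0%N))%:E + offspring_tail p r)%E.
Proof.
rewrite (nneseries_split 0 1); last by move=> i _; rewrite lee_fin exp_at_ge0.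
by rewrite big_nat1.
Qed.

Lemma measurable_offspring_tail p :
  measurable_fun [set: seqspace (\bar R)] (offspring_tail p).
Proof.
rewrite (_ : offspring_tail p = (fun r : seqspace (\bar R) =>
    (\sum_(i <oo) (exp_at p (r i))%:E - (exp_at p (r 0%N))%:E)%E)).
  apply: emeasurable_funB.
    exact: (@measurable_exp_at_sum _ _ _ (fun=> p) id).
  apply/measurable_EFinP; apply: measurable_exp_at => //.
  exact: measurable_coord.
by apply/funext => r; rewrite offspring_split addeAC subee// add0e.
Qed.

Lemma measurable_compensated p :
  measurable_fun [set: seqspace (\bar R)] (fun r => compensated p (r 0%N)).
Proof.
have me a : measurable_fun [set: seqspace (\bar R)] (fun r => exp_at a (r 0%N)).
  by apply: measurable_exp_at => //; exact: measurable_coord.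
apply: measurable_funD; first exact: measurable_funB.
by apply: measurable_funM => //; exact: measurable_funB.
Qed.

Lemma compensated_integrable mu p : 0 <= p ->
  (\int[mu]_(r in LP) ((1 - exp_at 1 (r 0%N)) ^+ 2)%:E < +oo)%E ->
  mu.-integrable LP (EFin \o (fun r => compensated p (r 0%N))).
Proof.
move=> p0 sq_int; have mLP := @measurable_log_partitions R.
have sqi : mu.-integrable LP (fun r => ((1 - exp_at 1 (r 0%N)) ^+ 2)%:E).
  apply/integrableP; split.
    apply/measurable_EFinP; apply: measurable_funTS; apply: measurable_funX.
    apply: measurable_funB => //; apply: measurable_exp_at => //.
    exact: measurable_coord.
  by under eq_integral do rewrite gee0_abs ?lee_fin ?sqr_ge0//.
have := integrableZl mLP (4 * (1 + p) ^+ 2) sqi.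
apply: le_integrable => //.
  by apply/measurable_EFinP/measurable_funTS; exact: measurable_compensated.
move=> r [_ r0 _] /=; rewrite lee_fin.
apply: (le_trans (compensated_bound p0 r0)).
by rewrite -[leLHS]/(_ * _) ler_norm.
Qed.

Definition log_cumulant (sigma c : R) mu (p : R) : \bar R :=
  ((2^-1 * sigma ^+ 2 * p ^+ 2 + c * p)%:E +
   (\int[mu]_(r in LP) (compensated p (r 0%N))%:E +
    \int[mu]_(r in LP) offspring_tail p r))%E.

Lemma offspring_tail1 p r : LP1 r -> offspring_tail p r = 0%E.
Proof.
rewrite log_partitions1E => -[[rm r0 _] /= nb1].
have mono i j : (i <= j)%N -> (r j <= r i)%E.
  elim: j => [|j IH]; first by rewrite leqn0 => /eqP ->.
  by rewrite leq_eqVlt => /predU1P[->//|/IH]; exact: le_trans.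
have r1 : r 1%N = -oo%E.
  apply/eqP; rewrite -leeNy_eq leNgt; apply/negP => r1.
  have : (2%:R%:E <= nb_series r)%E.
    apply: le_trans (nneseries_lim_ge 2 _) => //.
    rewrite big_nat_recr//= big_nat1 r1 (lt_le_trans r1 (mono 0 1 _))%N//.
  by rewrite nb1 lee_fin; lra.
apply: eseries0 => i i1 _.
by have /eqP -> : r i == -oo%E by rewrite -leeNy_eq -r1 mono.
Qed.

(** On [log_partitions1] the tail vanishes and the integral of [psi] remains. On
    [branching_partitions] the integrand is [p * (1 - exp_at 1 (r 0))], minus 1, plus the full sum
    of the [exp_at p (r i)]: these give the extra drift of [psi], the branching rate and the mean
    offspring. *)
Lemma log_cumulant_finite (sigma c : R) mu p : finite_birth_measure mu -> 0 <= p ->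
  log_cumulant sigma c mu p =
  (psi sigma c mu p - fine (branching_rate mu) + mean_offspring mu p)%:E.
Proof.
move=> fb p0; have [_ _ _ sq_int _] := fb.
have mLP := @measurable_log_partitions R.
have mLP1 := @measurable_log_partitions1 R.
have mBP := @measurable_branching_partitions R.
have BLP : BP `<=` LP by exact: subDsetl.
have L1LP : LP1 `<=` LP by exact: subIsetl.
rewrite /log_cumulant.
have LPE : LP1 `|` BP = LP by exact: setDUK.
have disj : [disjoint LP1 & BP].
  by apply/eqP/seteqP; split => // r [r1 [_]].
have comp_int := compensated_integrable p0 sq_int.
have mcomp D : measurable_fun D (fun r : seqspace (\bar R) => (compensated p (r 0%N))%:E).
  by apply/measurable_EFinP/measurable_funTS; exact: measurable_compensated.
have mtail D : measurable_fun D (offspring_tail p).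
  by apply: measurable_funTS; exact: measurable_offspring_tail.
have -> : (\int[mu]_(r in LP) (compensated p (r 0%N))%:E =
    \int[mu]_(r in LP1) (compensated p (r 0%N))%:E +
    \int[mu]_(r in BP) (compensated p (r 0%N))%:E)%E.
  by rewrite -[in LHS]LPE integral_setU.
have -> : (\int[mu]_(r in LP) offspring_tail p r =
    \int[mu]_(r in BP) offspring_tail p r)%E.
  rewrite -[in LHS]LPE integral_setU// integral0_eq ?add0e// => r.
  exact: offspring_tail1.
have rate_fin := branching_rate_fin fb.
have rate_int : mu.-integrable BP (EFin \o cst (1 : R)).
  apply/integrableP; split; first by apply/measurable_EFinP; exact: measurable_cst.
  under eq_integral do rewrite /= normr1.
  by rewrite (integral_cst mu mBP 1) mul1e ltey_eq rate_fin.
have e_int : mu.-integrable BP (fun r => (1 - exp_at 1 (r 0%N))%:E).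
  apply: le_integrable rate_int => //.
    apply/measurable_EFinP/measurable_funTS; apply: measurable_funB => //.
    by apply: measurable_exp_at => //; exact: measurable_coord.
  move=> r [[_ r0 _] _] /=; rewrite normr1 lee_fin ler_norml.
  have := exp_at_ge0 1 (r 0%N); have := exp_at_le1 (@ler01 R) r0; lra.
have lin_int : mu.-integrable BP (fun r => (p * (1 - exp_at 1 (r 0%N)) - 1)%:E).
  rewrite (_ : (fun _ => _) = (fun r => p%:E * (1 - exp_at 1 (r 0%N))%:E - (EFin \o cst 1%R) r)%E).
    by apply: integrableB => //; exact: integrableZl.
  by apply/funext => r; rewrite -EFinM -EFinB.
have BPE : (\int[mu]_(r in BP) (compensated p (r 0%N))%:E +
    \int[mu]_(r in BP) offspring_tail p r =
    p%:E * \int[mu]_(r in BP) (1 - exp_at 1 (r 0%N))%:E - branching_rate mu +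
    (mean_offspring mu p)%:E)%E.
  rewrite -integralD_integrable_ge0//; last 2 first.
  - exact: (integrableS mLP).
  - by move=> r _; exact: offspring_tail_ge0.
  rewrite -mean_offspringE//.
  transitivity (\int[mu]_(r in BP) ((p * (1 - exp_at 1 (r 0%N)) - 1)%:E +
      \sum_(i <oo) (exp_at p (r i))%:E))%E.
    apply: eq_integral => r _; rewrite offspring_split addeA; congr (_ + _)%E.
    by rewrite -EFinD /compensated; congr EFin; ring.
  rewrite integralD_integrable_ge0//; last 2 first.
  - by apply: measurable_funTS; exact: (@measurable_exp_at_sum _ _ _ (fun=> p) id).
  - by move=> r _; apply: nneseries_ge0 => i _ _; rewrite lee_fin exp_at_ge0.
  congr (_ + _)%E.
  transitivity (\int[mu]_(r in BP) (p%:E * (1 - exp_at 1 (r 0%N))%:E - (EFin \o cst 1%R) r))%E.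
    by apply: eq_integral => r _; rewrite /= -EFinM -EFinB.
  rewrite integralB//; last exact: integrableZl.
  rewrite integralZl//; congr (_ - _)%E.
  by rewrite (integral_cst mu mBP 1) mul1e.
have c1_fin : (\int[mu]_(r in LP1) (compensated p (r 0%N))%:E)%E \is a fin_num.
  by apply: integrable_fin_num => //; exact: (integrableS mLP).
have e_fin : (\int[mu]_(r in BP) (1 - exp_at 1 (r 0%N))%:E)%E \is a fin_num.
  exact: integrable_fin_num.
have psiE : psi sigma c mu p = 2^-1 * sigma ^+ 2 * p ^+ 2 +
    (c + fine (\int[mu]_(r in BP) (1 - exp_at 1 (r 0%N))%:E)%E) * p +
    fine (\int[mu]_(r in LP1) (compensated p (r 0%N))%:E)%E by [].
rewrite -addeA BPE psiE -(fineK c1_fin) -(fineK e_fin) -(fineK rate_fin).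
by rewrite -EFinM -EFinB -!EFinD /=; congr EFin; ring.
Qed.

End log_cumulant.

(** * Truncation *)

Section transfer.
Context d1 d2 (T1 : measurableType d1) (T2 : measurableType d2) (R : realType).

Definition pushforward_measure (m : {measure set T1 -> \bar R}) (phi : T1 -> T2)
    (mphi : measurable_fun setT phi) : {measure set T2 -> \bar R} :=
  measure_function_pushforward__canonical__measure_function_Measure m mphi.

Lemma integral_pushforward_measurable (m : {measure set T1 -> \bar R})
    (phi : T1 -> T2) (D : set T2) (f : T2 -> \bar R) :
  measurable_fun setT phi -> measurable D -> measurable_fun setT f ->
  (\int[pushforward m phi]_(y in D) f y = \int[m]_(x in phi @^-1` D) f (phi x))%E.
Proof.
move=> mphi mD mf.
rewrite [LHS]integralE (integralE m (phi @^-1` D) (f \o phi)).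
have mp : measurable_fun D (f ^\+)%E by apply: measurable_funTS; exact: measurable_funepos.
have mn : measurable_fun D (f ^\-)%E by apply: measurable_funTS; exact: measurable_funeneg.
congr (_ - _)%E.
  rewrite (funepos_comp f phi).
  by apply: (ge0_integral_pushforward mphi m mD mp) => y _; exact: funepos_ge0.
rewrite (funeneg_comp f phi).
by apply: (ge0_integral_pushforward mphi m mD mn) => y _; exact: funeneg_ge0.
Qed.

Lemma integral_conull (m : {measure set T1 -> \bar R}) (A B : set T1)
    (f : T1 -> \bar R) : measurable A -> measurable B -> A `<=` B ->
  m (~` A) = 0%E -> measurable_fun B f ->
  (\int[m]_(x in B) f x = \int[m]_(x in A) f x)%E.
Proof.
move=> mA mB AB mA0 mf; have mBA : measurable (B `\` A) by exact: measurableD.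
rewrite -[in LHS](setDUK AB) integral_setU ?setDUK//; last first.
  by apply/disj_setPS => x [Ax [_ /(_ Ax)]].
have mf' : measurable_fun (B `\` A) f.
  by apply: (measurable_funS mB) mf; exact: subDsetl.
have mBA0 : m (B `\` A) = 0%E.
  by apply: (subset_measure0 mBA (measurableC mA) _ mA0); exact: subDsetr.
by rewrite (null_set_integral mBA mf' mBA0) adde0.
Qed.

Lemma integral_pushforward_conull (m : {measure set T1 -> \bar R})
    (phi : T1 -> T2) (A : set T1) (D : set T2) (f : T2 -> \bar R) :
  measurable_fun setT phi -> measurable A -> measurable D -> A `<=` phi @^-1` D ->
  m (~` A) = 0%E -> measurable_fun setT f ->
  (\int[pushforward m phi]_(y in D) f y = \int[m]_(x in A) f (phi x))%E.
Proof.
move=> mphi mA mD AD mA0 mf.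
rewrite integral_pushforward_measurable//; apply: integral_conull => //.
  by rewrite -[X in measurable X]setTI; exact: mphi.
by apply: measurable_funTS; exact: measurableT_comp.
Qed.

Lemma pushforward_conull (m : {measure set T1 -> \bar R})
    (phi : T1 -> T2) (A : set T1) (D : set T2) :
  measurable_fun setT phi -> measurable A -> measurable D -> A `<=` phi @^-1` D ->
  m (~` A) = 0%E -> pushforward m phi (~` D) = 0%E.
Proof.
move=> mphi mA mD AD mA0; rewrite /pushforward.
apply: (subset_measure0 _ (measurableC mA) _ mA0).
  by rewrite -[X in measurable X]setTI; apply: mphi => //; exact: measurableC.
by rewrite preimage_setC; exact: subsetC.
Qed.

End transfer.

Section maps.
Context {R : realType}.
Local Notation LP := (@log_partitions R).
Local Notation MP := (@mass_partitions R).

Lemma measurable_log_seq : measurable_fun setT (@log_seq R).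
Proof.
apply: measurable_seqspace => i; rewrite /log_seq.
rewrite (_ : (fun _ => _) = (fun s : seqspace R =>
    if s i <= 0 then -oo%E else (ln (s i))%:E)) //.
apply: measurable_fun_ifT => //.
  by apply: measurable_fun_ler => //; exact: measurable_coord.
apply/measurable_EFinP; apply: measurableT_comp; first exact: measurable_ln.
exact: measurable_coord.
Qed.

Lemma measurable_truncate_seq (l : R) : measurable_fun setT (truncate_seq l).
Proof.
apply: measurable_seqspace => i; rewrite /truncate_seq.
apply: measurable_fun_ifT => //; last exact: measurable_coord.
apply: measurable_or => //; apply: measurable_fun_lte => //; exact: measurable_coord.
Qed.

Lemma exp_at_log_seq p (s : seqspace R) i : 0 <= s i ->
  exp_at p (log_seq s i) = pow0 (s i) p.
Proof.
rewrite /log_seq /pow0 /= le_eqVlt => /predU1P[<-|s0]; first by rewrite lexx eqxx.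
by rewrite leNgt s0 /= gt_eqF// /powR gt_eqF.
Qed.

Lemma log_seq_partition s : MP s -> LP (log_seq s).
Proof.
move=> [sm s0 s1]; split.
- move=> i; rewrite /log_seq /=; case: ifPn => [_|]; first exact: leNye.
  rewrite -ltNge => si; have si' := lt_le_trans si (sm i).
  by rewrite [s i <= 0]leNgt si' /= lee_fin ler_ln.
- rewrite /log_seq /=; case: ifPn => [_|]; first exact: leNye.
  rewrite -ltNge => si; rewrite lee_fin ln_le0// -lee_fin (le_trans _ s1)//.
  rewrite (le_trans _ (@nneseries_lim_ge R (fun i => (s i)%:E) xpredT 0 1 _))//.
    by rewrite big_nat1.
  by move=> i _ _; rewrite lee_fin.
- rewrite (eq_eseriesr (g := fun i => (s i)%:E))// => i _.
  by rewrite exp_at_log_seq// /pow0; case: eqVneq => [->//|_]; rewrite powRr1.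
Qed.

Lemma truncate_seq_partition l r : LP r -> LP (truncate_seq l r).
Proof.
move=> [rm r0 r1]; split => //.
- move=> i; rewrite /truncate_seq /=; case: ifPn => [ri|_]; last exact: leNye.
  by rewrite (lt_le_trans ri (rm i)) orbT.
- apply: le_trans r1; apply: lee_nneseries => [i _|i _]; first by rewrite lee_fin exp_at_ge0.
  by rewrite lee_fin /truncate_seq; case: ifP => // _; exact: exp_at_ge0.
Qed.

Lemma measurable_mass_partitions : measurable MP.
Proof.
(* Absolute values make the terms of the series nonnegative on all sequences, as measurability of
   its sum requires, and change nothing once the coordinates are nonnegative. *)
rewrite (_ : MP = (\bigcap_i [set s : seqspace R | s i.+1 <= s i])
   `&` ((\bigcap_i [set s : seqspace R | 0 <= s i]) `&`
   [set s : seqspace R | \sum_(i <oo) (`|s i|)%:E <= 1]%E)).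
  have mc i := @measurable_coord _ R i.
  have m0 : measurable_fun setT (fun _ : seqspace R => 0 : R) by [].
  apply: measurableI; last apply: measurableI.
  - apply: bigcapT_measurable => i; rewrite -[X in measurable X]setTI.
    by apply: (measurable_fun_ler (mc i.+1) (mc i)) => //; exact: (measurable_set1 true).
  - apply: bigcapT_measurable => i; rewrite -[X in measurable X]setTI.
    by apply: (measurable_fun_ler m0 (mc i)) => //; exact: (measurable_set1 true).
  - rewrite -[X in measurable X]setTI.
    apply: measurable_lee => //.
    apply: ge0_emeasurable_sum => i; first by move=> x _ _; rewrite lee_fin.
    by move=> _; apply/measurable_EFinP; apply: measurableT_comp.
apply/seteqP; split => s.
- move=> [sm s0 s1]; split => [i _|]; first exact: sm.
  split => [i _|/=]; first exact: s0.
  by under eq_eseriesr do rewrite ger0_norm//.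
- move=> [sm [s0 /= s1]]; split => [i|i|]; [exact: sm|exact: s0|].
  by move: s1; under eq_eseriesr do rewrite ger0_norm ?s0//.
Qed.

End maps.

Section truncation.
Context {R : realType}.
Variables (sigma c : R) (nu : {measure set (seqspace R) -> \bar R}).
Hypothesis nu_support : nu (~` mass_partitions) = 0%E.
Hypothesis nu_integrable :
  (\int[nu]_(s in mass_partitions) ((1 - s 0%N) ^+ 2)%:E < +oo)%E.
Local Notation LP := (@log_partitions R).

Definition log_measure : {measure set (seqspace (\bar R)) -> \bar R} :=
  pushforward_measure nu (@measurable_log_seq R).

Definition truncated_measure (l : R) : {measure set (seqspace (\bar R)) -> \bar R} :=
  pushforward_measure log_measure (measurable_truncate_seq l).

Lemma integral_log_measure (f : seqspace (\bar R) -> \bar R) : measurable_fun setT f ->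
  (\int[log_measure]_(r in LP) f r = \int[nu]_(s in mass_partitions) f (log_seq s))%E.
Proof.
apply: integral_pushforward_conull => //.
- exact: measurable_log_seq.
- exact: measurable_mass_partitions.
- exact: measurable_log_partitions.
- exact: log_seq_partition.
Qed.

Lemma log_measure_conull : log_measure (~` LP) = 0%E.
Proof.
apply: (pushforward_conull _ measurable_mass_partitions) => //.
- exact: measurable_log_seq.
- exact: measurable_log_partitions.
- exact: log_seq_partition.
Qed.

Lemma integral_truncated_measure l (f : seqspace (\bar R) -> \bar R) :
  measurable_fun setT f ->
  (\int[truncated_measure l]_(r in LP) f r = \int[log_measure]_(r in LP) f (truncate_seq l r))%E.
Proof.
have mLP := @measurable_log_partitions R.
apply: integral_pushforward_conull => //.
- exact: measurable_truncate_seq.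
- exact: truncate_seq_partition.
- exact: log_measure_conull.
Qed.

Lemma log_measure_sq_integrable :
  (\int[log_measure]_(r in LP) ((1 - exp_at 1 (r 0%N)) ^+ 2)%:E < +oo)%E.
Proof.
rewrite integral_log_measure; last first.
  apply/measurable_EFinP; apply: measurable_funX.
  apply: measurable_funB => //; apply: measurable_exp_at => //.
  exact: measurable_coord.
rewrite (eq_integral (fun s : seqspace R => ((1 - s 0%N) ^+ 2)%:E))// => s /[!inE] -[_ s0 _].
by rewrite exp_at_log_seq// /pow0; case: eqVneq => [->//|_]; rewrite powRr1.
Qed.

Lemma cumulant_log p : 0 <= p -> cumulant sigma c nu p = log_cumulant sigma c log_measure p.
Proof.
move=> p0; rewrite /cumulant /log_cumulant; congr (_ + _)%E.
rewrite -integralD_integrable_ge0; last first.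
- by move=> r _; exact: offspring_tail_ge0.
- by apply: measurable_funTS; exact: measurable_offspring_tail.
- exact: compensated_integrable p0 log_measure_sq_integrable.
- exact: measurable_log_partitions.
rewrite integral_log_measure; last first.
  apply: emeasurable_funD; last exact: measurable_offspring_tail.
  by apply/measurable_EFinP; exact: measurable_compensated.
apply: eq_integral => s /[!inE] -[_ s0 _].
have -> : (\sum_(i <oo) (pow0 (s i) p)%:E = \sum_(i <oo) (exp_at p (log_seq s i))%:E)%E.
  by apply: eq_eseriesr => i _; rewrite exp_at_log_seq.
rewrite offspring_split /compensated.
have -> : s 0%N = exp_at 1 (log_seq s 0).
  by rewrite exp_at_log_seq// /pow0; case: eqVneq => [->//|_]; rewrite powRr1.
case: (offspring_tail _ _) => [x| |] //=; rewrite -!EFinD; congr EFin; ring.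
Qed.

(** Truncation never alters the first coordinate, so only the tail depends on [l]. *)
Lemma log_cumulant_truncated l p :
  log_cumulant sigma c (truncated_measure l) p =
  ((2^-1 * sigma ^+ 2 * p ^+ 2 + c * p)%:E +
   (\int[log_measure]_(r in LP) (compensated p (r 0%N))%:E +
    \int[log_measure]_(r in LP) offspring_tail p (truncate_seq l r)))%E.
Proof.
rewrite /log_cumulant; congr (_ + (_ + _))%E; rewrite integral_truncated_measure//.
  by apply/measurable_EFinP; exact: measurable_compensated.
exact: measurable_offspring_tail.
Qed.

Lemma exp_at_truncate_le p (l l' : R) r i : l <= l' ->
  exp_at p (truncate_seq l r i) <= exp_at p (truncate_seq l' r i).
Proof.
move=> ll'; rewrite /truncate_seq; case: ifPn => [/orP[/eqP->//|h]|_].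
  by rewrite (le_lt_trans _ h) ?orbT// lee_fin lerN2.
by case: ifP => // _; exact: exp_at_ge0.
Qed.

Lemma offspring_tail_truncate_le p (l l' : R) r : l <= l' ->
  (offspring_tail p (truncate_seq l r) <= offspring_tail p (truncate_seq l' r))%E.
Proof.
move=> ll'; apply: lee_nneseries => [i _|i _]; first by rewrite lee_fin exp_at_ge0.
by rewrite lee_fin exp_at_truncate_le.
Qed.

(** The tails increase with the level, and each partial sum of the limit is attained: finitely many
    coordinates above [-oo] all exceed some [- n]. *)
Lemma offspring_tail_truncate_cvg (p : R) r :
  offspring_tail p (truncate_seq (n%:R : R) r) @[n --> \oo] --> offspring_tail p r.
Proof.
have nd : nondecreasing_seq (fun n : nat => offspring_tail p (truncate_seq n%:R r)).
  by move=> n m nm; apply: offspring_tail_truncate_le; rewrite ler_nat.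
have := ereal_nondecreasing_cvgn nd.
set S := ereal_sup _; suff -> : S = offspring_tail p r by [].
apply/eqP; rewrite eq_le; apply/andP; split.
  apply: ge_ereal_sup => _ [n _ <-]; apply: lee_nneseries => [i _|i _].
    by rewrite lee_fin exp_at_ge0.
  by rewrite lee_fin /truncate_seq; case: ifP => // _; exact: exp_at_ge0.
apply: lime_le.
  by apply: is_cvg_nneseries => i _ _; rewrite lee_fin exp_at_ge0.
apply: nearW => N.
have [n rn] : exists n : nat, forall i, (i < N)%N -> r i != -oo%E -> ((- n%:R)%:E < r i)%E.
  elim: N => [|N [n rn]]; first by exists 0%N.
  have [m rm] : exists m : nat, r N != -oo%E -> ((- m%:R)%:E < r N)%E.
    case: (r N) => [x| |]; [|by exists 0%N; rewrite ltry|by exists 0%N].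
    exists (Num.truncn `|x|).+1 => _; rewrite lte_fin ltrNl.
    by rewrite (le_lt_trans (ler_norm _))// normrN truncnS_gt.
  exists (maxn n m) => i; rewrite ltnS leq_eqVlt => /predU1P[->|iN] ri.
    by apply: le_lt_trans (rm ri); rewrite lee_fin lerN2 ler_nat leq_maxr.
  by apply: le_lt_trans (rn i iN ri); rewrite lee_fin lerN2 ler_nat leq_maxl.
apply: (@le_trans _ _ (offspring_tail p (truncate_seq n%:R r))); last first.
  by apply: ereal_sup_ubound; exists n.
pose a i := (exp_at p (truncate_seq n%:R r i))%:E.
apply: le_trans (@nneseries_lim_ge _ a xpredT 1 N _); last first.
  by move=> i _ _; rewrite lee_fin exp_at_ge0.
rewrite big_nat [leRHS]big_nat; apply: lee_sum => i /andP[_ iN]; rewrite lee_fin.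
rewrite /truncate_seq; have [ri|ri] := eqVneq (r i) -oo%E.
  by rewrite ri /=; exact: exp_at_ge0.
by rewrite rn// orbT.
Qed.

Lemma log_cumulant_truncated_le p (l l' : R) : 0 <= p -> l <= l' ->
  (log_cumulant sigma c (truncated_measure l) p <= log_cumulant sigma c (truncated_measure l') p)%E.
Proof.
move=> p0 ll'; rewrite !log_cumulant_truncated; apply: leeD2l; apply: leeD2l.
have mt a : measurable_fun LP (fun r => offspring_tail p (truncate_seq a r)).
  apply: measurable_funTS; apply: measurableT_comp; first exact: measurable_offspring_tail.
  exact: measurable_truncate_seq.
apply: ge0_le_integral => //.
- exact: measurable_log_partitions.
- by move=> r _; exact: offspring_tail_ge0.
- by move=> r _; exact: offspring_tail_truncate_le.
Qed.

Lemma log_cumulant_truncated_cvg p : 0 <= p ->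
  log_cumulant sigma c (truncated_measure n%:R) p @[n --> \oo] --> cumulant sigma c nu p.
Proof.
move=> p0; rewrite cumulant_log//.
under eq_fun do rewrite log_cumulant_truncated.
have mLP := @measurable_log_partitions R.
have ci := compensated_integrable p0 log_measure_sq_integrable.
have cfin := integrable_fin_num mLP ci.
apply: cvgeD; first by rewrite fin_num_adde_defr.
  exact: cvg_cst.
apply: cvgeD; first by rewrite fin_num_adde_defr.
  exact: cvg_cst.
have mt a : measurable_fun LP (fun r => offspring_tail p (truncate_seq a r)).
  apply: measurable_funTS; apply: measurableT_comp; first exact: measurable_offspring_tail.
  exact: measurable_truncate_seq.
rewrite [X in _ --> X](_ : _ =
  \int[log_measure]_(r in LP) limn (fun n => offspring_tail p (truncate_seq n%:R r)))%E.
  apply: cvg_monotone_convergence => //.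
  - by move=> n r _; exact: offspring_tail_ge0.
  - by move=> r _ n m nm; apply: offspring_tail_truncate_le; rewrite ler_nat.
by apply: eq_integral => r _; apply/esym/cvg_lim => //; exact: offspring_tail_truncate_cvg.
Qed.

End truncation.

Section integral_cvg.
Context d (T : measurableType d) (R : realType) (mu : {measure set T -> \bar R}).

(** Monotone convergence applies to the nonnegative differences with the integrable [k 0]; the limit
    may have an infinite integral. *)
Lemma cvg_integral_nondecreasing (D : set T) (k : nat -> T -> R) (kap : T -> \bar R) :
  measurable D -> (forall n, mu.-integrable D (EFin \o k n)) ->
  (forall x, D x -> nondecreasing_seq (k ^~ x)) ->
  (forall x, D x -> (k n x)%:E @[n --> \oo] --> kap x) ->
  (\int[mu]_(x in D) (k n x)%:E @[n --> \oo] --> \int[mu]_(x in D) kap x)%E.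
Proof.
move=> mD ik nd ck.
pose g n x := (k n x - k 0%N x)%:E.
have g0 n x : D x -> (0 <= g n x)%E by move=> Dx; rewrite lee_fin subr_ge0 nd.
have mk n : measurable_fun D (k n).
  by apply/measurable_EFinP; have /integrableP[] := ik n.
have mg n : measurable_fun D (g n) by apply/measurable_EFinP; exact: measurable_funB.
have cg x : D x -> g n x @[n --> \oo] --> limn (g ^~ x).
  move=> Dx; apply/ereal_nondecreasing_is_cvgn => n m nm.
  by rewrite lee_fin lerB// nd.
have kE n : (\int[mu]_(x in D) (k n x)%:E =
    \int[mu]_(x in D) (k 0%N x)%:E + \int[mu]_(x in D) g n x)%E.
  rewrite -integralD_integrable_ge0//; [|exact: g0].
  by apply: eq_integral => x _; rewrite /g -EFinD addrC subrK.
have kapE : (\int[mu]_(x in D) kap x =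
    \int[mu]_(x in D) (k 0%N x)%:E + \int[mu]_(x in D) limn (g ^~ x))%E.
  rewrite -integralD_integrable_ge0//.
  - apply: eq_integral => x /[!inE] Dx.
    apply: (cvg_unique (@ereal_hausdorff R) (ck x Dx)).
    rewrite (_ : (fun n => (k n x)%:E) = (fun n => (k 0%N x)%:E + g n x)%E); last first.
      by apply/funext => n; rewrite /g -EFinD addrC subrK.
    by apply: cvgeD; [exact: fin_num_adde_defr|exact: cvg_cst|exact: cg].
  - by apply: (emeasurable_fun_cvg g) => // x Dx; exact: cg.
  - by move=> x Dx; apply: lime_ge; [exact: cg|apply: nearW => n; exact: g0].
under eq_fun do rewrite kE.
rewrite kapE; apply: cvgeD; [|exact: cvg_cst|].
  exact: fin_num_adde_defr (integrable_fin_num mD (ik 0%N)).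
apply: cvg_monotone_convergence => // x Dx n m nm.
by rewrite lee_fin lerB// nd.
Qed.

End integral_cvg.

(** * Primitives of the discounted exponents *)

Section primitive.
Context {R : realType}.
Implicit Types f h : R -> R.

Lemma continuous_primitive f (t : R) : continuous f ->
  exists F, forall s, 0 <= s <= t -> is_derive s 1 F (f s).
Proof.
(* The base point -1, and [t + 1] as right end below, put [[0, t]] inside an open interval, so that
   the derivatives are two-sided at 0 and [t] too. *)
move=> cf; pose F x := (\int[lebesgue_measure]_(y in [set` `[-1, x]]) (f y))%R.
exists F => s /andP[s0 st].
have fi : lebesgue_measure.-integrable `[-1, t + 1] (EFin \o f).
  apply: continuous_compact_integrable; first exact: segment_compact.
  by apply: continuous_subspaceT.
have [dF FE] := @continuous_FTC1_closed _ f (-1) s (t + 1) ltac:(lra) fi ltac:(lra) (cf s).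
by apply: DeriveDef; [exact: dF|rewrite -derive1E; exact: FE].
Qed.

(** For [q = 0] the function is constant; for [q > 0] the argument of [h] stays positive. Continuity
    of [h] at 0 never enters. *)
Lemma continuous_scaled_exp h (g : R -> R) (q : R) : 0 <= q ->
  (forall p, 0 < p -> {for p, continuous h}) -> continuous g ->
  continuous (fun s => h (q * expR (g s))).
Proof.
rewrite le_eqVlt => /predU1P[<- _ _ s|q0 ch cg s].
  by under eq_fun do rewrite mul0r; exact: cvg_cst.
apply: (@continuous_comp _ _ _ (fun s => q * expR (g s)) h).
  apply: cvgM; first exact: cvg_cst.
  by apply: continuous_comp; [exact: cg|exact: continuous_expR].
by apply: ch; rewrite mulr_gt0// expR_gt0.
Qed.

Lemma continuous_affine (a b : R) : continuous (fun s : R => a * (b - s)).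
Proof.
move=> s; apply: cvgM; first exact: cvg_cst.
by apply: cvgB; [exact: cvg_cst|exact: cvg_id].
Qed.

End primitive.

Section mean_alive_cumulant.
Context d (Omega : measurableType d) (R : realType) (P : probability Omega R).
Variables (sigma c theta : R) (mu : {measure set (seqspace (\bar R)) -> \bar R}).
Variable F : branching_family Omega R.
Hypothesis HF : OU_branching_family P sigma c mu theta F.

Definition finite_cumulant (p : R) : R :=
  psi sigma c mu p - fine (branching_rate mu) + mean_offspring mu p.

(** Read off the Levy process that drives the motion of the root, instead of the integral formula
    for [psi]. *)
Lemma psi_continuous (p : R) : 0 < p -> {for p, continuous (psi sigma c mu)}.
Proof.
move=> p0; have [_ [_ [_ [/(_ [::]) [_ [xi Lxi _]] _]]]] := HF.
exact: levy_exponent_continuous Lxi p0.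
Qed.

Lemma finite_cumulant_continuous (p : R) : 0 < p -> {for p, continuous finite_cumulant}.
Proof.
have [fb _] := HF; move=> p0.
suff : finite_cumulant a @[a --> p] --> finite_cumulant p by [].
apply: cvgD; last exact: mean_offspring_continuous fb _ p0.
by apply: cvgB; [exact: psi_continuous|exact: cvg_cst].
Qed.

Lemma continuous_finite_cumulant (q : R) : 0 <= q ->
  continuous (fun s => finite_cumulant (q * expR (- theta * s))).
Proof.
move=> q0; apply: continuous_scaled_exp q0 finite_cumulant_continuous _ => s.
by apply: cvgM; [exact: cvg_cst|exact: cvg_id].
Qed.

Lemma integrable_finite_cumulant (t q : R) : 0 <= q ->
  lebesgue_measure.-integrable `[0, t]
    (EFin \o (fun s => finite_cumulant (q * expR (- theta * s)))).
Proof.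
move=> q0; apply: continuous_compact_integrable; first exact: segment_compact.
apply: continuous_subspaceT.
exact: continuous_finite_cumulant.
Qed.

Lemma mean_alive_cumulant (t q : R) : 0 <= t -> 0 <= q ->
  (\int[P]_w (\esum_(u in [set: seq nat]) (alive_weight theta F t q u w)%:E) =
   expeR (\int[lebesgue_measure]_(s in `[0%R, t])
     log_cumulant sigma c mu (q * expR (- theta * s))))%E.
Proof.
move=> t0 q0; have [fb _] := HF.
pose rate := fine (branching_rate mu).
have rateE : branching_rate mu = rate%:E by rewrite fineK// branching_rate_fin.
have [K dK] := continuous_primitive t
  (continuous_scaled_exp q0 psi_continuous (@continuous_affine _ (- theta) t)).
have [L dL] := continuous_primitive t
  (continuous_scaled_exp q0 (mean_offspring_continuous fb) (@continuous_affine _ (- theta) t)).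
have cM s : 0 <= s <= t ->
    {for s, continuous (fun s => mean_offspring mu (discounted theta t q s))}.
  move=> _; exact: (continuous_scaled_exp q0
    (mean_offspring_continuous fb) (@continuous_affine _ (- theta) t)).
rewrite (mean_alive HF rateE (mean_offspringE fb) t0 q0 dK dL cM).
rewrite -[LHS]/(expeR (_%:E)); congr (expeR _).
transitivity (\int[lebesgue_measure]_(s in `[0%R, t])
    (finite_cumulant (q * expR (- theta * s)))%:E)%E; last first.
  apply: eq_integral => s _; rewrite log_cumulant_finite//.
  by rewrite mulr_ge0// expR_ge0.
(* The primitives run in the time of the process, with exponent [q * expR (- theta * (t - s))];
   reversing time gives the exponent [q * expR (- theta * s)] of the statement. *)
pose G s := - (K (t - s) - rate * (t - s) + L (t - s)).
transitivity ((G t - G 0)%:E); first by rewrite /G subrr subr0 mulr0; congr EFin; ring.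
apply/esym; apply: integral_is_derive => // s /andP[s0 st].
  have ts : 0 <= t - s <= t by apply/andP; split; lra.
  have dinner : is_derive s (1 : R) (fun y : R => t - y) (-1).
    have := is_deriveB (is_derive_cst t s (1 : R)) (is_derive_id s (1 : R)).
    by rewrite sub0r.
  have dH : is_derive (t - s) (1 : R) (fun y => K y - rate * y + L y)
      (finite_cumulant (q * expR (- theta * s))).
    have drate : is_derive (t - s) (1 : R) (fun y : R => rate * y) rate.
      have := is_deriveZ rate (is_derive_id (t - s) (1 : R)).
      by rewrite /GRing.scale /= mulr1.
    have := is_deriveD (is_deriveB (dK _ ts) drate) (dL _ ts).
    by rewrite /finite_cumulant /discounted subKr.
  have := is_deriveN (@is_derive1_comp _ _ (fun y => t - y) s _ _ dH dinner).
  by rewrite mulrN1 opprK.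
exact: continuous_finite_cumulant q0 s.
Qed.

End mean_alive_cumulant.

(** * Populations *)

Section multisets.
Context {R : realType}.
Local Open Scope ereal_scope.

Lemma esum_const (I : choiceType) (S : set I) (a : R) : (0 < a)%R ->
  \esum_(i in S) a%:E = a%:E * counting S.
Proof.
move=> a0; rewrite /counting; case: asboolP => [finS|infS].
  rewrite esum_fset//; last by move=> i _; rewrite lee_fin ltW.
  by rewrite fsbig_finite//= sumEFin big_const_seq count_predT iter_addr_0 -EFinM mulr_natr.
rewrite gt0_muley ?lte_fin//; apply/eqyP => A A0.
have [B BS cardB] := infinite_set_fset (Num.truncn (A / a)).+1 infS.
apply: esum_ge; exists [set` B]; first by split => //; exact: finite_fset.
rewrite fsbig_finite//= set_fsetK sumEFin big_const_seq count_predT iter_addr_0 lee_fin.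
rewrite -mulr_natl -ler_pdivrMr// ltW//; apply: lt_le_trans (truncnS_gt _) _.
by rewrite ler_nat.
Qed.

Lemma counting_le (I : choiceType) (S S' : set I) : S `<=` S' ->
  counting S <= counting S' :> \bar R.
Proof.
move=> SS'; rewrite /counting; case: asboolP => [finS|infS]; case: asboolP => [finS'|infS'].
- by rewrite lee_fin ler_nat; apply: fsubset_leq_card; rewrite -fset_set_sub.
- exact: leey.
- by exfalso; apply: infS; exact: sub_finite_set finS'.
- by [].
Qed.

Lemma esum_fibers (I : choiceType) (A : set I) (g : I -> R) (h : R -> R) :
  (forall z, 0 < h z)%R ->
  \esum_(i in A) (h (g i))%:E =
  \esum_(z in [set: R]) ((h z)%:E * counting [set i | A i /\ g i = z]).
Proof.
move=> h0; pose J z := [set i | A i /\ g i = z].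
transitivity (\esum_(z in [set: R]) \esum_(i in J z) (h (g i))%:E).
  rewrite esum_esum; last by move=> z i _ _; rewrite lee_fin ltW.
  apply: reindex_esum; split.
  - by move=> [z i] [_ []].
  - move=> [z i] [z' i'] /[!inE] -[/= _ [_ <-]] [/= _ [_ <-]] /= ->; by [].
  - by move=> i Ai; exists (g i, i).
apply: eq_esum => z _; rewrite -esum_const//.
by apply: eq_esum => i [_ ->].
Qed.

(** The zeros completing the sequence contribute nothing, even for [q = 0], by the convention of
    [pow0]; the positive terms are grouped by their logarithm. *)
Lemma exp_rearrangement_sum (m : R -> \bar R) (x : nat -> R) (q : R) :
  exp_rearrangement m x ->
  \sum_(i <oo) (pow0 (x i) q)%:E = \esum_(z in [set: R]) ((expR (q * z))%:E * m z).
Proof.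
move=> [_ x0 _ xm].
have p0 y : (0 <= pow0 y q)%R by rewrite /pow0; case: ifP => // _; exact: powR_ge0.
rewrite nneseries_esumT; last by move=> i; rewrite lee_fin.
transitivity (\esum_(i in [set i | (0 < x i)%R]) (expR (q * ln (x i)))%:E).
  rewrite [RHS]esum_mkcond; apply: eq_esum => i _; rewrite /pow0 /powR.
  have [xi|xi] := eqVneq (x i) 0%R.
    by rewrite ifF//; apply/negbTE; rewrite notin_setE /= xi ltxx.
  by rewrite ifT// inE /= lt_neqAle eq_sym xi x0.
rewrite (@esum_fibers _ _ (fun i => ln (x i)) (fun z => expR (q * z))); last first.
  by move=> z; exact: expR_gt0.
apply: eq_esum => z _; congr (_ * _).
rewrite -[z in m z]expRK -xm ?expR_gt0//; congr counting.
apply/seteqP; split => i /=; first by move=> [xi <-]; rewrite lnK.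
by move=> ->; rewrite expR_gt0 expRK.
Qed.

(** Monotone convergence for a sum whose index set may be uncountable, as for positions on the real
    line: the exchange is made on finite partial sums. *)
Lemma esum_cvg_sup (I : choiceType) (h : I -> R) (p : nat -> I -> \bar R) (m : I -> \bar R) :
  (forall z, 0 < h z)%R -> (forall n z, 0 <= p n z) ->
  (forall z, nondecreasing_seq (p ^~ z)) ->
  (forall z, m z = ereal_sup (range (p ^~ z))) ->
  \esum_(z in [set: I]) ((h z)%:E * p n z) @[n --> \oo] -->
  \esum_(z in [set: I]) ((h z)%:E * m z).
Proof.
move=> h0 p0 nd mE.
have cm z : (h z)%:E * p n z @[n --> \oo] --> (h z)%:E * m z.
  by apply: cvgeZl => //; rewrite mE; exact: ereal_nondecreasing_cvgn.
have ndS : nondecreasing_seq (fun n => \esum_(z in [set: I]) ((h z)%:E * p n z)).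
  move=> n n' nn'; apply: le_esum => z _; rewrite lee_pmul2l ?lte_fin//.
  exact: nd.
have := ereal_nondecreasing_cvgn ndS; set S := ereal_sup _.
suff -> : S = \esum_(z in [set: I]) ((h z)%:E * m z) by [].
apply/eqP; rewrite eq_le; apply/andP; split.
  apply: ge_ereal_sup => _ [n _ <-]; apply: le_esum => z _.
  by rewrite lee_pmul2l ?lte_fin// mE; apply: ereal_sup_ubound; exists n.
apply: ge_ereal_sup => _ [X [finX _] <-]; rewrite fsbig_finite//=.
have cX : \sum_(z <- fset_set X) (h z)%:E * p n z @[n --> \oo] -->
    \sum_(z <- fset_set X) (h z)%:E * m z.
  by apply: cvg_nnesum => z _; [apply: nearW => n; rewrite mule_ge0// lee_fin ltW|exact: cm].
apply: (cvge_to_le cX); apply: nearW => n.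
apply: (@le_trans _ _ (\esum_(z in [set: I]) ((h z)%:E * p n z))).
  by apply: esum_ge; exists X => //; rewrite fsbig_finite.
by apply: ereal_sup_ubound; exists n.
Qed.

End multisets.

(** * Identification with the original branching family *)

Section identification.
Context d (Omega : measurableType d) (R : realType) (P : probability Omega R).
Variables (sigma c theta : R) (mu : {measure set (seqspace (\bar R)) -> \bar R}).
Variable F : branching_family Omega R.
Hypothesis HF : OU_branching_family P sigma c mu theta F.

(** The almost sure event on which the modifications agree with the original variables. The
    disjunction covers rate 0: dislocations are then arbitrary, but lifetimes are infinite and no
    child is ever born. *)
Definition regular w := forall u, [/\ (0 < life F u w)%E,
  forall x, 0 <= x -> displacement F u x w = (motion F u x w)%:E &
  log_partitions (dislocation F u w) \/ lifetime F u w = +oo%E].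

Lemma ae_foralln_words (Q : seq nat -> Omega -> Prop) :
  (forall u, \forall w \ae P, Q u w) -> \forall w \ae P, forall u, Q u w.
Proof.
move=> aeQ.
pose Q' n w := if choice.unpickle n is Some u then Q u w else True.
have aeQ' n : \forall w \ae P, Q' n w.
  by rewrite /Q'; case: (choice.unpickle n) => [u|]; [exact: aeQ|apply: nearW].
apply: filterS (ae_foralln aeQ') => w Qw u.
by have := Qw (choice.pickle u); rewrite /Q' choice.pickleK.
Qed.

Lemma ae_partition_or_immortal u :
  \forall w \ae P, log_partitions (dislocation F u w) \/ lifetime F u w = +oo%E.
Proof.
have [fb [_ [/(_ u) [mlife tailE] [_ /(_ u) [mdisl dislE]]]]] := HF.
have rfin := branching_rate_fin fb.
have mLP := @measurable_log_partitions R.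
have rate0 : (0 <= branching_rate mu)%E by exact: measure_ge0.
have [r0|r0] := eqVneq (branching_rate mu) 0%E.
  have lt_life (n : nat) : \forall w \ae P, (n%:R%:E < lifetime F u w)%E.
    have mS : measurable [set w | (n%:R%:E < lifetime F u w)%E].
      by rewrite -[X in measurable X]setTI; exact: measurable_lte.
    exists (~` [set w | (n%:R%:E < lifetime F u w)%E]); split => //; first exact: measurableC.
    rewrite probability_setC//.
    have := tailE n%:R (ler0n _ _); rewrite r0 mule0 oppe0 expeR0 => E.
    by transitivity (1 - 1%:E : \bar R)%E; [congr (_ - _)%E; exact: E|rewrite subee].
  apply: filterS (ae_foralln lt_life) => w lw; right; apply/eqyP => A A0.
  by apply: le_trans (ltW (lw (Num.truncn A).+1)); rewrite lee_fin ltW// truncnS_gt.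
have mS : measurable (dislocation F u @^-1` (~` log_partitions)).
  by rewrite -[X in measurable X]setTI; apply: mdisl => //; exact: measurableC.
exists (dislocation F u @^-1` (~` log_partitions)); split => //; last first.
  by move=> w /= /not_orP[].
have := dislE _ (measurableC mLP).
rewrite [X in mu X](_ : _ = set0); last first.
  by apply/seteqP; split => // r [/= nLP [LPr _]].
rewrite measure0 => /eqP; rewrite mule_eq0 (negbTE r0) /= => /eqP; exact.
Qed.

Lemma ae_regular : \forall w \ae P, regular w.
Proof.
apply: ae_foralln_words => u.
have [fb [_ [_ [/(_ u) OUu _]]]] := HF.
have rateE := esym (fineK (branching_rate_fin fb)).
apply: filterS3 (life_gt0 HF rateE u) (OU_right_version OUu) (ae_partition_or_immortal u).
by move=> w l0 dE LPu; split.
Qed.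

Section regular.
Variable w : Omega.
Hypothesis rw : regular w.

Lemma life_lifetime u : life F u w = lifetime F u w.
Proof.
have [l0 _ _] := rw u; move: l0; rewrite /life lt_max ltxx /= => l0.
by apply/max_idPr; exact: ltW.
Qed.

Lemma birth_birth_time u : birth F u w = birth_time F w u.
Proof. by elim: u => //= i v ->; rewrite life_lifetime. Qed.

Lemma place_birth_place u : place F theta u w = birth_place theta F w u.
Proof.
elim: u => //= i v ->; rewrite life_lifetime.
have [_ dE _] := rw v; rewrite dE// fine_ge0// -life_lifetime; exact: life_ge0.
Qed.

(** A finite birth time forces finite lifetimes along the ancestral line, so the dislocations on it
    lie in [log_partitions] and have nonpositive coordinates. This rules out [+oo], on which
    [exp_at] and [position] would disagree. *)
Lemma birth_place_lty (t : R) u : (birth_time F w u <= t%:E)%E -> (birth_place theta F w u < +oo)%E.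
Proof.
elim: u t => [//|i v IH] t /= bt; first by rewrite ltry.
have b0 : (0 <= birth_time F w v)%E by rewrite -birth_birth_time; exact: birth_ge0.
have l0 : (0 <= lifetime F v w)%E by rewrite -life_lifetime; exact: life_ge0.
have lfin : lifetime F v w <> +oo%E.
  by move=> ly; move: bt; rewrite ly addey ?gt_eqF// (lt_le_trans _ b0).
have pv : (birth_place theta F w v < +oo)%E.
  by apply: (IH t); apply: le_trans bt; rewrite leeDl.
have [_ _ [[rm r0 _]|//]] := rw v.
have ri : (dislocation F v w i <= 0)%E by elim: i {bt} => // i; exact: le_trans.
apply: lte_add_pinfty; last by apply: le_lt_trans ri _; rewrite ltry.
by rewrite lte_add_pinfty ?ltry// lte_mul_pinfty// lee_fin expR_ge0.
Qed.

Lemma alive_weightE (t q : R) u :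
  (alive_weight theta F t q u w)%:E =
  (if u \in alive theta F w t then (expR (q * position theta F w t u))%:E else 0)%E.
Proof.
rewrite /alive_weight life_lifetime birth_birth_time place_birth_place.
case: ifPn => [/andP[bt tb]|nbt]; last first.
  rewrite ifF//; apply/negbTE; rewrite notin_setE => -[_ bt tb].
  by move: nbt; rewrite bt tb.
have b0 : (0 <= birth_time F w u)%E by rewrite -birth_birth_time; exact: birth_ge0.
have bfin : birth_time F w u \is a fin_num.
  by rewrite ge0_fin_numE// (le_lt_trans bt) ?ltry.
have [_ dE _] := rw u.
have x0 : 0 <= t - fine (birth_time F w u) by rewrite subr_ge0 -lee_fin fineK.
rewrite dE//=; have := birth_place_lty bt.
case pE : (birth_place theta F w u) => [a| |] //= _; last first.
  by rewrite mul0r ifF//; apply/negbTE; rewrite notin_setE => -[]; rewrite pE eqxx.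
rewrite ifT; last by rewrite inE; split; rewrite ?pE.
rewrite -expRD /position pE /discounted; congr (expR _)%:E => /=; ring.
Qed.

Lemma alive_sum (t q : R) :
  (\esum_(u in [set: seq nat]) (alive_weight theta F t q u w)%:E =
   \esum_(z in [set: R]) ((expR (q * z))%:E * population theta F w t z))%E.
Proof.
transitivity (\esum_(u in alive theta F w t) (expR (q * position theta F w t u))%:E)%E.
  by rewrite [RHS]esum_mkcond; apply: eq_esum => u _; exact: alive_weightE.
rewrite (@esum_fibers _ _ _ (position theta F w t) (fun z => expR (q * z)))//.
by move=> z; exact: expR_gt0.
Qed.

End regular.
End identification.

Lemma ereal_nondecreasing_le_lim (R : realType) (u : nat -> \bar R) (x : \bar R) :
  nondecreasing_seq u -> u n @[n --> \oo] --> x -> forall n, (u n <= x)%E.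
Proof.
move=> nd cu n; rewrite (cvg_unique (@ereal_hausdorff R) cu (ereal_nondecreasing_cvgn nd)).
by apply: ereal_sup_ubound; exists n.
Qed.

(** * Passage to the limit *)

Section limit.
Context {R : realType}.
Variables (sigma c theta : R) (nu : {measure set (seqspace R) -> \bar R}).
Hypothesis nu_support : nu (~` mass_partitions) = 0%E.
Hypothesis nu_integrable :
  (\int[nu]_(s in mass_partitions) ((1 - s 0%N) ^+ 2)%:E < +oo)%E.
Variables (t q : R).
Hypothesis q0 : 0 <= q.

Let integrated n := (\int[lebesgue_measure]_(s in `[0%R, t])
  log_cumulant sigma c (truncated_measure nu n%:R) (q * expR (- theta * s)))%E.

Let pw_ge0 s : 0 <= q * expR (- theta * s).
Proof. by rewrite mulr_ge0// expR_ge0. Qed.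

Section family.
Context d (Omega : measurableType d) (P : probability Omega R).
Variable F : R -> branching_family Omega R.
Hypothesis HF : forall l, 0 <= l ->
  OU_branching_family P sigma c (truncated_measure nu l) theta (F l).

Let fb n : finite_birth_measure (truncated_measure nu n%:R).
Proof. by have [] := HF (ler0n R n). Qed.

Lemma cumulant_truncatedE n s :
  log_cumulant sigma c (truncated_measure nu n%:R) (q * expR (- theta * s)) =
  (finite_cumulant sigma c (truncated_measure nu n%:R) (q * expR (- theta * s)))%:E.
Proof. exact: log_cumulant_finite (fb n) (pw_ge0 s). Qed.

Lemma nondecreasing_finite_cumulant s :
  nondecreasing_seq (fun n => finite_cumulant sigma c (truncated_measure nu n%:R)
    (q * expR (- theta * s))).
Proof.
move=> n m nm; rewrite -lee_fin -!cumulant_truncatedE.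
by apply: log_cumulant_truncated_le; rewrite ?ler_nat.
Qed.

Lemma integrated_cvg : integrated n @[n --> \oo] -->
  (\int[lebesgue_measure]_(s in `[0%R, t]) cumulant sigma c nu (q * expR (- theta * s)))%E.
Proof.
have -> : integrated = fun n => (\int[lebesgue_measure]_(s in `[0%R, t])
    (finite_cumulant sigma c (truncated_measure nu n%:R) (q * expR (- theta * s)))%:E)%E.
  by apply/funext => n; apply: eq_integral => s _; exact: cumulant_truncatedE.
apply: cvg_integral_nondecreasing => //.
- by move=> n; exact: (integrable_finite_cumulant (HF (ler0n R n)) t q0).
- by move=> s _; exact: nondecreasing_finite_cumulant.
- move=> s _; under eq_fun do rewrite -cumulant_truncatedE.
  exact: log_cumulant_truncated_cvg.
Qed.

Lemma integrated_nondecreasing : nondecreasing_seq integrated.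
Proof.
move=> n m nm; rewrite /integrated.
under eq_integral do rewrite cumulant_truncatedE.
under [leRHS]eq_integral do rewrite cumulant_truncatedE.
apply: le_integral => //.
- exact: (integrable_finite_cumulant (HF (ler0n R n)) t q0).
- exact: (integrable_finite_cumulant (HF (ler0n R m)) t q0).
- by move=> s _; rewrite lee_fin nondecreasing_finite_cumulant.
Qed.

Lemma integrated_le n : (integrated n <=
  \int[lebesgue_measure]_(s in `[0%R, t]) cumulant sigma c nu (q * expR (- theta * s)))%E.
Proof.
exact: ereal_nondecreasing_le_lim integrated_nondecreasing integrated_cvg n.
Qed.

End family.
End limit.

Lemma cut_population_le d (Omega : measurableType d) (R : realType)
    (theta : R) (F : branching_family Omega R) (w : Omega) (l t z : R) :
  (cut_population theta F w l t z <= population theta F w t z)%E.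
Proof. by apply: counting_le => u [_ al pos]. Qed.

(** Cutting only removes individuals, so consistency makes populations increase with the level, and
    integer levels are cofinal among the real ones. *)
Lemma population_sup d (Omega : measurableType d) (R : realType)
    (theta t : R) (F : R -> branching_family Omega R) (w : Omega) :
  (forall l' l, 0 <= l' -> l' < l ->
     cut_population theta (F l) w l' t = population theta (F l') w t) ->
  (forall z, nondecreasing_seq (fun n : nat => population theta (F n%:R) w t z)) /\
  (forall z, ereal_sup [set population theta (F l) w t z | l in [set l | 0 <= l]] =
     ereal_sup (range (fun n : nat => population theta (F n%:R) w t z))).
Proof.
move=> cutE.
have mono l l' z : 0 <= l' -> l' <= l ->
    (population theta (F l') w t z <= population theta (F l) w t z)%E.
  move=> l'0; rewrite le_eqVlt => /predU1P[->//|ll'].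
  by rewrite -(cutE _ _ l'0 ll'); exact: cut_population_le.
split => [z n m nm|z]; first by apply: mono; rewrite ?ler_nat.
apply/eqP; rewrite eq_le; apply/andP; split; apply: ge_ereal_sup => _ [l l0 <-].
  have h : l <= (Num.truncn l).+1%:R by rewrite ltW// truncnS_gt.
  by apply: le_trans (mono _ _ z l0 h) _; apply: ereal_sup_ubound; exists (Num.truncn l).+1.
by apply: ereal_sup_ubound; exists l%:R => //=.
Qed.

Theorem theorem3p1 (R : realType) (d : measure_display)
    (Omega : measurableType d) (P : probability Omega R)
    (sigma c theta : R) (nu : {measure set (seqspace R) -> \bar R})
    (X : R -> nat -> {RV P >-> R})
    (theta_neq0 : theta != 0)
    (sigma_ge0 : 0 <= sigma)
    (nu_sigma_finite : sigma_finite setT nu)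
    (nu_support : nu (~` mass_partitions) = 0%E)
    (nu_unit : nu [set (fun i => if i == 0%N then 1 else 0)] = 0%E)
    (nu_integrable :
       (\int[nu]_(s in mass_partitions) ((1 - s 0%N) ^+ 2)%:E < +oo)%E)
    (X_OU : OU_growth_fragmentation P sigma c nu theta X)
    (t alpha q : R)
    (t_ge0 : 0 <= t)
    (alpha_ge0 : 0 <= alpha)
    (cumulant_alpha : (cumulant sigma c nu alpha < +oo)%E)
    (q_ge : alpha * Num.max 1 (expR (theta * t)) <= q) :
  (\int[P]_w (\sum_(i <oo) (pow0 (X t i w) q)%:E) =
   expeR (\int[lebesgue_measure]_(s in `[0%R, t])
            cumulant sigma c nu (q * expR (- theta * s))))%E.
Proof.
have q0 : 0 <= q.
  by apply: le_trans q_ge; rewrite mulr_ge0// le_max ler01.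
have [Z [F [HF aecut ZE]] aeX] := X_OU.
set x := (\int[lebesgue_measure]_(s in _) _)%E.
pose S w := (\sum_(i <oo) (pow0 (X t i w) q)%:E)%E.
pose U n w := (\esum_(u in [set: seq nat]) (alive_weight theta (F n%:R) t q u w)%:E)%E.
pose y n := (\int[lebesgue_measure]_(s in `[0%R, t])
  log_cumulant sigma c (truncated_measure nu n%:R) (q * expR (- theta * s)))%E.
have HF' n : OU_branching_family P sigma c (truncated_measure nu n%:R) theta (F n%:R).
  exact: HF.
have EU n : (\int[P]_w U n w = expeR (y n))%E by exact: (mean_alive_cumulant (HF' n) t_ge0 q0).
have yx : y n @[n --> \oo] --> x
  by exact: (@integrated_cvg _ _ _ _ _ nu_support nu_integrable t q q0 _ _ _ _ HF).
have y_le n : (y n <= x)%E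
  by exact: (@integrated_le _ _ _ _ _ nu_support nu_integrable t q q0 _ _ _ _ HF).
have mU n : measurable_fun setT (U n) by exact: (measurable_alive_sum (HF' n)).
have U0 n w : (0 <= U n w)%E by apply: esum_ge0 => u _; rewrite lee_fin alive_weight_ge0.
have S0 w : (0 <= S w)%E.
  apply: nneseries_ge0 => i _ _; rewrite lee_fin /pow0.
  by case: ifP => // _; exact: powR_ge0.
have mS : measurable_fun setT S.
  apply: ge0_emeasurable_sum => i.
    by move=> w _ _; rewrite lee_fin /pow0; case: ifP => // _; exact: powR_ge0.
  move=> _; apply/measurable_EFinP; apply: measurable_fun_ifT => //.
    apply: measurable_fun_eqr => //.
  exact: (measurableT_comp (measurable_powR q)).
have aeU : \forall w \ae P, (forall n, (U n w <= S w)%E) /\ U n w @[n --> \oo] --> S w.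
  have aereg := ae_foralln (fun n => ae_regular (HF' n)).
  apply: filterS3 aereg aecut aeX => w reg cut /(_ t t_ge0) rearr.
  have [nd supE] := population_sup (fun l' l l0 ll => cut l' l l0 ll t t_ge0).
  have UE : U ^~ w = fun n => (\esum_(z in [set: R])
      ((expR (q * z))%:E * population theta (F n%:R) w t z))%E.
    by apply/funext => n; exact: alive_sum (reg n) _ _.
  have Ucvg : U n w @[n --> \oo] --> S w.
    rewrite /S (exp_rearrangement_sum q rearr) UE (ZE t w t_ge0).
    apply: esum_cvg_sup => // [z|n z]; first exact: expR_gt0.
    by rewrite /population /counting; case: ifP.
  split => //; apply: ereal_nondecreasing_le_lim Ucvg; rewrite UE => n m nm.
  by apply: le_esum => z _; rewrite lee_pmul2l ?lte_fin ?expR_gt0//; exact: nd.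
apply/eqP; rewrite eq_le; apply/andP; split.
  (* Upper bound: [U n] converges almost surely to [S], and its mean [expeR (y n)] is at most
     [expeR x] since [y n <= x]. *)
  apply: (ae_fatou mU mS U0 S0); first by apply: filterS aeU => w [].
  by move=> n; rewrite EU lee_expeR.
have ES0 : (0 <= \int[P]_w S w)%E by apply: integral_ge0 => w _; exact: S0.
(* Lower bound: with the mean of [S] written as [expeR v], possibly infinite, the bounds on the
   means of [U n] become [y n <= v], and the limit is taken in the exponents. *)
have [v vE] := expeR_total ES0.
rewrite -[leRHS]/(\int[P]_w S w)%E -vE lee_expeR.
apply: (cvge_to_le yx); apply: nearW => n; rewrite -lee_expeR vE -EU.
apply: ae_ge0_le_integral => //.
by apply: filterS aeU => w [h _] _.
Qed.
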